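(* Let $k>0$, $f:\mathbb{R}\to\mathbb{R}$ smooth and $u_0>u_i$ be fixed with $\sigma=\frac{f(u_0)-f(0)}{u_0}>0$. For any $q\in\mathbb{R}$ such that a detonation wave $(\underline{u},\underline{z})$ of the inviscid Majda model with $\underline{u}(0^-)=u_0$ exists (in the sense defined in the context), there exist $\vartheta>0$, $C>0$ and $\eta>0$ such that for every $T>0$ and every perturbative solution $(v,\zeta)$ defined on $[0,T]$ with $\|(v(t,\cdot),\zeta(t,\cdot))\|_{W^{1,\infty}(\mathbb{R}^* )}<\eta$ on $[0,T]$, one has, for every $t\in[0,T]$, $$\|(v(t,\cdot),\zeta(t,\cdot))\|_{H^2_\varepsilon(\mathbb{R}^* )}\le Ce^{-\vartheta t}\|(v(0),\zeta(0))\|_{H^2_\varepsilon(\mathbb{R}^* )}+\int_0^tCe^{-\vartheta(t-s)}\|(v(s),\zeta(s))\|_{L^2_\varepsilon(\mathbb{R}^* )}\,ds.$$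
   Context: Majda model: $u_t+f(u)_x=kq\,\phi(u)z$, $z_t=-k\phi(u)z$, with scalar $u,z$, where $u_i>0$ is fixed, $\phi(u)=1$ if $u>u_i$ and $\phi(u)=0$ if $u\le u_i$. Detonation wave with $\underline{u}(0^-)=u_0$: a traveling wave $(\underline{u},\underline{z})(x-\sigma t)$ with a single jump at $0$, where $u_0>u_i$; for $x>0$, $\underline{u}(x)=0$, $\underline{z}(x)=1$; for $x<0$, $\underline{z}(x)=e^{kx/\sigma}$ and $\underline{u}$ is the smooth solution on $(-\infty,0]$ of $\underline{u}'(x)=\frac{kq\,e^{kx/\sigma}}{f'(\underline{u}(x))-\sigma}$, $\underline{u}(0)=u_0$; moreover $\inf_{\mathbb{R}_-}\underline{u}>u_i$, $\inf_{x<0}f'(\underline{u}(x))>\sigma$ and $\sigma>f'(0)$. Perturbative solution on $[0,T]$: $v(t,x)=u(t,x+\psi(t))-\underline{u}(x)$, $\zeta(t,x)=z(t,x+\psi(t))-\underline{z}(x)$ for $x\in\mathbb{R}^*=\mathbb{R}\setminus\{0\}$, where $(u,z)$ solves the Majda model on each side of the shock $x=\psi(t)$, $\psi(0)=0$, with the Rankine–Hugoniot conditions $\psi'(t)=\frac{f(u(t,\psi(t)^-))-f(u(t,\psi(t)^+))}{u(t,\psi(t)^-)-u(t,\psi(t)^+)}$, $z(t,\psi(t)^-)=z(t,\psi(t)^+)$, and where the initial perturbation $(v(0),\zeta(0))$ is smooth and compactly supported in $\mathbb{R}^*$. Weighted spaces: $H^m_\varepsilon(\mathbb{R}^* )=\{w\in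 H^m(\mathbb{R}^* ):(\partial_x^lw)^2e^{\varepsilon|\cdot|}\in L^1,\ 0\le l\le m\}$ with its natural norm, and $L^2_\varepsilon=H^0_\varepsilon$. Here $\varepsilon=k/\nu$, where $\nu>\sigma$ is a fixed constant, $\eta$ being taken small enough that $\psi'(t)<\nu$ for perturbations of sup norm smaller than $\eta$. *)

(* Defs.v *)
From HB Require Import structures.
From mathcomp Require Export all_boot all_order all_algebra.
From mathcomp Require Export all_classical all_reals all_analysis.

Set Implicit Arguments.
Unset Strict Implicit.
Unset Printing Implicit Defensive.

Export Order.TTheory GRing.Theory Num.Theory numFieldNormedType.Exports.

Local Open Scope ring_scope.
Local Open Scope classical_set_scope.

Definition smooth_on {R : realType} (D : set R) (g : R -> R) : Prop :=
  forall (n : nat) (x : R), D x -> derivable (derive1n n g) x 1.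

Definition smooth {R : realType} (g : R -> R) : Prop := smooth_on setT g.

(* Functions of time and space take their arguments in the order t, x. *)
Definition dt {R : realType} (g : R -> R -> R) : R -> R -> R :=
  fun t x => derive1 (fun s => g s x) t.

Definition dx {R : realType} (g : R -> R -> R) : R -> R -> R :=
  fun t x => derive1 (g t) x.

Fixpoint C2d {R : realType} (n : nat) (g : R -> R -> R) : Prop :=
  continuous (fun p : R * R => g p.1 p.2) /\
  if n is m.+1 then
    (forall t x, derivable (fun s => g s x) t 1 /\ derivable (g t) x 1) /\
    C2d m (dt g) /\ C2d m (dx g)
  else True.

Definition smooth2 {R : realType} (g : R -> R -> R) : Prop :=
  forall n, C2d n g.

(* g is smooth on D up to the boundary of D, expressed as being on D the
   restriction of a smooth function of the whole plane. *)
Definition smooth2_upto {R : realType} (D : R -> R -> Prop) (g : R -> R -> R) :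
  Prop :=
  exists G : R -> R -> R, smooth2 G /\ forall t x, D t x -> g t x = G t x.

Definition ltrace {R : realType} (g : R -> R) (a : R) : R :=
  lim (g x @[x --> a^'-]).

Definition rtrace {R : realType} (g : R -> R) (a : R) : R :=
  lim (g x @[x --> a^'+]).

(* Norms over R^* = R \ {0}, for functions that are smooth on R^*: their weak
   derivatives on R^* are then their classical ones. The norms take values in
   \bar R, the value +oo meaning that the function is not in the space. *)

Definition Rstar {R : realType} : set R := [set x | x <> 0].

(* The point 0 is Lebesgue-negligible, so that essential suprema over R^* and
   over R coincide; the derivative is never integrated across 0. *)
Definition W1oo_norm {R : realType} (v zeta : R -> R) : \bar R :=
  (maxe (maxe 'N[@lebesgue_measure R]_+oo[EFin \o v]
              'N[@lebesgue_measure R]_+oo[EFin \o derive1 v])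
        (maxe 'N[@lebesgue_measure R]_+oo[EFin \o zeta]
              'N[@lebesgue_measure R]_+oo[EFin \o derive1 zeta]))%E.

Definition wHnorm {R : realType} (m : nat) (eps : R) (v zeta : R -> R) :
  \bar R :=
  ((\sum_(l < m.+1)
     \int[@lebesgue_measure R]_(x in Rstar)
       ((((derive1n l v x) ^+ 2 + (derive1n l zeta x) ^+ 2)
          * expR (eps * `|x|))%:E)) `^ 2^-1)%E.

Definition ignition {R : realType} (u_i u : R) : R := if u_i < u then 1 else 0.

Record detonation_wave {R : realType} (f : R -> R) (k q u_i u0 sigma : R)
    (ubar zbar : R -> R) : Prop := DetonationWave {
  wave_ahead : forall x : R, 0 < x -> ubar x = 0 /\ zbar x = 1 ;
  wave_zbar : forall x : R, x < 0 -> zbar x = expR (k * x / sigma) ;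
  (* U is the restriction of ubar to the negative half-line, smooth up to 0:
     its value at 0 is the left trace of ubar. *)
  wave_ubar : exists U : R -> R,
    [/\ smooth U, U 0 = u0,
        forall x : R, x < 0 -> ubar x = U x &
        forall x : R, x <= 0 ->
          derive1 U x = k * q * expR (k * x / sigma) / (derive1 f (U x) - sigma)] ;
  wave_ignited :
    (u_i%:E < ereal_inf [set (ubar x)%:E | x in [set x : R | (x < 0)%R]])%E ;
  wave_behind :
    (sigma%:E < ereal_inf [set (derive1 f (ubar x))%:E | x in [set x : R | (x < 0)%R]])%E ;
  wave_lax : derive1 f 0 < sigma }.

(* Perturbation, in the frame of the shock, of the profile wbar by w. *)
Definition pert {R : realType} (psi : R -> R) (wbar : R -> R)
    (w : R -> R -> R) (t x : R) : R :=
  w t (x + psi t) - wbar x.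

Record perturbative_solution {R : realType} (f : R -> R) (k q u_i : R)
    (ubar zbar : R -> R) (T : R) (psi : R -> R) (u z : R -> R -> R) : Prop :=
  PerturbativeSolution {
  pert_psi0 : psi 0 = 0 ;
  pert_psi_cont : {within `[0, T], continuous psi} ;
  pert_smooth_l : forall w, w = u \/ w = z ->
    smooth2_upto (fun t x : R => 0 <= t <= T /\ x < psi t) w ;
  pert_smooth_r : forall w, w = u \/ w = z ->
    smooth2_upto (fun t x : R => 0 <= t <= T /\ psi t < x) w ;
  pert_eq_u : forall t x : R, 0 < t < T -> x <> psi t ->
    dt u t x + dx (fun s y => f (u s y)) t x
      = k * q * ignition u_i (u t x) * z t x ;
  pert_eq_z : forall t x : R, 0 < t < T -> x <> psi t ->
    dt z t x = - k * ignition u_i (u t x) * z t x ;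
  pert_RH_u : forall t : R, 0 < t < T ->
    is_derive t 1 psi
      ((f (ltrace (u t) (psi t)) - f (rtrace (u t) (psi t)))
         / (ltrace (u t) (psi t) - rtrace (u t) (psi t))) ;
  pert_RH_z : forall t : R, 0 < t < T ->
    ltrace (z t) (psi t) = rtrace (z t) (psi t) ;
  pert_init_smooth :
    smooth_on Rstar (pert psi ubar u 0) /\ smooth_on Rstar (pert psi zbar z 0) ;
  pert_init_supp : exists K : set R,
    [/\ compact K, K `<=` Rstar &
        forall x, Rstar x -> ~ K x ->
          pert psi ubar u 0 x = 0 /\ pert psi zbar z 0 x = 0] }.

(* Main.v *)
Require Import Defs.
From mathcomp Require Import ring lra.
From mathcomp Require Import measurable_realfun ess_sup_inf.

Set Implicit Arguments.
Unset Strict Implicit.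
Unset Printing Implicit Defensive.

(** The estimate is a weighted energy estimate at the level of second derivatives.

    In the frame of the front, with the half line ahead reflected onto x <= 0, let V j and Z j be the
    j-th space derivatives (j <= 2) of the perturbations of u and z behind the front, and Y j and P j
    those ahead.  Each is transported, h_t + a h_x = F on x <= 0.  By the Lax inequalities and
    as sigma > 0, the speed a is at least some c1 > 0 for V, Y and P, which therefore leave through
    x = 0; it is - psi' for Z, which enters there.  In terms of the energy with weight expR (- eps * x):

    - an outgoing component moves towards smaller weights and so decays at rate eps * c1.  The linear
      terms that are not small have size expR (kap * x), because the wave is steep only near the front
      (lemma profile_bound), and the additional factor expR (- B * expR (kap * x)) of the weight
      absorbs them (lemma outgoing_balance);
    - Z moves towards larger weights, at a cost eps * psi' <= eps * nu = k, which is half of its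
      reaction rate 2 * k (lemma incoming_balance).  This is what the choice eps = k / nu is for.

    At x = 0 the outgoing components release a term c1 * h ^ 2, and everything entering there is
    paid with it: the Rankine-Hugoniot relation bounds psi' - sigma by the traces of V 0 and Y 0,
    continuity of z gives Z 0 = P 0, and this identity differentiated along the front expresses the
    traces of Z 1 and Z 2 by those of P, V and Y (lemmas trace1_bound and trace2_bound).  The
    components of levels 1 and 2 are forced by each other and through the front; all of this is
    absorbed by giving the squares multipliers M0 >> N1 >> M1 >> N2 >> 1 (lemma multipliers).  What is
    left is the forcing by level 0, that is, by the weighted L2 norm of the perturbation, and a
    Gronwall argument for the square root of the energy (lemma gronwall_sqrt) gives theorem
    frame_energy.

    Energies are computed on a segment [- N, 0] with a cutoff whose support shrinks at a speed that no
    transport speed exceeds, so that its derivative only contributes a term of good sign.  Letting N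
    tend to infinity turns the cut-off masses into weighted norms (theorem norm_estimate).  That a
    perturbative solution close to the wave satisfies the hypotheses of the energy estimate is theorem
    perturbation_frame. *)

Local Open Scope ring_scope.
Local Open Scope classical_set_scope.

(** * Derivatives in one variable *)

Ltac nonneg := repeat (first [ assumption | exact: ltW | exact: sqr_ge0 | exact: normr_ge0
  | exact: expR_ge0 | exact: ler0n | apply: mulr_ge0 | apply: addr_ge0 | apply: exprn_ge0 | (rewrite invr_ge0)
  | apply: sumr_ge0 => * | done ]).

Section calculus.
Context {R : realType}.
Implicit Types (f g h : R -> R) (x y t a b : R).

Lemma deriveE f x : derivable f x 1 -> is_derive x 1 f (derive1 f x).
Proof. by move=> d; rewrite derive1E; apply: DeriveDef. Qed.

Lemma derive1_is f x d : is_derive x 1 f d -> derive1 f x = d.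
Proof. by move=> h; rewrite derive1E derive_val. Qed.

Lemma is_derive_cont f x d : is_derive x 1 f d -> {for x, continuous f}.
Proof. by move=> h; apply: differentiable_continuous; apply/derivable1_diffP. Qed.

Lemma derivD f g x df dg : is_derive x 1 f df -> is_derive x 1 g dg ->
  is_derive x 1 (fun y => f y + g y) (df + dg).
Proof. by move=> ? ?; exact: is_deriveD. Qed.

Lemma derivB f g x df dg : is_derive x 1 f df -> is_derive x 1 g dg ->
  is_derive x 1 (fun y => f y - g y) (df - dg).
Proof. by move=> ? ?; exact: is_deriveB. Qed.

Lemma derivN f x df : is_derive x 1 f df -> is_derive x 1 (fun y => - f y) (- df).
Proof. by move=> ?; exact: is_deriveN. Qed.

Lemma derivM f g x df dg : is_derive x 1 f df -> is_derive x 1 g dg ->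
  is_derive x 1 (fun y => f y * g y) (df * g x + f x * dg).
Proof.
move=> df_ dg_; rewrite [X in is_derive _ _ _ X](_ : _ = f x *: dg + g x *: df).
  exact: is_deriveM.
by rewrite addrC /GRing.scale /= (mulrC (g x)).
Qed.

Lemma derivC c x : is_derive x 1 (fun=> c : R) 0.
Proof. exact: is_derive_cst. Qed.

Lemma derivid x : is_derive x 1 (fun y : R => y) 1.
Proof. exact: is_derive_id. Qed.

Lemma derivZ c f x df : is_derive x 1 f df ->
  is_derive x 1 (fun y => c * f y) (c * df).
Proof. by move=> ?; exact: is_deriveZ. Qed.

Lemma deriv2 f x df : is_derive x 1 f df ->
  is_derive x 1 (fun y => f y ^+ 2) (2 * f x * df).
Proof.
move=> d; under eq_fun do rewrite expr2.
by rewrite [X in is_derive _ _ _ X](_ : _ = df * f x + f x * df);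
  [exact: derivM|ring].
Qed.

Lemma deriv_comp f g x df dg : is_derive (g x) 1 f df -> is_derive x 1 g dg ->
  is_derive x 1 (fun y => f (g y)) (df * dg).
Proof. by move=> ? ?; exact: is_derive1_comp. Qed.

Lemma deriv_near f g x d : (\forall y \near x, f y = g y) ->
  is_derive x 1 f d -> is_derive x 1 g d.
Proof. by move=> fg; exact: near_eq_is_derive. Qed.

End calculus.

(** * Functions of time and space *)

Section calculus2.
Context {R : realType}.
Implicit Types (f g : R -> R) (x y t a b : R) (G : R -> R -> R).

(** The difference quotient is awkward to handle for functions known only through mean value
    bounds; this is the linearisation form of differentiability. *)
Lemma is_derive_eps f x d :
  (forall e, 0 < e -> \forall y \near x, `|f y - f x - d * (y - x)| <= e * `|y - x|) ->
  is_derive x 1 f d.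
Proof.
move=> H.
have C : (h^-1 *: ((f \o shift x) (h *: 1) - f x)) @[h --> 0^'] --> d.
  apply/cvgrPdist_le => e e0.
  have /nbhs0P Hn := H e e0; rewrite near_withinE; near=> h => h0.
  have : `|f (x + h) - f x - d * (x + h - x)| <= e * `|x + h - x| by near: h; exact: Hn.
  rewrite (addrC x) addrK /= /GRing.scale /= mulr1.
  rewrite (_ : d - _ = - (h^-1 * (f (h + x) - f x - d * h))); last by field.
  rewrite normrN normrM normfV ler_pdivrMl ?normr_gt0// (mulrC _ e).
move=> Q; exact Q.
by apply: DeriveDef; [apply/cvg_ex; exists d|exact: cvg_lim].
Unshelve. all: by end_near. Qed.

Definition cont2 G := continuous (fun p : R * R => G p.1 p.2).

Lemma continuous_pair (T U V : topologicalType) (f : T -> U) (g : T -> V) (p : T) :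
  {for p, continuous f} -> {for p, continuous g} ->
  {for p, continuous (fun r : T => (f r, g r))}.
Proof. by move=> cf cg; exact: (cvg_pair cf cg). Qed.

Lemma cont2_subst (T : topologicalType) G (g h : T -> R) : cont2 G ->
  continuous g -> continuous h -> continuous (fun p => G (g p) (h p)).
Proof.
move=> cG cg ch p.
apply: (@continuous_comp _ _ _ (fun p => (g p, h p)) (fun p => G p.1 p.2)).
  exact: continuous_pair (cg p) (ch p).
exact: cG.
Qed.

Lemma cont2_t G x : cont2 G -> continuous (fun t => G t x).
Proof. by move=> cG; apply: (cont2_subst cG) => t; [exact: cvg_id|exact: cvg_cst]. Qed.

Lemma cont2_x G t : cont2 G -> continuous (G t).
Proof. by move=> cG; apply: (cont2_subst cG) => x; [exact: cvg_cst|exact: cvg_id]. Qed.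

Lemma cont2_of_t f : continuous f -> cont2 (fun t _ => f t).
Proof. by move=> cf p; apply: (@continuous_comp _ _ _ fst f); [exact: cvg_fst|exact: cf]. Qed.

Lemma cont2_of_x f : continuous f -> cont2 (fun _ x => f x).
Proof. by move=> cf p; apply: (@continuous_comp _ _ _ snd f); [exact: cvg_snd|exact: cf]. Qed.

Lemma cont2D G H : cont2 G -> cont2 H -> cont2 (fun t x => G t x + H t x).
Proof. by move=> cG cH p; exact: (cvgD (cG p) (cH p)). Qed.

Lemma cont2N G : cont2 G -> cont2 (fun t x => - G t x).
Proof. by move=> cG p; exact: (cvgN (cG p)). Qed.

Lemma cont2B G H : cont2 G -> cont2 H -> cont2 (fun t x => G t x - H t x).
Proof. by move=> cG cH; apply: cont2D => //; exact: cont2N. Qed.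

Lemma cont2M G H : cont2 G -> cont2 H -> cont2 (fun t x => G t x * H t x).
Proof. by move=> cG cH p; exact: (cvgM (cG p) (cH p)). Qed.

Lemma cont2C c : cont2 (fun _ _ => c).
Proof. by move=> p; exact: cvg_cst. Qed.

Lemma cont2X G n : cont2 G -> cont2 (fun t x => G t x ^+ n).
Proof.
move=> cG; elim: n => [|n ih].
  by rewrite (_ : (fun _ _ => _) = fun _ _ => 1)//; exact: cont2C.
rewrite (_ : (fun _ _ => _) = fun t x => G t x * G t x ^+ n); first exact: cont2M.
by apply/funext => t; apply/funext => x; rewrite exprS.
Qed.

Lemma cont2_comp f G : continuous f -> cont2 G -> cont2 (fun t x => f (G t x)).
Proof.
by move=> cf cG p; apply: (@continuous_comp _ _ _ (fun p => G p.1 p.2) f); [exact: cG|exact: cf].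
Qed.

Lemma MVT_between f df a b : (forall x, is_derive x 1 f (df x)) ->
  exists2 c, (a <= c <= b) || (b <= c <= a) & f b - f a = df c * (b - a).
Proof.
move=> H.
have M a' b' : a' <= b' -> exists2 c, a' <= c <= b' & f b' - f a' = df c * (b' - a').
  move=> ab; have [c cab E] := @MVT_segment R f df a' b' ab (fun x _ => H x)
    (continuous_subspaceT (fun x => is_derive_cont (H x))).
  by exists c => //; move: cab; rewrite in_itv.
have [/M[c cab E]|/ltW/M[c cab E]] := leP a b; exists c => //; rewrite ?cab ?orbT//.
by rewrite -opprB E; ring.
Qed.

(** The increment of G in x is handled at the fixed time t by the one-variable chain rule, the increment
    in t by the mean value theorem at the moved point, where joint continuity of Gt is used. *)
Lemma chain_rule G Gt (xi : R -> R) t (Gx s : R) : cont2 Gt -> (forall t x, is_derive t 1 (G ^~ x) (Gt t x)) ->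
  is_derive (xi t) 1 (G t) Gx -> is_derive t 1 xi s ->
  is_derive t 1 (fun r => G r (xi r)) (Gt t (xi t) + Gx * s).
Proof.
move=> cGt dG dGx dxi.
rewrite (_ : (fun r => G r (xi r)) =
  (fun r => (G r (xi r) - G t (xi r)) + G t (xi r))); last by apply/funext=> r; ring.
suff A : is_derive t 1 (fun r => G r (xi r) - G t (xi r)) (Gt t (xi t)).
  exact: (derivD A (deriv_comp dGx dxi)).
apply: is_derive_eps => e e0.
have : {for (t, xi t), continuous (fun p : R * R => Gt p.1 p.2)} by exact: cGt.
move/cvgrPdist_le => /(_ e e0) /nbhs_ballP[d /= d0 Hd].
have cxi := is_derive_cont dxi.
near=> r.
have [c cb E] := MVT_between t r (fun r' => dG r' (xi r)).
rewrite E subrr subr0 -mulrBl normrM ler_wpM2r//.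
rewrite distrC; apply: (Hd (c, xi r)); split => /=.
  apply: (@le_lt_trans _ _ `|t - r|).
    have [tr|rt] := leP t r.
      rewrite !ler0_norm; lra.
    rewrite !ger0_norm; lra.
  by near: r; exact: nbhsx_ballx.
near: r; move/cvgrPdist_lt : cxi; exact.
Unshelve. all: by end_near. Qed.

(** The second difference of G over a square of side h, divided by h ^ 2, is by two applications of
    the mean value theorem a value of Gtx at one point of the square and of Gxt at another; let h
    tend to 0. *)
Lemma Clairaut G Gt Gx Gtx Gxt t x : cont2 Gtx -> cont2 Gxt ->
  (forall t x, is_derive t 1 (G ^~ x) (Gt t x)) ->
  (forall t x, is_derive x 1 (G t) (Gx t x)) ->
  (forall t x, is_derive x 1 (Gt t) (Gtx t x)) ->
  (forall t x, is_derive t 1 (Gx ^~ x) (Gxt t x)) ->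
  Gtx t x = Gxt t x.
Proof.
move=> c1 c2 dt_ dx_ dtx dxt.
have K h : 0 < h -> exists2 p : R * R * R * R,
    [/\ t <= p.1.1.1 <= t + h, x <= p.1.1.2 <= x + h,
      t <= p.1.2 <= t + h & x <= p.2 <= x + h] & Gtx p.1.1.1 p.1.1.2 = Gxt p.1.2 p.2.
  move=> h0.
  have [a1 Ha1 E1] := MVT_between t (t + h) (fun r => derivB (dt_ r (x + h)) (dt_ r x)).
  have [b1 Hb1 E1'] := MVT_between x (x + h) (dtx a1).
  have [b2 Hb2 E2] := MVT_between x (x + h) (fun r => derivB (dx_ (t + h) r) (dx_ t r)).
  have [a2 Ha2 E2'] := MVT_between t (t + h) (dxt ^~ b2).
  exists (a1, b1, a2, b2) => /=; first by split; lra.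
  have hh : h * h != 0 by rewrite mulf_neq0 ?gt_eqF.
  apply: (mulIf hh).
  rewrite E1' in E1; rewrite E2' in E2; lra.
apply/eqP; rewrite -subr_eq0 -normr_le0; apply/ler_addgt0Pr => e e0; rewrite add0r.
have e20 : 0 < e / 2 by lra.
have /cvgrPdist_le /(_ _ e20) /nbhs_ballP[d1 /= d10 H1] := c1 (t, x).
have /cvgrPdist_le /(_ _ e20) /nbhs_ballP[d2 /= d20 H2] := c2 (t, x).
pose h := Num.min d1 d2 / 2.
have m0 : 0 < Num.min d1 d2 by rewrite lt_min d10.
have h0 : 0 < h by rewrite divr_gt0.
have hd1 : h < d1.
  have : Num.min d1 d2 <= d1 by rewrite ge_min lexx.
  rewrite /h; lra.
have hd2 : h < d2.
  have : Num.min d1 d2 <= d2 by rewrite ge_min lexx orbT.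
  rewrite /h; lra.
have [[[[a1 b1] a2] b2] /= [A1 B1 A2 B2] E] := K h h0.
have {}H1 : `|Gtx t x - Gtx a1 b1| <= e / 2.
  by apply: (H1 (a1, b1)); split; rewrite /= /ball /= ler0_norm; lra.
have {}H2 : `|Gxt t x - Gxt a2 b2| <= e / 2.
  by apply: (H2 (a2, b2)); split; rewrite /= /ball /= ler0_norm; lra.
move: H1 H2; rewrite E !ler_norml; lra.
Qed.

Lemma deriv_pos2 x : is_derive x 1 (fun y => Num.max 0 y ^+ 2) (2 * Num.max 0 x).
Proof.
have [x0|x0|->] := ltgtP x 0.
- apply: (@deriv_near _ (fun=> 0)).
    near=> y; rewrite max_l ?expr0n//; apply: ltW; near: y; exact: lt_nbhsl.
  by rewrite mulr0; exact: derivC.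
- apply: (@deriv_near _ (fun y => y ^+ 2)).
    near=> y; rewrite max_r//; apply: ltW; near: y; exact: lt_nbhsr.
  have := deriv2 (derivid x); by rewrite mulr1.
- apply: is_derive_eps => e e0; near=> y.
  rewrite mulr0 mul0r !subr0 maxxx expr0n subr0.
  have ye : `|y| <= e.
    by near: y; apply/nbhs_ballP; exists e => //= y; rewrite /ball /= sub0r normrN => /ltW.
  have [y0|y0] := leP 0 y.
    by rewrite normrX expr2 ler_wpM2r.
  by rewrite expr0n normr0 mulr_ge0// ltW.
Unshelve. all: by end_near. Qed.

End calculus2.

(** * Integrals over segments *)

Section segment_integral.
Context {R : realType}.
Notation mu := (@lebesgue_measure R).
Implicit Types (f g : R -> R) (x y t a b : R) (G : R -> R -> R).

Definition sint a b f : R := \int[mu]_(x in `[a, b]) f x.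

Lemma cont_integrable a b f : continuous f -> mu.-integrable `[a, b] (EFin \o f).
Proof.
by move=> cf; apply: continuous_compact_integrable; [exact: segment_compact|exact: continuous_subspaceT].
Qed.

Lemma sintE a b f : continuous f -> (\int[mu]_(x in `[a, b]) (f x)%:E)%E = (sint a b f)%:E.
Proof.
move=> cf; rewrite /sint /Rintegral fineK//; apply: integrable_fin_num => //; exact: cont_integrable.
Qed.

Lemma sintD a b f g : continuous f -> continuous g ->
  sint a b (fun x => f x + g x) = sint a b f + sint a b g.
Proof. by move=> cf cg; rewrite /sint RintegralD//; exact: cont_integrable. Qed.

Lemma sintZ a b c f : continuous f -> sint a b (fun x => c * f x) = c * sint a b f.
Proof. by move=> cf; rewrite /sint RintegralZl//; exact: cont_integrable. Qed.

Lemma sint_le a b f g : continuous f -> continuous g ->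
  (forall x, a <= x <= b -> f x <= g x) -> sint a b f <= sint a b g.
Proof.
by move=> cf cg fg; apply: le_Rintegral => //; exact: cont_integrable.
Qed.

Lemma sint_ge0 a b f : (forall x, a <= x <= b -> 0 <= f x) -> 0 <= sint a b f.
Proof. by move=> f0; apply: Rintegral_ge0 => x /=; rewrite in_itv; exact: f0. Qed.

Lemma sint_eq a b f g : (forall x, a <= x <= b -> f x = g x) -> sint a b f = sint a b g.
Proof. by move=> fg; apply: eq_Rintegral => x; rewrite inE /= in_itv; exact: fg. Qed.

Lemma sint_FTC a b f F : a < b -> continuous f -> (forall x, is_derive x 1 F (f x)) ->
  sint a b f = F b - F a.
Proof.
move=> ab cf dF; rewrite /sint /Rintegral (@continuous_FTC2 _ f F)//.
- exact: continuous_subspaceT.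
- split; first by move=> x _; have [] := dF x.
  + by apply: cvg_at_right_filter; exact: (is_derive_cont (dF a)).
  + by apply: cvg_at_left_filter; exact: (is_derive_cont (dF b)).
- by move=> x _; rewrite (derive1_is (dF x)).
Qed.

Lemma cont2_bounded G a b c d : cont2 G ->
  exists2 M : R, 0 <= M & forall t x, a <= t <= b -> c <= x <= d -> `|G t x| <= M.
Proof.
move=> cG.
have K : compact (`[a, b]%classic `*` `[c, d]%classic : set (R * R)%type).
  by apply: compact_setX; exact: segment_compact.
have /compact_bounded[M [_ HM]] := @continuous_compact _ _ (fun p : R * R => G p.1 p.2) _
  (continuous_subspaceT cG) K.
exists (`|M| + 1); first by rewrite addr_ge0.
move=> t x tab xcd; apply: HM; first by rewrite (le_lt_trans (ler_norm _))// ltrDl.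
by exists (t, x) => //; split; rewrite /= in_itv.
Qed.

(** Dominated convergence, G being bounded on compact rectangles. *)
Lemma sint_cont G a b : cont2 G -> continuous (fun t => sint a b (G t)).
Proof.
move=> cG t.
have [M M0 HM] := cont2_bounded (t - 1) (t + 1) a b cG.
have H1 (x : R) : `]t - 1, t + 1[%classic x -> mu.-integrable `[a, b] (EFin \o G x).
  by move=> _; exact: (cont_integrable _ _ (cont2_x cG)).
have H2 : {ae mu, forall y, `[a, b]%classic y -> {in `]t - 1, t + 1[%classic, continuous (G ^~ y)}}.
  by apply: aeW => y _ r _; exact: (cont2_t cG).
have iM : mu.-integrable `[a, b] (EFin \o cst M) by apply: cont_integrable => ?; exact: cvg_cst.
have H3 (x : R) : `]t - 1, t + 1[%classic x -> {ae mu, forall y, `[a, b]%classic y -> `|G x y| <= cst M y}.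
  rewrite /= in_itv /= => /andP[r1 r2]; apply: aeW => y; rewrite /= in_itv /= => yab.
  by apply: HM => //; apply/andP; split; exact: ltW.
have C := @continuity_under_integral R _ _ mu G _ (measurable_itv _) _ _ H1 H2 _ iM H3.
apply: (C t).
by rewrite inE /= in_itv /=; lra.
Qed.

Lemma sint_deriv G Gt a b t u v : cont2 G -> cont2 Gt -> u < t < v ->
  (forall r x, u < r < v -> is_derive r 1 (G ^~ x) (Gt r x)) ->
  is_derive t 1 (fun t => sint a b (G t)) (sint a b (Gt t)).
Proof.
move=> cG cGt tuv dG.
have [M M0 HM] := cont2_bounded u v a b cGt.
have It : t \in `]u, v[%R by rewrite in_itv.
have H1 (x : R) : `]u, v[%classic x -> mu.-integrable `[a, b] (EFin \o G x).
  by move=> _; exact: (cont_integrable _ _ (cont2_x cG)).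
have H2 (x y : R) : `]u, v[%classic x -> `[a, b]%classic y -> derivable (G ^~ y) x 1.
  by rewrite /= in_itv => /(dG x y)[].
have H3 (x y : R) : `]u, v[%classic x -> `[a, b]%classic y -> `|partial1of2 G x y| <= M.
  rewrite /= !in_itv /= => xuv yab; rewrite /partial1of2 (derive1_is (dG x y xuv)).
  by apply: HM => //; case/andP: xuv => *; apply/andP; split; exact: ltW.
have iM : mu.-integrable `[a, b] (EFin \o cst M) by apply: cont_integrable => ?; exact: cvg_cst.
have d := @derivable_under_integral R _ _ mu G _ (measurable_itv _) _ _ _ It H1 H2 _ (fun=> M0) iM H3.
have E := @differentiation_under_integral R _ _ mu G _ (measurable_itv _) _ _ _ It H1 H2 _ (fun=> M0) iM H3.
have := deriveE d; rewrite E.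
rewrite (_ : \int[_]_(y in _) _ = sint a b (Gt t))//.
by apply: sint_eq => y _; rewrite /partial1of2 (derive1_is (dG t y tuv)).
Qed.

Lemma sint_primitive f t : continuous f -> 0 < t ->
  is_derive t 1 (fun t => sint 0 t f) (f t).
Proof.
move=> cf t0; have tt : t < t + 1 by rewrite ltrDl.
have [d E] := continuous_FTC1_closed tt (cont_integrable 0 (t + 1) cf) t0 (cf t).
by rewrite -E; exact: deriveE.
Qed.

Lemma sint_primitive_cont f T : continuous f -> 0 <= T ->
  {within `[0, T], continuous (fun t => sint 0 t f)}.
Proof. by move=> cf T0; apply: parameterized_integral_continuous => //; exact: cont_integrable. Qed.

Lemma sint_opp a b f : a <= b -> continuous f ->
  sint a b (fun x => f (- x)) = sint (- b) (- a) f.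
Proof.
move=> ab cf; rewrite /sint /Rintegral integration_by_substitution_oppr//.
exact: continuous_subspaceT.
Qed.

End segment_integral.

(** * A Gronwall inequality for square roots of energies *)

Section gronwall.
Context {R : realType}.

Lemma decreasing_on (F F' : R -> R) (a b : R) : {within `[a, b], continuous F} ->
  (forall x, a < x < b -> is_derive x 1 F (F' x)) ->
  (forall x, a < x < b -> F' x <= 0) -> a <= b -> F b <= F a.
Proof.
move=> cF dF F0 ab.
have H1 x : x \in `]a, b[%R -> derivable F x 1 by rewrite in_itv => /dF[].
have H2 x : x \in `]a, b[%R -> derive1 F x <= 0.
  by rewrite in_itv => /= xab; rewrite (derive1_is (dF x xab)) F0.
by apply: (ler0_derive1_le_cc H1 H2 cF); rewrite ?in_itv /= ?lexx ?ab.
Qed.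

Lemma derivE (x : R) : is_derive x 1 (@expR R) (expR x).
Proof. exact: is_derive_expR. Qed.

Lemma derivEX (c x : R) : is_derive x 1 (fun x => expR (c * x)) (c * expR (c * x)).
Proof.
have := deriv_comp (derivE (c * x)) (derivZ c (derivid x)).
by rewrite mulr1 mulrC.
Qed.

Lemma contEX (c : R) : continuous (fun x => expR (c * x)).
Proof. by move=> x; exact: (is_derive_cont (derivEX c x)). Qed.

Lemma contD (f g : R -> R) : continuous f -> continuous g -> continuous (fun x => f x + g x).
Proof. by move=> cf cg x; exact: (cvgD (cf x) (cg x)). Qed.

Lemma contB (f g : R -> R) : continuous f -> continuous g -> continuous (fun x => f x - g x).
Proof. by move=> cf cg x; exact: (cvgB (cf x) (cg x)). Qed.

Lemma contM (f g : R -> R) : continuous f -> continuous g -> continuous (fun x => f x * g x).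
Proof. by move=> cf cg x; exact: (cvgM (cf x) (cg x)). Qed.

Lemma contC (c : R) : continuous (fun _ : R => c).
Proof. by move=> x; exact: cvg_cst. Qed.

Lemma contsqrt (f : R -> R) : continuous f -> continuous (fun x => Num.sqrt (f x)).
Proof.
move=> cf x; apply: (@continuous_comp _ _ _ f Num.sqrt); first exact: cf.
exact: sqrt_continuous.
Qed.

(** For y = sqrt E the hypothesis reads y' <= - theta * y + D * sqrt L, and the conclusion is Duhamel's
    formula.  As E may vanish, y is replaced by sqrt (E + d ^ 2) with d > 0, which costs an error
    proportional to d, and d tends to 0. *)
Lemma gronwall_sqrt (E E' L : R -> R) (T theta D : R) :
  0 <= theta -> 0 <= D ->
  continuous E -> continuous L -> (forall t, 0 <= E t) ->
  (forall t, 0 < t < T -> is_derive t 1 E (E' t)) ->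
  (forall t, 0 < t < T -> E' t <= - (2 * theta) * E t + 2 * D * (Num.sqrt (E t) * Num.sqrt (L t))) ->
  forall t, 0 <= t <= T -> Num.sqrt (E t) <= expR (- theta * t) * Num.sqrt (E 0)
    + sint 0 t (fun s => D * expR (- theta * (t - s)) * Num.sqrt (L s)).
Proof.
move=> th0 D0 cE cL E0 dE HE t /andP[t0 tT].
pose sL s := Num.sqrt (L s).
have csL : continuous sL by exact: contsqrt.
pose e_ (s : R) := expR (theta * s).
have ce : continuous e_ by exact: contEX.
pose K := sint 0 t (fun s => theta * e_ s).
have cK : continuous (fun s => theta * e_ s) by apply: contM => //; exact: contC.
have cI : continuous (fun s => D * (e_ s * sL s)).
  by apply: contM; [exact: contC|exact: contM].
pose I := sint 0 t (fun s => D * (e_ s * sL s)).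
have key d : 0 < d -> e_ t * Num.sqrt (E t) <= Num.sqrt (E 0) + I + (1 + K) * d.
  move=> d0.
  pose y s := Num.sqrt (E s + d ^+ 2).
  have d20 : 0 < d ^+ 2 by rewrite exprn_gt0.
  have Ed s : 0 < E s + d ^+ 2 by rewrite ltr_wpDl.
  have y0 s : 0 < y s by rewrite sqrtr_gt0.
  have y2 s : y s ^+ 2 = E s + d ^+ 2 by rewrite sqr_sqrtr// ltW.
  have dy s : d <= y s.
    have -> : d = Num.sqrt (d ^+ 2) by rewrite sqrtr_sqr ger0_norm// ltW.
    by rewrite ler_wsqrtr// lerDr.
  have Ey s : Num.sqrt (E s) <= y s by rewrite ler_wsqrtr// lerDl ltW.
  pose f s := D * (e_ s * sL s) + d * (theta * e_ s).
  have cf : continuous f.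
    by apply: contD => //; apply: contM => //; exact: contC.
  pose Phi s := e_ s * y s - sint 0 s f.
  have cy : continuous y.
    by apply: contsqrt; apply: contD => //; exact: contC.
  have cdK : continuous (fun s => d * (theta * e_ s)) by apply: contM => //; exact: contC.
  have If : sint 0 t f = I + d * K by rewrite /f (sintD _ _ cI cdK) (sintZ _ _ d cK).
  have := @decreasing_on Phi (fun s => (theta * e_ s * y s + e_ s * ((2 * y s)^-1 * E' s)) - f s) 0 t.
  rewrite /Phi => H.
  have {H} : e_ t * y t - sint 0 t f <= e_ 0 * y 0 - sint 0 0 f.
    apply: H => //.
    - move=> x; have cey : {within `[0, t], continuous (fun s => e_ s * y s)}.
        by apply: continuous_subspaceT; exact: contM.
      by apply: cvgB; [exact: cey|exact: (sint_primitive_cont cf t0)].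
    - move=> s /andP[s0 st];
      have H1 : is_derive s 1 (fun s => E s + d ^+ 2) (E' s).
        rewrite -[X in is_derive _ _ _ X]addr0.
        have dEs : is_derive s 1 E (E' s) by apply: dE; rewrite s0 (lt_le_trans st).
        exact: (derivD dEs (derivC (d ^+ 2) s)).
      have H2 := @deriv_comp _ Num.sqrt (fun s => E s + d ^+ 2) _ _ _ (is_derive1_sqrt (Ed s)) H1.
      exact: (derivB (derivM (derivEX theta s) H2) (sint_primitive cf s0)).
    - move=> s /andP[s0 st].
      have /HE Hs : 0 < s < T by rewrite s0 (lt_le_trans st).
      have es : 0 < e_ s by exact: expR_gt0.
      have sL0 : 0 <= sL s by exact: sqrtr_ge0.
      have -> : theta * e_ s * y s + e_ s * ((2 * y s)^-1 * E' s) - f s =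
         (e_ s / (2 * y s)) * (2 * theta * y s ^+ 2 + E' s - 2 * D * (y s * sL s) - 2 * d * theta * y s).
        by rewrite /f; field; rewrite gt_eqF.
      apply: mulr_ge0_le0; first by rewrite divr_ge0// ltW// mulr_gt0.
      have h1 : Num.sqrt (E s) * sL s <= y s * sL s by rewrite ler_wpM2r.
      have h2 : D * (Num.sqrt (E s) * sL s) <= D * (y s * sL s) by rewrite ler_wpM2l.
      have h3 : d ^+ 2 <= d * y s by rewrite expr2 ler_wpM2l// ltW.
      have h4 : theta * d ^+ 2 <= theta * (d * y s) by rewrite ler_wpM2l.
      rewrite y2; rewrite /sL in h2 *; nra.
  have -> : sint 0 0 f = 0 by rewrite /sint set_itv1 Rintegral_set1.
  rewrite subr0 If /e_ mulr0 expR0 mul1r.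
  have h1 : y 0 <= Num.sqrt (E 0) + d.
    have s0 := sqrtr_ge0 (E 0).
    have -> : Num.sqrt (E 0) + d = Num.sqrt ((Num.sqrt (E 0) + d) ^+ 2).
      by rewrite sqrtr_sqr ger0_norm// addr_ge0// ltW.
    rewrite ler_wsqrtr// sqrrD sqr_sqrtr// lerD2r lerDl.
    by rewrite mulrn_wge0// mulr_ge0// ltW.
  have h2 : expR (theta * t) * Num.sqrt (E t) <= expR (theta * t) * y t.
    by rewrite ler_wpM2l// expR_ge0.
  lra.
have K0 : 0 <= K by apply: sint_ge0 => s _; rewrite mulr_ge0// expR_ge0.
have {}key : e_ t * Num.sqrt (E t) <= Num.sqrt (E 0) + I.
  apply/ler_addgt0Pr => d d0.
  have := key (d / (1 + K)); rewrite divr_gt0 ?ltr_pwDl// => /(_ isT).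
  by rewrite (_ : (1 + K) * (d / (1 + K)) = d)//; field; rewrite gt_eqF// ltr_pwDl.
have -> : sint 0 t (fun s => D * expR (- theta * (t - s)) * Num.sqrt (L s)) =
    expR (- theta * t) * I.
  rewrite /I -sintZ//; apply: sint_eq => s _.
  rewrite /e_ (_ : - theta * (t - s) = - theta * t + theta * s); last by ring.
  by rewrite expRD /sL; ring.
rewrite -mulrDr mulNr expRN -ler_pdivrMl ?invr_gt0 ?expR_gt0// invrK; exact: key.
Qed.

End gronwall.

(** * Localised energy balances *)

Section balance.
Context {R : realType}.
Implicit Types (g phi d h : R -> R -> R) (T t x : R).

(** The conservation law g_t + phi_x = d on x <= 0, with the regularity that allows integrating it
    over a segment. *)
Definition balance T g phi d : Prop := exists gt phix : R -> R -> R,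
  [/\ cont2 g, cont2 gt, cont2 phix,
      forall t x, 0 < t < T -> is_derive t 1 (g ^~ x) (gt t x) &
      (forall t x, is_derive x 1 (phi t) (phix t x)) /\
      forall t x, 0 < t < T -> x <= 0 -> gt t x + phix t x = d t x].

Lemma balanceD T g phi d g' phi' d' : balance T g phi d -> balance T g' phi' d' ->
  balance T (fun t x => g t x + g' t x) (fun t x => phi t x + phi' t x)
    (fun t x => d t x + d' t x).
Proof.
move=> [gt [px [c1 c2 c3 dg [dp E]]]] [gt' [px' [c1' c2' c3' dg' [dp' E']]]].
exists (fun t x => gt t x + gt' t x), (fun t x => px t x + px' t x); split.
- exact: cont2D.
- exact: cont2D.
- exact: cont2D.
- by move=> t x tT; exact: (derivD (dg t x tT) (dg' t x tT)).
- split=> [t x|t x tT x0]; first exact: (derivD (dp t x) (dp' t x)).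
  by rewrite -E// -E'//; ring.
Qed.

Lemma balanceZ T (M : R) g phi d : balance T g phi d ->
  balance T (fun t x => M * g t x) (fun t x => M * phi t x) (fun t x => M * d t x).
Proof.
move=> [gt [px [c1 c2 c3 dg [dp E]]]].
exists (fun t x => M * gt t x), (fun t x => M * px t x); split.
- by apply: cont2M => //; exact: cont2C.
- by apply: cont2M => //; exact: cont2C.
- by apply: cont2M => //; exact: cont2C.
- by move=> t x tT; exact: (derivZ M (dg t x tT)).
- split=> [t x|t x tT x0]; first exact: (derivZ M (dp t x)).
  by rewrite -E//; ring.
Qed.

(** The derivative E' is chosen before the bound h on the source because the theorems below first
    collect several balances and only then bound the total source. *)
Lemma balance_energy T (a : R) g phi d : a < 0 -> balance T g phi d ->
  exists E' : R -> R, forall t, 0 < t < T ->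
    is_derive t 1 (fun t => sint a 0 (g t)) (E' t) /\
    forall h : R -> R, continuous h -> (forall x, a <= x <= 0 -> d t x <= h x) ->
      E' t <= sint a 0 h - phi t 0 + phi t a.
Proof.
move=> a0 [gt [px [c1 c2 c3 dg [dp E]]]].
exists (fun t => sint a 0 (gt t)) => t tT; split; first exact: (sint_deriv _ _ c1 c2 tT dg).
move=> h ch dh.
have cg : continuous (gt t) by exact: (cont2_x c2).
have cp : continuous (px t) by exact: (cont2_x c3).
suff : sint a 0 (gt t) + sint a 0 (px t) <= sint a 0 h.
  have -> : sint a 0 (px t) = phi t 0 - phi t a by apply: sint_FTC.
  move=> ?; lra.
rewrite -sintD//; apply: sint_le => //; first exact: contD.
move=> x /[dup] xa /andP[_ x0]; rewrite E//; exact: dh.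
Qed.

(** The equation h_t + a h_x = F on x <= 0, where ax is the space derivative of a. *)
Record transport T h (a ax F : R -> R -> R) : Prop := Transport {
  tr_h : cont2 h; tr_a : cont2 a; tr_ax : cont2 ax;
  tr_dax : forall t x, is_derive x 1 (a t) (ax t x);
  tr_eq : exists ht hx : R -> R -> R, [/\ cont2 ht, cont2 hx,
    forall t x, 0 < t < T -> is_derive t 1 (h ^~ x) (ht t x),
    forall t x, is_derive x 1 (h t) (hx t x) &
    forall t x, 0 < t < T -> x <= 0 -> ht t x + a t x * hx t x = F t x]}.

(** A function of x - c * t: its support moves into x <= 0 at speed c, so that information transported
    at speed at most c does not enter it from the left.  The square makes it differentiable. *)
Definition cutoff (c N t x : R) : R := Num.max 0 (1 + (x - c * t) / N) ^+ 2.

Lemma cutoff_ge0 c N t x : 0 <= cutoff c N t x.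
Proof. exact: sqr_ge0. Qed.

Lemma cutoff_le1 c N t x : 0 < N -> 0 <= c -> 0 <= t -> x <= 0 -> cutoff c N t x <= 1.
Proof.
move=> N0 c0 t0 x0; rewrite /cutoff exprn_ile1// ?le_max ?lexx// ge_max ler01 /=.
have ct0 : 0 <= c * t by rewrite mulr_ge0.
by rewrite gerDl ler_pdivrMr// mul0r; lra.
Qed.

Lemma cutoff_edge c N t : 0 < N -> 0 <= c -> 0 <= t -> cutoff c N t (- N) = 0.
Proof.
move=> N0 c0 t0; have E : 1 + (- N - c * t) / N = - (c * t / N) by field; rewrite gt_eqF.
by rewrite /cutoff E max_l ?expr0n// oppr_le0 divr_ge0 ?mulr_ge0// ltW.
Qed.

Lemma cutoff_ge c N t x (N0 T : R) : 0 <= c -> 0 <= t <= T -> - N0 <= x -> 0 < N ->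
  2 * (N0 + c * T) <= N -> 4^-1 <= cutoff c N t x.
Proof.
move=> c0 /andP[t0 tT] xN N_0 H.
have ctT : c * t <= c * T by rewrite ler_wpM2l.
have h : 2^-1 <= 1 + (x - c * t) / N.
  rewrite -lerBlDl (_ : 2^-1 - 1 = (- 2^-1)); last by field.
  rewrite ler_pdivlMr//; lra.
have -> : (4^-1 : R) = 2^-1 ^+ 2 by field.
rewrite /cutoff ler_pXn2r ?nnegrE ?le_max ?lexx//; first by rewrite h orbT.
Qed.

Definition cutoffx (c N t x : R) : R := 2 * Num.max 0 (1 + (x - c * t) / N) / N.

Lemma continuous_max0 : continuous (fun y : R => Num.max 0 y).
Proof. by move=> y; apply: continuous_max; [exact: cvg_cst|exact: cvg_id]. Qed.

Lemma cont2_lin c N : cont2 (fun t x : R => 1 + (x - c * t) / N).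
Proof.
apply: cont2D; first exact: cont2C.
apply: cont2M; last exact: cont2C.
apply: cont2B; first by apply: (@cont2_of_x _ id) => ?; exact: cvg_id.
apply: cont2M; first exact: cont2C.
by apply: (@cont2_of_t _ id) => ?; exact: cvg_id.
Qed.

Lemma cont2_cutoff c N : cont2 (cutoff c N).
Proof.
rewrite /cutoff; apply: cont2X.
by apply: (@cont2_comp _ (fun y => Num.max 0 y)); [exact: continuous_max0|exact: cont2_lin].
Qed.

Lemma cont2_cutoffx c N : cont2 (cutoffx c N).
Proof.
apply: cont2M; last exact: cont2C.
apply: cont2M; first exact: cont2C.
by apply: (@cont2_comp _ (fun y => Num.max 0 y)); [exact: continuous_max0|exact: cont2_lin].
Qed.

Lemma cutoffx_ge0 c N t x : 0 < N -> 0 <= cutoffx c N t x.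
Proof. by move=> N0; apply: divr_ge0; [apply: mulr_ge0; rewrite ?le_max ?lexx|exact: ltW]. Qed.

Lemma cutoff_dx c N t x : is_derive x 1 (cutoff c N t) (cutoffx c N t x).
Proof.
have H : is_derive x 1 (fun x => 1 + (x - c * t) / N) (0 + ((1 - 0) * N^-1 + (x - c * t) * 0)).
  exact: (derivD (derivC 1 x) (derivM (derivB (derivid x) (derivC (c * t) x)) (derivC N^-1 x))).
have := @deriv_comp _ (fun y => Num.max 0 y ^+ 2) (fun x => 1 + (x - c * t) / N) _ _ _
  (deriv_pos2 (1 + (x - c * t) / N)) H.
by rewrite /cutoffx mulr0 addr0 subr0 mul1r add0r.
Qed.

Lemma cutoff_dt c N t x : is_derive t 1 (cutoff c N ^~ x) (- c * cutoffx c N t x).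
Proof.
have H : is_derive t 1 (fun t => 1 + (x - c * t) / N) (0 + ((0 - c * 1) * N^-1 + (x - c * t) * 0)).
  exact: (derivD (derivC 1 t) (derivM (derivB (derivC x t) (derivZ c (derivid t))) (derivC N^-1 t))).
have := @deriv_comp _ (fun y => Num.max 0 y ^+ 2) (fun t => 1 + (x - c * t) / N) _ _ _
  (deriv_pos2 (1 + (x - c * t) / N)) H.
by rewrite [X in is_derive _ _ _ X -> _](_ : _ = - c * cutoffx c N t x)//; rewrite /cutoffx; ring.
Qed.

(** Multiply the equation by 2 * cutoff * om * h.  The derivatives of the cutoff add up to
    (a - c) * cutoffx * om * h ^ 2, which is nonpositive where a <= c. *)
Lemma transport_balance T h a ax F (om omx : R -> R) c N :
  transport T h a ax F -> 0 < N ->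
  (forall x, is_derive x 1 om (omx x)) -> continuous omx -> (forall x, 0 <= om x) ->
  exists d, balance T (fun t x => cutoff c N t x * (om x * h t x ^+ 2))
     (fun t x => a t x * (cutoff c N t x * (om x * h t x ^+ 2))) d /\
   forall t x, 0 < t < T -> x <= 0 -> a t x <= c ->
     d t x <= cutoff c N t x * ((omx x * a t x + ax t x * om x) * h t x ^+ 2
                               + 2 * om x * h t x * F t x).
Proof.
move=> [ch ca cax da [ht [hx [cht chx dt_ dx_ E]]]] N0 dom comx om0.
have com : cont2 (fun _ x : R => om x).
  by apply: cont2_of_x => x; exact: (is_derive_cont (dom x)).
have comx2 : cont2 (fun _ x : R => omx x) by exact: cont2_of_x.
have cc : cont2 (cutoff c N) by exact: cont2_cutoff.
have ccx : cont2 (cutoffx c N) by exact: cont2_cutoffx.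
pose X := cutoff c N; pose Xx := cutoffx c N.
pose gt t x := (- c * Xx t x) * (om x * h t x ^+ 2) + X t x * (om x * (2 * h t x * ht t x)).
pose px t x := ax t x * (X t x * (om x * h t x ^+ 2))
  + a t x * (Xx t x * (om x * h t x ^+ 2) + X t x * (omx x * h t x ^+ 2 + om x * (2 * h t x * hx t x))).
have ch2 : cont2 (fun t x => h t x ^+ 2) by exact: cont2X.
have com2 := cont2M com ch2.
exists (fun t x => gt t x + px t x); split.
  exists gt, px; split.
  - exact: cont2M.
  - apply: cont2D; first by apply: cont2M => //; apply: cont2M => //; exact: cont2C.
    by apply: cont2M => //; apply: cont2M => //; apply: cont2M => //; apply: cont2M => //; exact: cont2C.
  - apply: cont2D; first by apply: cont2M => //; exact: cont2M.
    apply: cont2M => //; apply: cont2D; first exact: cont2M.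
    apply: cont2M => //; apply: cont2D; first exact: cont2M.
    by apply: cont2M => //; apply: cont2M => //; apply: cont2M => //; exact: cont2C.
  - by move=> t x tT; exact: (derivM (cutoff_dt c N t x) (derivZ (om x) (deriv2 (dt_ t x tT)))).
  - split=> // t x.
    exact: (derivM (da t x) (derivM (cutoff_dx c N t x) (derivM (dom x) (deriv2 (dx_ t x))))).
move=> t x tT x0 ac; rewrite /gt /px -(E t x tT x0).
have h1 : 0 <= (c - a t x) * (Xx t x * (om x * h t x ^+ 2)).
  apply: mulr_ge0; first by rewrite subr_ge0.
  by apply: mulr_ge0; [exact: cutoffx_ge0|apply: mulr_ge0; rewrite ?sqr_ge0].
rewrite -subr_ge0; move: h1; congr (_ <= _); rewrite /X /Xx; ring.
Qed.

End balance.

(** * Weighted balances of outgoing and incoming components *)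

Section weights.
Context {R : realType}.
Implicit Types (T t x : R) (h rem : R -> R -> R).

(** For x <= 0 this is the weight expR (eps * `|x|) of the norms. *)
Definition wexp (eps x : R) : R := expR (- eps * x).
(** Equivalent to wexp on x <= 0 (lemmas wdamp_le and wexp_le), but its logarithmic derivative
    contains - B * kap * expR (kap * x), which for B large beats any given multiple of expR (kap * x):
    terms localised near the front become harmless for components moving towards it. *)
Definition wdamp (eps B kap x : R) : R := wexp eps x * expR (- B * expR (kap * x)).

Lemma wexp_gt0 eps x : 0 < wexp eps x. Proof. exact: expR_gt0. Qed.
Lemma wdamp_gt0 eps B kap x : 0 < wdamp eps B kap x.
Proof. by rewrite mulr_gt0 ?expR_gt0. Qed.

Lemma wexp_d eps x : is_derive x 1 (wexp eps) (- eps * wexp eps x).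
Proof. exact: derivEX. Qed.

Lemma wdamp_d eps B kap x :
  is_derive x 1 (wdamp eps B kap) ((- eps - B * kap * expR (kap * x)) * wdamp eps B kap x).
Proof.
have H := @deriv_comp _ expR (fun x => - B * expR (kap * x)) _ _ _
  (derivE (- B * expR (kap * x))) (derivZ (- B) (derivEX kap x)).
have := derivM (wexp_d eps x) H; rewrite /wdamp.
by rewrite [X in is_derive _ _ _ X -> _](_ : _ =
  (- eps - B * kap * expR (kap * x)) * (wexp eps x * expR (- B * expR (kap * x))))//; ring.
Qed.

Lemma wdamp_le eps B kap x : 0 <= B -> wdamp eps B kap x <= wexp eps x.
Proof.
move=> B0; rewrite /wdamp ler_piMr ?expR_ge0// -expR0 ler_expR.
by rewrite mulNr oppr_le0 mulr_ge0 ?expR_ge0.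
Qed.

Lemma wexp_le eps B kap x : 0 <= B -> 0 <= kap -> x <= 0 ->
  wexp eps x <= expR B * wdamp eps B kap x.
Proof.
move=> B0 k0 x0; rewrite /wdamp mulrCA ler_peMr ?expR_ge0// -expRD -[leLHS]expR0 ler_expR.
have : B * expR (kap * x) <= B * 1.
  by rewrite ler_wpM2l// -expR0 ler_expR mulr_ge0_le0.
by rewrite mulr1 mulNr subr_ge0.
Qed.

Lemma cont_wexp eps : continuous (wexp eps).
Proof. by move=> x; exact: (is_derive_cont (wexp_d eps x)). Qed.

Lemma cont_wdamp eps B kap : continuous (wdamp eps B kap).
Proof. by move=> x; exact: (is_derive_cont (wdamp_d eps B kap x)). Qed.

(** A component transported to the right, out of x <= 0.  The terms linear in h itself are the ones
    allowed to be of size A1, but only near the front or with the small factor eta; all other forcing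
    is collected in rem. *)
Definition outgoing T (c1 c A1 kap eta : R) h rem : Prop :=
  exists a ax F, transport T h a ax F /\ forall t x, 0 < t < T -> x <= 0 ->
   [/\ c1 <= a t x <= c, `|ax t x| <= A1 * (expR (kap * x) + eta) &
       `|F t x| <= A1 * (expR (kap * x) + eta) * `|h t x| + rem t x].

(** The weight decreases along the motion, which yields - eps * c1 * h ^ 2.  Three terms of size
    A1 * (expR (kap * x) + eta) * h ^ 2 have to be absorbed, one from the derivative of the speed and
    two from F: the part with expR (kap * x) by the damping factor of the weight, the part with eta by
    half of the decay. *)
Lemma outgoing_balance T c1 c A1 kap eta h rem eps B N :
  outgoing T c1 c A1 kap eta h rem -> 0 < N -> 0 < c1 -> c1 <= c -> 0 <= A1 -> 0 < kap ->
  0 < eps -> 0 <= eta -> 0 <= B -> 3 * A1 <= B * kap * c1 -> 3 * A1 * eta <= eps * c1 / 2 ->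
  exists phi d, [/\ balance T (fun t x => cutoff c N t x * (wdamp eps B kap x * h t x ^+ 2)) phi d,
    (forall t x, 0 < t < T -> x <= 0 -> d t x <= cutoff c N t x * (wdamp eps B kap x *
       (- (eps * c1 / 2) * h t x ^+ 2 + 2 * `|h t x| * rem t x))),
    (forall t, 0 < t < T -> c1 * (cutoff c N t 0 * (wdamp eps B kap 0 * h t 0 ^+ 2)) <= phi t 0) &
    (forall t, 0 < t < T -> phi t (- N) = 0)].
Proof.
move=> [a [ax [F [tr H]]]] N0 c10 c1c A10 kap0 eps0 eta0 B0 HB Heta.
have cw' : continuous (fun x => (- eps - B * kap * expR (kap * x)) * wdamp eps B kap x).
  apply: contM; last exact: cont_wdamp.
  apply: contD; first exact: contC.
  by move=> x; apply: cvgN; apply: cvgM; [exact: cvg_cst|exact: contEX].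
have [d [bal Hd]] := transport_balance c tr N0 (wdamp_d eps B kap) cw' (fun x => ltW (wdamp_gt0 eps B kap x)).
do 2 eexists; split; first exact: bal.
- move=> t x tT x0; have [/andP[a1 a2] Hax HF] := H t x tT x0.
  apply: (le_trans (Hd t x tT x0 a2)); apply: ler_wpM2l; first exact: cutoff_ge0.
  set e := expR (kap * x) in Hax HF *; set w := wdamp eps B kap x.
  have e0 : 0 <= e by exact: expR_ge0.
  rewrite (_ : _ + _ = w * ((- (eps + B * kap * e) * a t x + ax t x) * h t x ^+ 2 + 2 * (h t x * F t x))); last by ring.
  apply: ler_wpM2l; first exact: ltW (wdamp_gt0 _ _ _ _).
  set hh := h t x in HF *; set FF := F t x in HF *; set Ra := rem t x in HF *.
  have h1 : hh * FF <= A1 * (e + eta) * hh ^+ 2 + `|hh| * Ra.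
    apply: (le_trans (ler_norm _)); rewrite normrM.
    apply: (le_trans (ler_wpM2l (normr_ge0 hh) HF)).
    by rewrite -(real_normK (num_real hh)) le_eqVlt; apply/orP; left; apply/eqP; ring.
  have h2 : ax t x * hh ^+ 2 <= A1 * (e + eta) * hh ^+ 2.
    by rewrite ler_wpM2r ?sqr_ge0// (le_trans (ler_norm _)).
  have h3 : (eps + B * kap * e) * c1 * hh ^+ 2 <= (eps + B * kap * e) * a t x * hh ^+ 2.
    have q0 : 0 <= eps + B * kap * e.
      by apply: addr_ge0; [exact: ltW|apply: mulr_ge0 => //; apply: mulr_ge0 => //; exact: ltW].
    by rewrite ler_wpM2r ?sqr_ge0// ler_wpM2l.
  have h4 : 3 * A1 * (e * hh ^+ 2) <= B * kap * c1 * (e * hh ^+ 2).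
    by rewrite ler_wpM2r// mulr_ge0// sqr_ge0.
  have h5 : 3 * A1 * eta * hh ^+ 2 <= eps * c1 / 2 * hh ^+ 2.
    by rewrite ler_wpM2r ?sqr_ge0.
  lra.
- move=> t tT; have [/andP[a1 a2] _ _] := H t 0 tT (lexx _).
  apply: ler_wpM2r => //; apply: mulr_ge0; first exact: cutoff_ge0.
  by apply: mulr_ge0; [exact: ltW (wdamp_gt0 _ _ _ _)|exact: sqr_ge0].
- by move=> t /andP[t0 _]; rewrite cutoff_edge ?ltW// ?mul0r ?mulr0// (lt_le_trans c10).
Qed.

(** A component transported to the left, away from the front, and damped at rate k. *)
Definition incoming T (k : R) (s : R -> R) h rem : Prop :=
  exists F, transport T h (fun t _ => - s t) (fun _ _ => 0) F /\ forall t x, 0 < t < T -> x <= 0 ->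
   F t x <= - k * h t x + rem t x /\ - k * h t x - rem t x <= F t x.

(** Moving towards larger weights at speed s costs eps * s <= k, which is half of the damping 2 * k of
    the square. *)
Lemma incoming_balance T k nu s h rem eps c N :
  incoming T k s h rem -> 0 < N -> 0 <= c -> 0 < eps -> eps * nu <= k ->
  (forall t, 0 < t < T -> 0 <= s t <= nu) ->
  exists phi d, [/\ balance T (fun t x => cutoff c N t x * (wexp eps x * h t x ^+ 2)) phi d,
    (forall t x, 0 < t < T -> x <= 0 -> d t x <= cutoff c N t x * (wexp eps x *
       (- k * h t x ^+ 2 + 2 * `|h t x| * rem t x))),
    (forall t, 0 < t < T -> - nu * (cutoff c N t 0 * (wexp eps 0 * h t 0 ^+ 2)) <= phi t 0) &
    (forall t, 0 < t < T -> phi t (- N) = 0)].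
Proof.
move=> [F [tr H]] N0 c0 eps0 Heps Hs.
have cw' : continuous (fun x => - eps * wexp eps x).
  by apply: contM; [exact: contC|exact: cont_wexp].
have [d [bal Hd]] := transport_balance c tr N0 (wexp_d eps) cw' (fun x => ltW (wexp_gt0 eps x)).
do 2 eexists; split; first exact: bal.
- move=> t x tT x0; have [F1 F2] := H t x tT x0; have /andP[s0 s1] := Hs t tT.
  have sc : - s t <= c by rewrite (le_trans _ c0)// oppr_le0.
  apply: (le_trans (Hd t x tT x0 sc)); apply: ler_wpM2l; first exact: cutoff_ge0.
  set w := wexp eps x.
  rewrite (_ : _ + _ = w * (eps * s t * h t x ^+ 2 + 2 * (h t x * F t x))); last by ring.
  apply: ler_wpM2l; first exact: ltW (wexp_gt0 _ _).
  set hh := h t x in F1 F2 *; set FF := F t x in F1 F2 *; set Ra := rem t x in F1 F2 *.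
  have h1 : hh * FF <= - k * hh ^+ 2 + `|hh| * Ra.
    have -> : hh * FF = - k * hh ^+ 2 + hh * (FF + k * hh) by ring.
    rewrite lerD2l (le_trans (ler_norm _))// normrM ler_wpM2l// ler_norml; lra.
  have h2 : eps * s t * hh ^+ 2 <= k * hh ^+ 2.
    by rewrite ler_wpM2r ?sqr_ge0// (le_trans _ Heps)// ler_wpM2l// ltW.
  lra.
- move=> t tT; have /andP[s0 s1] := Hs t tT.
  apply: ler_wpM2r; last by rewrite lerN2.
  apply: mulr_ge0; first exact: cutoff_ge0.
  by apply: mulr_ge0; [exact: ltW (wexp_gt0 _ _)|exact: sqr_ge0].
- by move=> t /andP[t0 _]; rewrite (cutoff_edge N0 c0 (ltW t0)) mul0r mulr0.
Qed.

End weights.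

(** * Scalar inequalities behind the energy estimate *)

Section scalar.
Context {R : realFieldType}.
Implicit Types (w wz lam r h : R).

Lemma young (d h r : R) : 0 < d -> 2 * `|h| * r <= d * h ^+ 2 + d^-1 * r ^+ 2.
Proof.
move=> d0; rewrite -(real_normK (num_real h)) -subr_ge0.
rewrite (_ : _ - _ = d^-1 * (d * `|h| - r) ^+ 2); last by field; rewrite gt_eqF.
by rewrite mulr_ge0 ?sqr_ge0// invr_ge0 ltW.
Qed.

(** Half of the damping absorbs h in the cross term by Young's inequality. *)
Lemma damped_production w wz lam h r : 0 < w -> w <= wz -> 0 < lam ->
  w * (- lam * h ^+ 2 + 2 * `|h| * r) <= - (lam / 2) * (w * h ^+ 2) + wz * ((2 / lam) * r ^+ 2).
Proof.
move=> w0 wwz lam0; have l2 : 0 < lam / 2 by rewrite divr_gt0.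
have := young h r l2; rewrite invf_div => H.
have h1 : w * (2 * `|h| * r) <= w * (lam / 2 * h ^+ 2 + 2 / lam * r ^+ 2).
  by rewrite ler_wpM2l// ltW.
have h2 : w * (2 / lam * r ^+ 2) <= wz * (2 / lam * r ^+ 2).
  by rewrite ler_wpM2r// mulr_ge0 ?sqr_ge0// divr_ge0// ltW.
lra.
Qed.

(** Absorbing h into the damping fixes the factor 2 / lam of the forcing; where a term in h ^ 2 is
    affordable, as it is at level 0, that factor can be any al > 0. *)
Lemma undamped_production w wz lam al h r : 0 < w -> w <= wz -> 0 <= lam -> 0 < al ->
  w * (- lam * h ^+ 2 + 2 * `|h| * r) <= wz * (al^-1 * h ^+ 2 + al * r ^+ 2).
Proof.
move=> w0 wwz lam0 al0; have ai : 0 < al^-1 by rewrite invr_gt0.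
have := young h r ai; rewrite invrK => H.
have h1 : w * (- lam * h ^+ 2 + 2 * `|h| * r) <= w * (al^-1 * h ^+ 2 + al * r ^+ 2).
  rewrite ler_wpM2l// ?(ltW w0)//.
  have : 0 <= lam * h ^+ 2 by rewrite mulr_ge0 ?sqr_ge0.
  lra.
apply: (le_trans h1); rewrite ler_wpM2r// addr_ge0// mulr_ge0 ?sqr_ge0// ltW//.
Qed.

Lemma sq2 (a b : R) : (a + b) ^+ 2 <= 2 * (a ^+ 2 + b ^+ 2).
Proof. have := sqr_ge0 (a - b); lra. Qed.

Lemma sq4 (a b c d : R) : (a + b + c + d) ^+ 2 <= 4 * (a ^+ 2 + b ^+ 2 + c ^+ 2 + d ^+ 2).
Proof. have := sq2 (a + b) (c + d); have := sq2 a b; have := sq2 c d; rewrite -!addrA; lra. Qed.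

Lemma sq8 (a b c d e f g : R) : (a + b + c + d + e + f + g) ^+ 2 <=
  8 * (a ^+ 2 + b ^+ 2 + c ^+ 2 + d ^+ 2 + e ^+ 2 + f ^+ 2 + g ^+ 2).
Proof.
have := sq2 (a + b + c + d) (e + f + g); have := sq4 a b c d; have := sq4 e f g 0.
rewrite expr0n /= !addr0 -!addrA; lra.
Qed.

Lemma damped_forced w wz lam K C h r s : 0 < w -> w <= wz -> 0 < lam ->
  2 / lam * (4 * C ^+ 2) <= K -> 0 <= s -> r ^+ 2 <= 4 * C ^+ 2 * s ->
  w * (- lam * h ^+ 2 + 2 * `|h| * r) <= - (lam / 2) * (w * h ^+ 2) + wz * (K * s).
Proof.
move=> w0 wwz lam0 KC s0 rs; apply: (le_trans (damped_production h r w0 wwz lam0)).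
rewrite lerD2l ler_wpM2l ?(le_trans (ltW w0))//.
apply: (@le_trans _ _ (2 / lam * (4 * C ^+ 2 * s))).
  by rewrite ler_wpM2l// divr_ge0// ltW.
by rewrite mulrA ler_wpM2r.
Qed.

Lemma damped_free w lam h : 0 <= w -> 0 <= lam ->
  w * (- lam * h ^+ 2 + 2 * `|h| * 0) <= - (lam / 2) * (w * h ^+ 2).
Proof.
move=> w0 lam0; have : 0 <= lam * (w * h ^+ 2) by rewrite mulr_ge0// mulr_ge0// sqr_ge0.
lra.
Qed.

Lemma undamped_forced w wz lam al al' C h r s : 0 < w -> w <= wz -> 0 <= lam -> 0 < al' ->
  al' * (4 * C ^+ 2) <= al -> 0 <= s -> r ^+ 2 <= 4 * C ^+ 2 * s ->
  w * (- lam * h ^+ 2 + 2 * `|h| * r) <= wz * (al'^-1 * h ^+ 2 + al * s).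
Proof.
move=> w0 wwz lam0 al0 KC s0 rs; apply: (le_trans (undamped_production h r w0 wwz lam0 al0)).
rewrite ler_wpM2l ?(le_trans (ltW w0))// lerD2l.
apply: (@le_trans _ _ (al' * (4 * C ^+ 2 * s))); first by rewrite ler_wpM2l// ltW.
by rewrite mulrA ler_wpM2r.
Qed.

Lemma forcing4 (C a b c d : R) :
  (C * (a + b + c + d)) ^+ 2 <= 4 * C ^+ 2 * (a ^+ 2 + b ^+ 2 + c ^+ 2 + d ^+ 2).
Proof. by rewrite exprMn [leRHS]mulrAC [leRHS]mulrC ler_wpM2l ?sqr_ge0// sq4. Qed.

Lemma forcing3 (C a b c : R) : (C * (a + b + c)) ^+ 2 <= 4 * C ^+ 2 * (a ^+ 2 + b ^+ 2 + c ^+ 2).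
Proof. by have := forcing4 C a b c 0; rewrite expr0n !addr0. Qed.

Lemma forcing2 (C a b : R) : (C * (a + b)) ^+ 2 <= 4 * C ^+ 2 * (a ^+ 2 + b ^+ 2).
Proof. by have := forcing3 C a b 0; rewrite expr0n !addr0. Qed.

Lemma forcing1 (C a : R) : (C * a) ^+ 2 <= 4 * C ^+ 2 * a ^+ 2.
Proof. by have := forcing2 C a 0; rewrite expr0n !addr0. Qed.

Lemma forcing2' (C a b : R) : (C * (a + b)) ^+ 2 <= 2 * C ^+ 2 * (a ^+ 2 + b ^+ 2).
Proof. by rewrite exprMn [leRHS]mulrAC [leRHS]mulrC ler_wpM2l ?sqr_ge0// sq2. Qed.

Lemma forcing7 (C a b c d e f g : R) : (C * (a + b + c + d + e + f + g)) ^+ 2 <=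
  8 * C ^+ 2 * (a ^+ 2 + b ^+ 2 + c ^+ 2 + d ^+ 2 + e ^+ 2 + f ^+ 2 + g ^+ 2).
Proof. by rewrite exprMn [leRHS]mulrAC [leRHS]mulrC ler_wpM2l ?sqr_ge0// sq8. Qed.

Lemma outflow_rate (c1 m X w : R) : 0 <= c1 -> 0 < m -> 4^-1 <= X -> 1 <= m * w ->
  c1 / (4 * m) <= c1 * X * w.
Proof.
move=> c10 m0 X4 mw; rewrite -mulrA ler_wpM2l//.
rewrite -(ler_pM2r (x := 4 * m)) ?mulr_gt0// mulVf ?gt_eqF ?mulr_gt0//.
have : 1 * (m * w) <= 4 * X * (m * w) by rewrite ler_wpM2r ?(le_trans ler01)//; lra.
lra.
Qed.

Lemma big_enough (A b : R) : 0 < b -> 0 <= A -> exists2 M, 1 <= M & A <= M * b.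
Proof.
move=> b0 A0; exists (1 + A / b); first by rewrite lerDl divr_ge0// ltW.
by rewrite mulrDl mul1r divfK ?gt_eqF// lerDr ltW.
Qed.

(** The multipliers are chosen in the order N2, M1, N1, Q1, Q0, M0, al: each is
    large enough to pay for the interior forcing of the components chosen before it and for the traces
    entering them at the front.  The small
    constant al comes last because it multiplies M0 in the condition on M0. *)
Lemma multipliers (lam k K m nu b0 C2 I3 : R) : 0 < lam -> 0 < k -> 0 <= K -> 0 <= m ->
  0 <= nu -> 0 < b0 -> 0 <= C2 -> 0 <= I3 ->
  exists N2 M1 N1 M0 Q2 Q1 Q0 al : R,
  [/\ [/\ 1 <= N2, 1 <= M1, 1 <= N1 & 1 <= M0], [/\ 1 <= Q2, 1 <= Q1, 1 <= Q0 & 0 < al],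
      [/\ K <= N2 * (k / 4), K * m <= M1 * (lam / 4), M1 * K <= N1 * (k / 4) & N2 * nu * C2 <= M1 * b0] &
      [/\ N2 * nu * C2 <= Q2 * b0, (N1 + N2) * nu * C2 <= Q1 * b0, (1 + (N1 + N2) * C2) * nu <= Q0 * b0 &
      (N1 + N2) * nu * C2 + ((M0 + 1) * al + (1 + M1 + N1 + N2) * K) * I3 <= M0 * b0]].
Proof.
move=> lam0 k0 K0 m0 nu0 b00 C20 I30.
have k4 : 0 < k / 4 by rewrite divr_gt0.
have l4 : 0 < lam / 4 by rewrite divr_gt0.
have pos A : 1 <= A -> 0 <= A :> R by apply: le_trans.
have [N2 N21 HN2] := big_enough k4 K0; have N20 := pos _ N21.
have [M1a M1a1 HM1a] := big_enough l4 (mulr_ge0 K0 m0); have M1a0 := pos _ M1a1.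
have NnC := mulr_ge0 (mulr_ge0 N20 nu0) C20.
have [M1b M1b1 HM1b] := big_enough b00 NnC; have M1b0 := pos _ M1b1.
pose M1 := M1a + M1b.
have M11 : 1 <= M1 by rewrite /M1; lra.
have M10 := pos _ M11.
have [N1 N11 HN1] := big_enough k4 (mulr_ge0 M10 K0); have N10 := pos _ N11.
have N120 : 0 <= N1 + N2 by rewrite addr_ge0.
have NNnC := mulr_ge0 (mulr_ge0 N120 nu0) C20.
have [Q1 Q11 HQ1] := big_enough b00 NNnC.
have Q0p : 0 <= (1 + (N1 + N2) * C2) * nu by rewrite mulr_ge0// addr_ge0// mulr_ge0.
have [Q0 Q01 HQ0] := big_enough b00 Q0p.
have b2 : 0 < b0 / 2 by rewrite divr_gt0.
have M0p : 0 <= (N1 + N2) * nu * C2 + (1 + M1 + N1 + N2) * K * I3 + b0 / 2.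
  have : 0 <= (1 + M1 + N1 + N2) * K * I3.
    by apply: mulr_ge0 => //; apply: mulr_ge0 => //; lra.
  lra.
have [M0 M01 HM0] := big_enough b2 M0p; have M00 := pos _ M01.
have I31 : 0 < I3 + 1 by lra.
exists N2, M1, N1, M0, M1b, Q1, Q0, (b0 / 2 / (I3 + 1)); split.
- by split=> //.
- by split=> //; rewrite !divr_gt0.
- split=> //.
    by apply: (le_trans HM1a); rewrite ler_wpM2r ?(ltW l4)// /M1; lra.
  by apply: (le_trans HM1b); rewrite ler_wpM2r ?(ltW b00)// /M1; lra.
split=> //.
have h1 : (M0 + 1) * (b0 / 2 / (I3 + 1)) * I3 <= (M0 + 1) * (b0 / 2).
  rewrite -mulrA ler_wpM2l//; first by lra.
  by rewrite mulrAC ler_pdivrMr// ler_wpM2l// ?(ltW b2)//; lra.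
lra.
Qed.

Lemma common_bound (a b c d e f g : R) : 1 <= a -> 1 <= b -> 1 <= c -> 1 <= d -> 1 <= e ->
  1 <= f -> 1 <= g ->
  exists M, [/\ 1 <= M, a <= M, b <= M & [/\ c <= M, d <= M, e <= M, f <= M & g <= M]].
Proof. by move=> *; exists (a + b + c + d + e + f + g); split; [lra|lra|lra|split; lra]. Qed.

(** The energy density with multipliers is equivalent to the plain weighted density, uniformly in the
    squares v, z, y, p of the components. *)
Section density.
Variables (w wz m M N2 M1 N1 M0 Q2 Q1 Q0 : R).
Variables (v0 v1 v2 z0 z1 z2 y0 y1 y2 p0 p1 p2 : R).
Hypotheses (w0 : 0 <= w) (wwz : w <= wz) (wzm : wz <= m * w) (m1 : 1 <= m).
Hypotheses (v00 : 0 <= v0) (v10 : 0 <= v1) (v20 : 0 <= v2) (z00 : 0 <= z0) (z10 : 0 <= z1)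
 (z20 : 0 <= z2) (y00 : 0 <= y0) (y10 : 0 <= y1) (y20 : 0 <= y2) (p00 : 0 <= p0) (p10 : 0 <= p1)
 (p20 : 0 <= p2).
Hypotheses (N21 : 1 <= N2) (M11 : 1 <= M1) (N11 : 1 <= N1) (M01 : 1 <= M0) (Q21 : 1 <= Q2)
  (Q11 : 1 <= Q1) (Q01 : 1 <= Q0).
Let q := v0 + z0 + y0 + p0 + (v1 + z1 + y1 + p1) + (v2 + z2 + y2 + p2).
Let dens := w * (v2 + y2 + Q2 * p2 + M1 * (v1 + y1) + Q1 * p1 + M0 * (v0 + y0) + Q0 * p0)
      + wz * (N2 * z2 + N1 * z1 + z0).

Lemma density_ge : wz * q <= m * dens.
Proof.
have wz0 : 0 <= wz by exact: le_trans wwz.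
have up (A x : R) : 1 <= A -> 0 <= x -> m * (w * x) <= m * (w * (A * x)).
  move=> A1 x0; rewrite ler_wpM2l ?(le_trans _ m1)// ler_wpM2l// ler_peMl//.
have upz (A x : R) : 1 <= A -> 0 <= x -> m * (wz * x) <= m * (wz * (A * x)).
  by move=> A1 x0; rewrite ler_wpM2l ?(le_trans _ m1)// ler_wpM2l// ler_peMl.
have ch x : 0 <= x -> wz * x <= m * (w * x) by move=> x0; rewrite mulrA ler_wpM2r.
have chz x : 0 <= x -> wz * x <= m * (wz * x) by move=> x0; rewrite ler_peMl// mulr_ge0.
have := up _ _ M01 v00; have := up _ _ M01 y00; have := up _ _ M11 v10; have := up _ _ M11 y10.
have := up _ _ Q01 p00; have := up _ _ Q11 p10; have := up _ _ Q21 p20.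
have := upz _ _ N11 z10; have := upz _ _ N21 z20; have := chz _ z00.
have := ch _ v00; have := ch _ v10; have := ch _ v20; have := ch _ y00; have := ch _ y10.
have := ch _ y20; have := ch _ p00; have := ch _ p10; have := ch _ p20; have := chz _ z10.
have := chz _ z20; rewrite /dens /q; lra.
Qed.

Hypotheses (hM : 1 <= M) (hN2 : N2 <= M) (hM1 : M1 <= M) (hN1 : N1 <= M) (hM0 : M0 <= M)
 (hQ2 : Q2 <= M) (hQ1 : Q1 <= M) (hQ0 : Q0 <= M).

Lemma density_le : dens <= M * (wz * q).
Proof.
have wz0 : 0 <= wz by exact: le_trans wwz.
have up (A x : R) : 1 <= A -> A <= M -> 0 <= x -> w * (A * x) <= M * (wz * x).
  move=> A1 AM x0; rewrite mulrCA; apply: ler_pM => //.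
  - exact: le_trans A1.
  - exact: mulr_ge0.
  - by rewrite ler_wpM2r.
have upz (A x : R) : A <= M -> 0 <= x -> wz * (A * x) <= M * (wz * x).
  by move=> AM x0; rewrite mulrCA ler_wpM2r// mulr_ge0.
have := up _ _ M01 hM0 v00; have := up _ _ M01 hM0 y00; have := up _ _ M11 hM1 v10.
have := up _ _ M11 hM1 y10; have := up _ _ Q01 hQ0 p00; have := up _ _ Q11 hQ1 p10.
have := up _ _ Q21 hQ2 p20; have := up 1 _ (lexx _) hM v20; have := up 1 _ (lexx _) hM y20.
have := upz _ _ hN1 z10; have := upz _ _ hN2 z20; have := upz _ _ hM z00.
rewrite /dens /q; lra.
Qed.

End density.

End scalar.

Section scalar2.
Context {R : realFieldType}.

(** The letters v, z, y, p stand for the squares of the components, pv, pz, py, pp for the production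
    rates of their balances, and S for the square of (psi' - sigma) * expR (kap * x).  Of the damping
    lam / 2 or k / 2 of a component the rate th is kept; the rest, at least lam / 4 or k / 4, pays by means
    of its multiplier for the forcing that it exerts on the other components. *)
Lemma interior_bound (w wz m lam k th K K3 al N2 M1 N1 M0 Q2 Q1 Q0 : R)
  (v0 v1 v2 z0 z1 z2 y0 y1 y2 p0 p1 p2 S : R)
  (pv0 pv1 pv2 pz0 pz1 pz2 py0 py1 py2 pp0 pp1 pp2 : R) :
  0 <= w -> w <= wz -> wz <= m * w -> 0 <= th -> th <= lam / 4 -> th <= k / 4 -> 0 <= K -> 0 <= K3 -> 0 < al ->
  [/\ 1 <= N2, 1 <= M1, 1 <= N1 & 1 <= M0] -> [/\ 1 <= Q2, 1 <= Q1 & 1 <= Q0] ->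
  [/\ K <= N2 * (k / 4), K * m <= M1 * (lam / 4) & M1 * K <= N1 * (k / 4)] ->
  [/\ 0 <= v0, 0 <= v1 & 0 <= v2] -> [/\ 0 <= z0, 0 <= z1 & 0 <= z2] ->
  [/\ 0 <= y0, 0 <= y1 & 0 <= y2] -> [/\ 0 <= p0, 0 <= p1 & 0 <= p2] -> 0 <= S ->
  pv0 <= wz * (K3 * v0 + al * (z0 + S)) ->
  pv1 <= - (lam / 2) * (w * v1) + wz * (K * (v0 + z1 + S)) ->
  pv2 <= - (lam / 2) * (w * v2) + wz * (K * (v0 + v1 + z2 + S)) ->
  pz0 <= wz * (K3 * z0 + al * S) ->
  pz1 <= - (k / 2) * (wz * z1) + wz * (K * S) ->
  pz2 <= - (k / 2) * (wz * z2) + wz * (K * S) ->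
  py0 <= - (lam / 2) * (w * y0) ->
  py1 <= - (lam / 2) * (w * y1) + wz * (K * y0) ->
  py2 <= - (lam / 2) * (w * y2) + wz * (K * (y0 + y1)) ->
  pp0 <= - (lam / 2) * (w * p0) -> pp1 <= - (lam / 2) * (w * p1) ->
  pp2 <= - (lam / 2) * (w * p2) ->
  pv2 + py2 + N2 * pz2 + Q2 * pp2 + M1 * (pv1 + py1) + N1 * pz1 + Q1 * pp1
    + M0 * (pv0 + py0) + Q0 * pp0 + pz0 <=
  - th * (w * (v2 + y2 + Q2 * p2 + M1 * (v1 + y1) + Q1 * p1 + M0 * (v0 + y0) + Q0 * p0)
      + wz * (N2 * z2 + N1 * z1 + z0))
  + (M0 * (K3 + al + th) + K3 + th + 2 * (M1 + 1) * K) * (wz * (v0 + z0 + y0 + p0))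
  + ((M0 + 1) * al + (1 + M1 + N1 + N2) * K) * (wz * S).
Proof.
move=> w0 wwz wzm th0 thl thk K0 K30 al0 [N21 M11 N11 M01] [Q21 Q11 Q01] [c1 c2 c3].
move=> [v00 v10 v20] [z00 z10 z20] [y00 y10 y20] [p00 p10 p20] S0.
move=> hv0 hv1 hv2 hz0 hz1 hz2 hy0 hy1 hy2 hp0 hp1 hp2.
have pos (A : R) : 1 <= A -> 0 <= A by apply: le_trans.
have wz0 : 0 <= wz by exact: le_trans wwz.
have step (A p q r : R) : 0 <= A -> p <= q -> A * q <= r -> A * p <= r.
  by move=> A0 pq; apply: le_trans; rewrite ler_wpM2l.
have dampw (A x : R) : 0 <= A -> 0 <= x -> A * (th * (w * x)) <= A * (lam / 4 * (w * x)).
  by move=> A0 x0; rewrite ler_wpM2l// ler_wpM2r// mulr_ge0.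
have dampz (A x : R) : 0 <= A -> 0 <= x -> A * (th * (wz * x)) <= A * (k / 4 * (wz * x)).
  by move=> A0 x0; rewrite ler_wpM2l// ler_wpM2r// mulr_ge0.
have KM (x : R) : 0 <= x -> wz * (K * x) <= M1 * (lam / 4 * (w * x)).
  move=> x0; apply: (@le_trans _ _ ((m * w) * (K * x))).
    by rewrite ler_wpM2r// mulr_ge0.
  rewrite (_ : m * w * (K * x) = K * m * (w * x)); last by ring.
  by rewrite [leRHS]mulrA; apply: ler_wpM2r => //; exact: mulr_ge0.
have lam0 : 0 <= lam by lra.
have k0 : 0 <= k by lra.
have thw (A x : R) : 0 <= A -> 0 <= x -> A * (th * (w * x)) <= A * (th * (wz * x)).
  by move=> A0 x0; rewrite ler_wpM2l// ler_wpM2l// ler_wpM2r.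
have M00 := pos _ M01; have M10 := pos _ M11; have N10 := pos _ N11; have N20 := pos _ N21.
have Q00 := pos _ Q01; have Q10 := pos _ Q11; have Q20 := pos _ Q21.
have e_v2 : pv2 <= - th * (w * v2) + wz * (K * (v0 + S)) + M1 * (lam / 4 * (w * v1)) + N2 * (k / 4 * (wz * z2)).
  have := KM v1 v10; have := dampw 1 v2 ler01 v20.
  have : wz * (K * z2) <= N2 * (k / 4) * (wz * z2).
    by rewrite mulrCA ler_wpM2r// mulr_ge0.
  have : 0 <= lam / 4 * (w * v2) by rewrite mulr_ge0 ?divr_ge0 ?mulr_ge0.
  lra.
have e_y2 : py2 <= - th * (w * y2) + wz * (K * y0) + M1 * (lam / 4 * (w * y1)).
  have := KM y1 y10; have := dampw 1 y2 ler01 y20.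
  have : 0 <= lam / 4 * (w * y2) by rewrite mulr_ge0 ?divr_ge0 ?mulr_ge0.
  lra.
have e_z2 : N2 * pz2 <= - th * (N2 * (wz * z2)) - N2 * (k / 4 * (wz * z2)) + N2 * (wz * (K * S)).
  apply: (step _ _ _ _ N20 hz2); have := dampz N2 z2 N20 z20; lra.
have e_v1 : M1 * pv1 <= - th * (M1 * (w * v1)) - M1 * (lam / 4 * (w * v1))
    + M1 * (wz * (K * (v0 + S))) + N1 * (k / 4 * (wz * z1)).
  apply: (step _ _ _ _ M10 hv1); have := dampw M1 v1 M10 v10.
  have : M1 * K * (wz * z1) <= N1 * (k / 4) * (wz * z1) by rewrite ler_wpM2r// mulr_ge0.
  lra.
have e_y1 : M1 * py1 <= - th * (M1 * (w * y1)) - M1 * (lam / 4 * (w * y1)) + M1 * (wz * (K * y0)).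
  apply: (step _ _ _ _ M10 hy1); have := dampw M1 y1 M10 y10; lra.
have e_z1 : N1 * pz1 <= - th * (N1 * (wz * z1)) - N1 * (k / 4 * (wz * z1)) + N1 * (wz * (K * S)).
  apply: (step _ _ _ _ N10 hz1); have := dampz N1 z1 N10 z10; lra.
have e_p (A x p : R) : 0 <= A -> 0 <= x -> p <= - (lam / 2) * (w * x) -> A * p <= - th * (A * (w * x)).
  move=> A0 x0 hp; apply: (step _ _ _ _ A0 hp); have := dampw A x A0 x0.
  have : 0 <= A * (lam / 4 * (w * x)) by rewrite mulr_ge0// mulr_ge0 ?divr_ge0 ?mulr_ge0.
  lra.
have e_p2 := e_p _ _ _ Q20 p20 hp2.
have e_p1 := e_p _ _ _ Q10 p10 hp1.
have e_p0 := e_p _ _ _ Q00 p00 hp0.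
have e_y0 := e_p _ _ _ M00 y00 hy0.
have e_v0 : M0 * pv0 <= - th * (M0 * (w * v0)) + M0 * (th * (wz * v0)) + M0 * (wz * (K3 * v0 + al * (z0 + S))).
  have := thw M0 v0 M00 v00; have := ler_wpM2l M00 hv0; lra.
have e_z0 : pz0 <= - th * (wz * z0) + th * (wz * z0) + wz * (K3 * z0 + al * S) by lra.
have g0 (A B x : R) : 0 <= A -> 0 <= B -> 0 <= x -> 0 <= A * B * (wz * x).
  by move=> A0 B0 x0; rewrite !mulr_ge0.
have t1 := g0 _ _ _ M00 K30 z00. have t2 := g0 _ _ _ M00 K30 y00. have t3 := g0 _ _ _ M00 K30 p00.
have al0' := ltW al0.
have t4 := g0 _ _ _ M00 al0' v00. have t5 := g0 _ _ _ M00 al0' y00. have t6 := g0 _ _ _ M00 al0' p00.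
have t7 := g0 _ _ _ M00 th0 z00. have t8 := g0 _ _ _ M00 th0 y00. have t9 := g0 _ _ _ M00 th0 p00.
have ta := g0 _ _ _ M10 K0 v00. have tb := g0 _ _ _ M10 K0 z00. have tc := g0 _ _ _ M10 K0 y00.
have td := g0 _ _ _ M10 K0 p00.
have s1 := g0 _ _ _ ler01 K30 v00. have s2 := g0 _ _ _ ler01 K30 y00. have s3 := g0 _ _ _ ler01 K30 p00.
have s4 := g0 _ _ _ ler01 th0 v00. have s5 := g0 _ _ _ ler01 th0 y00. have s6 := g0 _ _ _ ler01 th0 p00.
have s7 := g0 _ _ _ ler01 K0 v00. have s8 := g0 _ _ _ ler01 K0 y00. have s9 := g0 _ _ _ ler01 K0 p00.
have sa := g0 _ _ _ ler01 K0 z00.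
clear - e_v2 e_y2 e_z2 e_v1 e_y1 e_z1 e_p2 e_p1 e_p0 e_y0 e_v0 e_z0 t1 t2 t3 t4 t5 t6 t7 t8 t9 ta tb tc td
 s1 s2 s3 s4 s5 s6 s7 s8 s9 sa.
lra.
Qed.

End scalar2.

Section scalar3.
Context {R : realFieldType}.

(** At the front, the fluxes of the outgoing components are at least b0 times their squares, those of the
    incoming ones at least - nu times theirs.  The trace relations turn the latter into outgoing
    squares, and the multipliers leave enough of these to pay for the part of the source that
    comes from the speed of the front: S is the square of psi' - sigma, and J an integral over x. *)
Lemma boundary_bound (b0 nu C2 I3 KS J N2 M1 N1 M0 Q2 Q1 Q0 : R)
  (v0 v1 v2 z0 z1 z2 y0 y1 y2 p0 p1 p2 S : R)
  (fv0 fv1 fv2 fz0 fz1 fz2 fy0 fy1 fy2 fp0 fp1 fp2 : R) :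
  0 <= b0 -> 0 <= nu -> 0 <= C2 -> 0 <= KS -> 0 <= J ->
  [/\ 1 <= N2, 1 <= M1, 1 <= N1 & 1 <= M0] -> [/\ 1 <= Q2, 1 <= Q1 & 1 <= Q0] ->
  N2 * nu * C2 <= M1 * b0 ->
  [/\ N2 * nu * C2 <= Q2 * b0, (N1 + N2) * nu * C2 <= Q1 * b0, (1 + (N1 + N2) * C2) * nu <= Q0 * b0 &
  (N1 + N2) * nu * C2 + KS * I3 <= M0 * b0] ->
  [/\ 0 <= v0, 0 <= v1 & 0 <= v2] ->
  [/\ 0 <= y0, 0 <= y1 & 0 <= y2] -> [/\ 0 <= p0, 0 <= p1 & 0 <= p2] ->
  z0 <= p0 -> z1 <= C2 * (p1 + p0 + v0 + y0) -> z2 <= C2 * (p2 + p1 + p0 + v0 + y0 + v1 + y1) ->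
  J * S <= I3 * (v0 + y0) ->
  b0 * v0 <= fv0 -> b0 * v1 <= fv1 -> b0 * v2 <= fv2 ->
  - nu * z0 <= fz0 -> - nu * z1 <= fz1 -> - nu * z2 <= fz2 ->
  b0 * y0 <= fy0 -> b0 * y1 <= fy1 -> b0 * y2 <= fy2 ->
  b0 * p0 <= fp0 -> b0 * p1 <= fp1 -> b0 * p2 <= fp2 ->
  KS * (J * S) <= fv2 + fy2 + N2 * fz2 + Q2 * fp2 + M1 * (fv1 + fy1) + N1 * fz1 + Q1 * fp1
    + M0 * (fv0 + fy0) + Q0 * fp0 + fz0.
Proof.
move=> b00 nu0 C20 KS0 J0 [N21 M11 N11 M01] [Q21 Q11 Q01] c4 [c5 c6 c7 c8].
move=> [v00 v10 v20] [y00 y10 y20] [p00 p10 p20] hz0 hz1 hz2 hS.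
move=> a1 a2 a3 b1 b2 b3 d1 d2 d3 e1 e2 e3.
have pos (A : R) : 1 <= A -> 0 <= A by apply: le_trans.
have M00 := pos _ M01; have M10 := pos _ M11; have N10 := pos _ N11; have N20 := pos _ N21.
have Q00 := pos _ Q01; have Q10 := pos _ Q11; have Q20 := pos _ Q21.
have {}hS := ler_wpM2l KS0 hS.
have nz0 : - nu * p0 <= - nu * z0 by rewrite !mulNr lerN2 ler_wpM2l.
have nz1 : N1 * (- nu * (C2 * (p1 + p0 + v0 + y0))) <= N1 * (- nu * z1).
  by rewrite ler_wpM2l// !mulNr lerN2 ler_wpM2l.
have nz2 : N2 * (- nu * (C2 * (p2 + p1 + p0 + v0 + y0 + v1 + y1))) <= N2 * (- nu * z2).
  by rewrite ler_wpM2l// !mulNr lerN2 ler_wpM2l.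
have {}b2 := ler_wpM2l N10 b2. have {}b3 := ler_wpM2l N20 b3.
have {}e1 := ler_wpM2l Q00 e1. have {}e2 := ler_wpM2l Q10 e2. have {}e3 := ler_wpM2l Q20 e3.
have {}a1 := ler_wpM2l M00 a1. have {}d1 := ler_wpM2l M00 d1.
have {}a2 := ler_wpM2l M10 a2. have {}d2 := ler_wpM2l M10 d2.
have k1 := ler_wpM2r v10 c4. have k2 := ler_wpM2r y10 c4.
have k3 := ler_wpM2r p20 c5. have k4 := ler_wpM2r p10 c6. have k5 := ler_wpM2r p00 c7.
have k6 := ler_wpM2r v00 c8. have k7 := ler_wpM2r y00 c8.
have l1 : 0 <= b0 * v2 by rewrite mulr_ge0. have l2 : 0 <= b0 * y2 by rewrite mulr_ge0.
clear - hS nz0 nz1 nz2 b1 b2 b3 e1 e2 e3 a1 a2 a3 d1 d2 d3 k1 k2 k3 k4 k5 k6 k7 l1 l2.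
lra.
Qed.

Lemma weighted_sum_le (X N2 Q2 M1 N1 Q1 M0 Q0 : R)
  (a1 a2 a3 a4 a5 a6 a7 a8 a9 a10 a11 a12 b1 b2 b3 b4 b5 b6 b7 b8 b9 b10 b11 b12 : R) :
  0 <= N2 -> 0 <= Q2 -> 0 <= M1 -> 0 <= N1 -> 0 <= Q1 -> 0 <= M0 -> 0 <= Q0 ->
  a1 <= X * b1 -> a2 <= X * b2 -> a3 <= X * b3 -> a4 <= X * b4 -> a5 <= X * b5 -> a6 <= X * b6 ->
  a7 <= X * b7 -> a8 <= X * b8 -> a9 <= X * b9 -> a10 <= X * b10 -> a11 <= X * b11 -> a12 <= X * b12 ->
  a1 + a2 + N2 * a3 + Q2 * a4 + M1 * (a5 + a6) + N1 * a7 + Q1 * a8 + M0 * (a9 + a10) + Q0 * a11 + a12 <=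
  X * (b1 + b2 + N2 * b3 + Q2 * b4 + M1 * (b5 + b6) + N1 * b7 + Q1 * b8 + M0 * (b9 + b10) + Q0 * b11 + b12).
Proof.
move=> h1 h2 h3 h4 h5 h6 h7 c1 c2 c3 c4 c5 c6 c7 c8 c9 c10 c11 c12.
have {}c3 := ler_wpM2l h1 c3. have {}c4 := ler_wpM2l h2 c4. have {}c5 := ler_wpM2l h3 c5.
have {}c6 := ler_wpM2l h3 c6. have {}c7 := ler_wpM2l h4 c7. have {}c8 := ler_wpM2l h5 c8.
have {}c9 := ler_wpM2l h6 c9. have {}c10 := ler_wpM2l h6 c10. have {}c11 := ler_wpM2l h7 c11.
lra.
Qed.

End scalar3.

(** * The energy estimate *)

Section frame.
Context {R : realType}.

(** What the energy estimate uses of a perturbation, written for the frame of the front: V and Z are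
    behind it, Y and P ahead of it and reflected.  The last
    fields, from fr_speed on, are the consequences of the conditions at the front. *)
Record frame (k sg nu c1 c A1 C kap eta T : R) (s : R -> R) (V Z Y P : nat -> R -> R -> R) : Prop := Frame {
  fr_V : forall j, (j < 3)%N -> outgoing T c1 c A1 kap eta (V j)
    (fun t x => C * (\sum_(i < j) `|V i t x| + `|Z j t x| + `|s t - sg| * expR (kap * x)));
  fr_Z : forall j, (j < 3)%N -> incoming T k s (Z j) (fun t x => C * (`|s t - sg| * expR (kap * x)));
  fr_Y : forall j, (j < 3)%N -> outgoing T c1 c A1 kap eta (Y j) (fun t x => C * \sum_(i < j) `|Y i t x|);
  fr_P : forall j, (j < 3)%N -> outgoing T c1 c A1 kap eta (P j) (fun _ _ => 0);
  fr_s : forall t, 0 < t < T -> 0 <= s t <= nu;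
  fr_speed : forall t, 0 < t < T -> `|s t - sg| <= C * (`|V 0 t 0| + `|Y 0 t 0|);
  fr_Z0 : forall t, 0 < t < T -> `|Z 0 t 0| <= `|P 0 t 0|;
  fr_Z1 : forall t, 0 < t < T -> `|Z 1 t 0| <= C * (`|P 1 t 0| + `|P 0 t 0| + `|V 0 t 0| + `|Y 0 t 0|);
  fr_Z2 : forall t, 0 < t < T -> `|Z 2 t 0| <= C * (`|P 2 t 0| + `|P 1 t 0| + `|P 0 t 0|
     + `|V 0 t 0| + `|Y 0 t 0| + `|V 1 t 0| + `|Y 1 t 0|) }.

Definition qlevel (V Z Y P : nat -> R -> R -> R) (j : nat) (t x : R) : R :=
  V j t x ^+ 2 + Z j t x ^+ 2 + Y j t x ^+ 2 + P j t x ^+ 2.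

Definition mass (eps c N : R) (q : R -> R -> R) (t : R) : R :=
  sint (- N) 0 (fun x => cutoff c N t x * (wexp eps x * q t x)).

Lemma sint_exp_le (b N : R) : 0 < b -> 0 < N -> sint (- N) 0 (fun x => expR (b * x)) <= b^-1.
Proof.
move=> b0 N0.
have -> : sint (- N) 0 (fun x => expR (b * x)) = b^-1 * expR (b * 0) - b^-1 * expR (b * - N).
  apply: (@sint_FTC _ _ _ _ (fun x => b^-1 * expR (b * x))); first by rewrite oppr_lt0.
    exact: contEX.
  move=> x; have := derivZ b^-1 (derivEX b x).
  by rewrite mulrA mulVf ?gt_eqF// mul1r.
by rewrite mulr0 expR0 mulr1 gerBl mulr_ge0 ?expR_ge0// invr_ge0 ltW.
Qed.

Lemma sum1 (F : nat -> R) : \sum_(i < 1) F i = F 0%N.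
Proof. by rewrite big_ord_recr big_ord0 /= add0r. Qed.

Lemma sum2 (F : nat -> R) : \sum_(i < 2) F i = F 0%N + F 1%N.
Proof. by rewrite 2!big_ord_recr big_ord0 /= add0r. Qed.

(** The combination G of all the localised squares, with the multipliers, satisfies a balance whose
    source is at most - th * G up to the level 0 mass and the front speed, and whose flux at the front
    dominates the contribution of the front speed.  Hence E' <= - th * E + Kf * L for the integral E of G and the
    level 0 mass L, and L <= m * E makes this an inequality in sqrt E * sqrt L. *)
Theorem frame_energy (k sg nu c1 c A1 C kap eps : R) : 0 < k -> 0 <= nu -> 0 < c1 -> c1 <= c ->
  0 <= A1 -> 0 <= C -> 0 < kap -> 0 < eps -> eps * nu <= k -> eps < 2 * kap ->
  exists theta D, [/\ 0 < theta, 0 < D &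
   forall eta T s V Z Y P, 0 <= eta -> 3 * A1 * eta <= eps * c1 / 2 ->
    frame k sg nu c1 c A1 C kap eta T s V Z Y P ->
    forall N, 0 < N -> 2 * (c * T) <= N ->
    forall t, 0 <= t <= T ->
    Num.sqrt (mass eps c N (fun t x => qlevel V Z Y P 0 t x + qlevel V Z Y P 1 t x + qlevel V Z Y P 2 t x) t)
    <= D * expR (- theta * t)
       * Num.sqrt (mass eps c N (fun t x => qlevel V Z Y P 0 t x + qlevel V Z Y P 1 t x + qlevel V Z Y P 2 t x) 0)
     + sint 0 t (fun r => D * expR (- theta * (t - r)) * Num.sqrt (mass eps c N (qlevel V Z Y P 0) r))].
Proof.
move=> k0 nu0 c10 c1c A10 C0 kap0 eps0 epsnu epskap.
have c0 : 0 <= c by lra.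
pose lam := eps * c1 / 2.
have lam0 : 0 < lam by rewrite divr_gt0// mulr_gt0.
(* the least B for which the damping factor absorbs the terms localised near the front *)
pose B := 3 * A1 / (kap * c1).
have B0 : 0 <= B by rewrite /B; nonneg.
have HB : 3 * A1 <= B * kap * c1.
  by rewrite -mulrA /B divfK// gt_eqF// mulr_gt0.
(* m bounds the ratio of the two weights *)
pose m := expR B.
have m0 : 0 < m by exact: expR_gt0.
have m1 : 1 <= m by rewrite /m -expR0 ler_expR.
pose K := (2 / lam + 2 / k) * (4 * C ^+ 2).
have C20 : 0 <= C ^+ 2 by exact: sqr_ge0.
have K0 : 0 <= K by rewrite /K; nonneg.
pose b0 := c1 / (4 * m).
have b00 : 0 < b0 by rewrite divr_gt0// mulr_gt0.
pose C2 := 8 * C ^+ 2.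
have C2_0 : 0 <= C2 by rewrite /C2; nonneg.
pose I0 := (2 * kap - eps)^-1.
have I00 : 0 < I0 by rewrite invr_gt0 subr_gt0.
pose I3 := I0 * (2 * C ^+ 2).
have I30 : 0 <= I3 by rewrite /I3; nonneg.
have [N2 [M1 [N1 [M0 [Q2 [Q1 [Q0 [al]]]]]]]] :=
  multipliers lam0 k0 K0 (ltW m0) nu0 b00 C2_0 I30.
move=> [HM [Q21 Q11 Q01 al0] [HN2 HM1 HN1 HM1b] [HQ2 HQ1 HQ0 HM0]].
have [N21 M11 N11 M01] := HM.
pose al' := al / (4 * C ^+ 2 + 1).
have d0 : 0 < 4 * C ^+ 2 + 1 by rewrite ltr_wpDl//; nonneg.
have al'0 : 0 < al' by apply: divr_gt0.
have Hal' : al' * (4 * C ^+ 2) <= al.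
  by rewrite /al' mulrAC ler_pdivrMr// ler_wpM2l ?lerDl// ltW.
pose K3 := al'^-1.
have K30 : 0 <= K3 by rewrite invr_ge0 ltW.
pose th := Num.min (lam / 4) (k / 4).
have th0 : 0 < th by rewrite /th lt_min; apply/andP; split; apply: divr_gt0.
have thl : th <= lam / 4 by rewrite ge_min lexx.
have thk : th <= k / 4 by rewrite ge_min lexx orbT.
pose Kf := M0 * (K3 + al + th) + K3 + th + 2 * (M1 + 1) * K.
pose KS := (M0 + 1) * al + (1 + M1 + N1 + N2) * K.
have pos (A : R) : 1 <= A -> 0 <= A by apply: le_trans.
have M00 := pos _ M01; have M10 := pos _ M11; have N10 := pos _ N11; have N20 := pos _ N21.
have Q00 := pos _ Q01; have Q10 := pos _ Q11; have Q20 := pos _ Q21.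
have KS0 : 0 <= KS.
  by rewrite /KS; nonneg.
have Kf0 : 0 <= Kf.
  by rewrite /Kf; nonneg.
have [Mx [Mx1 MxN2 MxM1 [MxN1 MxM0 MxQ2 MxQ1 MxQ0]]] := common_bound N21 M11 N11 M01 Q21 Q11 Q01.
have Mx0 : 0 < Mx by exact: lt_le_trans Mx1.
exists (th / 2), (m * Mx + Kf * m * m); split; first by rewrite divr_gt0.
  by rewrite ltr_pwDl ?mulr_gt0//; nonneg.
move=> eta T s V Z Y P eta0 Heta fr N N0 HN t0 t0T.
have oV j (j3 : (j < 3)%N) := outgoing_balance (fr_V fr j3) N0 c10 c1c A10 kap0 eps0 eta0 B0 HB Heta.
have oY j (j3 : (j < 3)%N) := outgoing_balance (fr_Y fr j3) N0 c10 c1c A10 kap0 eps0 eta0 B0 HB Heta.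
have oP j (j3 : (j < 3)%N) := outgoing_balance (fr_P fr j3) N0 c10 c1c A10 kap0 eps0 eta0 B0 HB Heta.
have oZ j (j3 : (j < 3)%N) := incoming_balance (fr_Z fr j3) N0 c0 eps0 epsnu (fr_s fr).
have [pV0 [dV0 [bV0 hV0 fV0 eV0]]] := oV 0%N isT.
have [pV1 [dV1 [bV1 hV1 fV1 eV1]]] := oV 1%N isT.
have [pV2 [dV2 [bV2 hV2 fV2 eV2]]] := oV 2%N isT.
have [pY0 [dY0 [bY0 hY0 fY0 eY0]]] := oY 0%N isT.
have [pY1 [dY1 [bY1 hY1 fY1 eY1]]] := oY 1%N isT.
have [pY2 [dY2 [bY2 hY2 fY2 eY2]]] := oY 2%N isT.
have [pP0 [dP0 [bP0 hP0 fP0 eP0]]] := oP 0%N isT.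
have [pP1 [dP1 [bP1 hP1 fP1 eP1]]] := oP 1%N isT.
have [pP2 [dP2 [bP2 hP2 fP2 eP2]]] := oP 2%N isT.
have [pZ0 [dZ0 [bZ0 hZ0 fZ0 eZ0]]] := oZ 0%N isT.
have [pZ1 [dZ1 [bZ1 hZ1 fZ1 eZ1]]] := oZ 1%N isT.
have [pZ2 [dZ2 [bZ2 hZ2 fZ2 eZ2]]] := oZ 2%N isT.
clear oV oY oP oZ.
have bal := balanceD (balanceD (balanceD (balanceD (balanceD (balanceD (balanceD (balanceD (balanceD
  bV2 bY2) (balanceZ N2 bZ2)) (balanceZ Q2 bP2)) (balanceZ M1 (balanceD bV1 bY1)))
  (balanceZ N1 bZ1)) (balanceZ Q1 bP1)) (balanceZ M0 (balanceD bV0 bY0))) (balanceZ Q0 bP0)) bZ0.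
set G := (X in balance _ X _ _) in bal.
have NN : - N < 0 by rewrite oppr_lt0.
have [E' HE'] := balance_energy NN bal.
pose w x := wdamp eps B kap x.
pose wz x := wexp eps x.
pose X t x := cutoff c N t x.
pose q t x := qlevel V Z Y P 0 t x + qlevel V Z Y P 1 t x + qlevel V Z Y P 2 t x.
have GE t x : G t x = X t x * (w x * (V 2 t x ^+ 2 + Y 2 t x ^+ 2 + Q2 * P 2 t x ^+ 2
   + M1 * (V 1 t x ^+ 2 + Y 1 t x ^+ 2) + Q1 * P 1 t x ^+ 2 + M0 * (V 0 t x ^+ 2 + Y 0 t x ^+ 2)
   + Q0 * P 0 t x ^+ 2) + wz x * (N2 * Z 2 t x ^+ 2 + N1 * Z 1 t x ^+ 2 + Z 0 t x ^+ 2)).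
  by rewrite /G /w /wz /X; ring.
have w0 x : 0 < w x by exact: wdamp_gt0.
have wwz x : w x <= wz x by exact: wdamp_le.
have wzw x : x <= 0 -> wz x <= m * w x by move=> x0; apply: wexp_le => //; exact: ltW.
have X0 t x : 0 <= X t x by exact: cutoff_ge0.
have massG t x : x <= 0 -> X t x * (wz x * q t x) <= m * G t x.
  move=> x0; rewrite GE [leRHS]mulrCA ler_wpM2l// /q /qlevel.
  by apply: density_ge; rewrite ?sqr_ge0// ?wzw// ltW.
have Gmass t x : G t x <= Mx * (X t x * (wz x * q t x)).
  rewrite GE [leRHS]mulrCA ler_wpM2l// /q /qlevel.
  by apply: density_le; rewrite ?sqr_ge0// ltW.
have G0 t x : 0 <= G t x.
  rewrite GE; apply: mulr_ge0 => //; have wz0 : 0 <= wz x by exact: (ltW (wexp_gt0 _ _)).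
  by have wx0 := ltW (w0 x); nonneg.
have [gt_ [px_ [cG _ _ _ _]]] := bal.
have cV j : (j < 3)%N -> cont2 (V j) by move=> /(fr_V fr)[? [? [? [[]]]]].
have cY j : (j < 3)%N -> cont2 (Y j) by move=> /(fr_Y fr)[? [? [? [[]]]]].
have cP j : (j < 3)%N -> cont2 (P j) by move=> /(fr_P fr)[? [? [? [[]]]]].
have cZ j : (j < 3)%N -> cont2 (Z j) by move=> /(fr_Z fr)[? [[]]].
have cq j : (j < 3)%N -> cont2 (qlevel V Z Y P j).
  move=> j3; have h1 : cont2 (fun t x => V j t x ^+ 2) by apply: cont2X; exact: cV.
  have h2 : cont2 (fun t x => Z j t x ^+ 2) by apply: cont2X; exact: cZ.
  have h3 : cont2 (fun t x => Y j t x ^+ 2) by apply: cont2X; exact: cY.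
  have h4 : cont2 (fun t x => P j t x ^+ 2) by apply: cont2X; exact: cP.
  exact: (cont2D (cont2D (cont2D h1 h2) h3) h4).
have cmass qq : cont2 qq -> cont2 (fun t x => X t x * (wz x * qq t x)).
  move=> cqq; apply: cont2M; first exact: cont2_cutoff.
  by apply: cont2M => //; apply: cont2_of_x; exact: cont_wexp.
pose E t := sint (- N) 0 (G t).
pose L := mass eps c N (qlevel V Z Y P 0).
have cq3 : cont2 q by exact: (cont2D (cont2D (cq 0%N isT) (cq 1%N isT)) (cq 2%N isT)).
have cL0 := cmass _ (cq 0%N isT).
have cE : continuous E by exact: sint_cont.
have cL : continuous L by exact: sint_cont.
have E0 t : 0 <= E t by apply: sint_ge0.
have L0 t : 0 <= L t.
  apply: sint_ge0 => x _; apply: mulr_ge0 => //.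
  by rewrite mulr_ge0 ?(ltW (wexp_gt0 _ _))// /qlevel; nonneg.
have LE t : L t <= m * E t.
  rewrite /L /mass /E -sintZ; last exact: (cont2_x cG).
  apply: sint_le; [exact: (cont2_x cL0)|by apply: contM; [exact: contC|exact: (cont2_x cG)]|].
  move=> x /andP[_ x0]; apply: le_trans (massG t x x0); rewrite ler_wpM2l// ler_wpM2l ?(ltW (wexp_gt0 _ _))//.
  by rewrite /q -addrA lerDl addr_ge0// /qlevel; nonneg.
have mE t : mass eps c N q t <= m * E t.
  rewrite /mass /E -sintZ; last exact: (cont2_x cG).
  apply: sint_le; [exact: (cont2_x (cmass _ cq3))|by apply: contM; [exact: contC|exact: (cont2_x cG)]|].
  by move=> x /andP[_ x0]; exact: massG.
have Em t : E t <= Mx * mass eps c N q t.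
  have cm := cont2_x (cmass _ cq3).
  rewrite /mass /E -sintZ; last exact: cm.
  apply: sint_le; [exact: (cont2_x cG)|by apply: contM; [exact: contC|exact: cm]|].
  by move=> x _; exact: Gmass.
have KC1 : 2 / lam * (4 * C ^+ 2) <= K.
  by rewrite /K ler_wpM2r ?mulr_ge0// lerDl divr_ge0// ltW.
have KC2 : 2 / k * (4 * C ^+ 2) <= K.
  by rewrite /K ler_wpM2r ?mulr_ge0// lerDr divr_ge0// ltW.
have wz0 x : 0 < wz x by exact: wexp_gt0.
have nk (x : R) : `|x| ^+ 2 = x ^+ 2 by rewrite real_normK// num_real.
have interior t x : 0 < t < T -> x <= 0 ->
    dV2 t x + dY2 t x + N2 * dZ2 t x + Q2 * dP2 t x + M1 * (dV1 t x + dY1 t x) + N1 * dZ1 t x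
      + Q1 * dP1 t x + M0 * (dV0 t x + dY0 t x) + Q0 * dP0 t x + dZ0 t x <=
    - th * G t x + Kf * (X t x * (wz x * qlevel V Z Y P 0 t x))
      + KS * (X t x * (wz x * (`|s t - sg| * expR (kap * x)) ^+ 2)).
  move=> tT x0.
  have := hV0 t x tT x0; have := hV1 t x tT x0; have := hV2 t x tT x0.
  have := hY0 t x tT x0; have := hY1 t x tT x0; have := hY2 t x tT x0.
  have := hP0 t x tT x0; have := hP1 t x tT x0; have := hP2 t x tT x0.
  have := hZ0 t x tT x0; have := hZ1 t x tT x0; have := hZ2 t x tT x0.
  rewrite -!/(w x) -!/(wz x) -!/(X t x) -/lam.
  rewrite (sum1 (fun i => `|V i t x|)) (sum2 (fun i => `|V i t x|)).
  rewrite (sum1 (fun i => `|Y i t x|)) (sum2 (fun i => `|Y i t x|)) !big_ord0 add0r (mulr0 C).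
  set S := `|s t - sg| * expR (kap * x).
  have wx0 := w0 x; have wwx := wwz x; have wzx0 := wz0 x.
  have S20 : 0 <= S ^+ 2 by exact: sqr_ge0.
  have b1 := undamped_forced (V 0%N t x) wx0 wwx (ltW lam0) al'0 Hal' _ (forcing2 C `|Z 0%N t x| S).
  have b2 := damped_forced (V 1%N t x) wx0 wwx lam0 KC1 _ (forcing3 C `|V 0%N t x| `|Z 1%N t x| S).
  have b3 := damped_forced (V 2%N t x) wx0 wwx lam0 KC1 _ (forcing4 C `|V 0%N t x| `|V 1%N t x| `|Z 2%N t x| S).
  have b4 := undamped_forced (Z 0%N t x) wzx0 (lexx _) (ltW k0) al'0 Hal' _ (forcing1 C S).
  have b5 := damped_forced (Z 1%N t x) wzx0 (lexx _) k0 KC2 _ (forcing1 C S).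
  have b6 := damped_forced (Z 2%N t x) wzx0 (lexx _) k0 KC2 _ (forcing1 C S).
  have b8 := damped_forced (Y 1%N t x) wx0 wwx lam0 KC1 _ (forcing1 C `|Y 0%N t x|).
  have b9 := damped_forced (Y 2%N t x) wx0 wwx lam0 KC1 _ (forcing2 C `|Y 0%N t x| `|Y 1%N t x|).
  have bb (h : R) := damped_free h (ltW wx0) (ltW lam0).
  rewrite !nk in b1 b2 b3 b4 b5 b6 b8 b9.
  have {}b1 := b1 (addr_ge0 (sqr_ge0 _) (sqr_ge0 _)).
  have {}b2 := b2 (addr_ge0 (addr_ge0 (sqr_ge0 _) (sqr_ge0 _)) (sqr_ge0 _)).
  have {}b3 := b3 (addr_ge0 (addr_ge0 (addr_ge0 (sqr_ge0 _) (sqr_ge0 _)) (sqr_ge0 _)) (sqr_ge0 _)).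
  have {}b4 := b4 S20. have {}b5 := b5 S20. have {}b6 := b6 S20.
  have {}b8 := b8 (sqr_ge0 _). have {}b9 := b9 (addr_ge0 (sqr_ge0 _) (sqr_ge0 _)).
  have HQ : [/\ 1 <= Q2, 1 <= Q1 & 1 <= Q0] by [].
  have HN3 : [/\ K <= N2 * (k / 4), K * m <= M1 * (lam / 4) & M1 * K <= N1 * (k / 4)] by [].
  have s3 (a b d : R) : [/\ 0 <= a ^+ 2, 0 <= b ^+ 2 & 0 <= d ^+ 2] by split; exact: sqr_ge0.
  have ib := interior_bound (ltW wx0) wwx (wzw x x0) (ltW th0) thl thk K0 K30 al0 HM HQ HN3
   (s3 _ _ _) (s3 _ _ _) (s3 _ _ _) (s3 _ _ _) S20 b1 b2 b3 b4 b5 b6 (bb (Y 0%N t x)) b8 b9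
   (bb (P 0%N t x)) (bb (P 1%N t x)) (bb (P 2%N t x)).
  move=> hz2 hz1 hz0 hp2 hp1 hp0 hy2 hy1 hy0 hv2 hv1 hv0.
  apply: (le_trans (weighted_sum_le N20 Q20 M10 N10 Q10 M00 Q00 hv2 hy2 hz2 hp2 hv1 hy1 hz1 hp1 hv0 hy0 hp0 hz0)).
  apply: (le_trans (ler_wpM2l (X0 t x) ib)).
  rewrite GE /qlevel -/Kf -/KS le_eqVlt; apply/orP; left; apply/eqP; ring.
have HE t : 0 < t < T -> E' t <= - th * E t + Kf * L t.
  move=> tT; have [_ HEt] := HE' t tT.
  have /andP[t_0 t_T] := tT.
  pose S0 := `|s t - sg| ^+ 2.
  have S00 : 0 <= S0 by exact: sqr_ge0.
  pose hh x := - th * G t x + Kf * (X t x * (wz x * qlevel V Z Y P 0 t x))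
    + KS * S0 * expR ((2 * kap - eps) * x).
  have ch1 : continuous (fun x => - th * G t x) by apply: contM; [exact: contC|exact: (cont2_x cG)].
  have ch2 : continuous (fun x => Kf * (X t x * (wz x * qlevel V Z Y P 0 t x))).
    by apply: contM; [exact: contC|exact: (cont2_x cL0)].
  have ch12 := contD ch1 ch2.
  have ch3 : continuous (fun x => KS * S0 * expR ((2 * kap - eps) * x)).
    by apply: contM; [exact: contC|exact: contEX].
  have {HEt} := HEt hh (contD ch12 ch3).
  rewrite (eV0 t tT) (eV1 t tT) (eV2 t tT) (eY0 t tT) (eY1 t tT) (eY2 t tT) (eP0 t tT) (eP1 t tT).
  rewrite (eP2 t tT) (eZ0 t tT) (eZ1 t tT) (eZ2 t tT) !(mulr0, addr0).
  rewrite /hh (sintD _ _ ch12 ch3) (sintD _ _ ch1 ch2).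
  rewrite (sintZ _ _ _ (cont2_x cG)) (sintZ _ _ _ (cont2_x cL0)) (sintZ _ _ _ (@contEX _ (2 * kap - eps))).
  rewrite -/(E t) -/(mass eps c N (qlevel V Z Y P 0) t) -/(L t).
  set J := sint _ _ (fun x => expR _).
  set bdry := (X in _ <= _ - X) => HEt.
  have J0 : 0 <= J by apply: sint_ge0 => x _; exact: expR_ge0.
  have JI : J <= I0 by apply: sint_exp_le => //; rewrite subr_gt0.
  have {}HEt : E' t <= - th * E t + Kf * L t + KS * S0 * J - bdry.
    apply: HEt => x /andP[_ x0]; apply: (le_trans (interior t x tT x0)).
    rewrite lerD2l -mulrA ler_wpM2l// exprMn.
    rewrite (_ : expR ((2 * kap - eps) * x) = wz x * expR (kap * x) ^+ 2); last first.
      by rewrite /wz /wexp expr2 -!expRD; congr expR; ring.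
    rewrite (_ : X t x * _ = X t x * (S0 * (wz x * expR (kap * x) ^+ 2))); last by rewrite /S0; ring.
    apply: ler_piMl.
      by apply: mulr_ge0 => //; apply: mulr_ge0; [exact: ltW|exact: sqr_ge0].
    by apply: cutoff_le1 => //; exact: ltW.
  suff bd : KS * (J * S0) <= bdry by move: HEt bd; clear; lra.
  have X4 : 4^-1 <= X t 0.
    have ctT : 0 <= t <= T by rewrite !ltW.
    by apply: (@cutoff_ge _ _ _ _ _ 0 _ c0 ctT) => //; rewrite ?oppr0// add0r.
  have X1 : X t 0 <= 1 by apply: cutoff_le1 => //; exact: ltW.
  have mw : 1 <= m * w 0 by have := wzw 0 (lexx _); rewrite /wz /wexp mulr0 expR0.
  have bA (h ph : R) : c1 * (X t 0 * (w 0 * h ^+ 2)) <= ph -> b0 * h ^+ 2 <= ph.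
    apply: le_trans; rewrite (_ : c1 * _ = c1 * X t 0 * w 0 * h ^+ 2); last by ring.
    apply: ler_wpM2r; [exact: sqr_ge0|rewrite /b0].
    by apply: outflow_rate => //; exact: ltW.
  have bZ (h ph : R) : - nu * (X t 0 * (wz 0 * h ^+ 2)) <= ph -> - nu * h ^+ 2 <= ph.
    apply: le_trans; rewrite !mulNr lerN2 ler_wpM2l// /wz /wexp mulr0 expR0 mul1r.
    by apply: ler_piMl => //; exact: sqr_ge0.
  have sqle (a b : R) : `|a| <= b -> a ^+ 2 <= b ^+ 2.
    by move=> ab; rewrite -(nk a) ler_pXn2r// ?nnegrE ?normr_ge0// (le_trans (normr_ge0 a)).
  have sp := le_trans (sqle _ _ (fr_speed fr tT)) (forcing2' _ _ _).
  have tz0 := sqle _ _ (fr_Z0 fr tT).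
  have tz1 := le_trans (sqle _ _ (fr_Z1 fr tT)) (forcing4 _ _ _ _ _).
  have tz2 := le_trans (sqle _ _ (fr_Z2 fr tT)) (forcing7 _ _ _ _ _ _ _ _).
  rewrite !nk in sp tz0 tz1 tz2.
  have {}tz1 : Z 1%N t 0 ^+ 2 <= C2 * (P 1%N t 0 ^+ 2 + P 0%N t 0 ^+ 2 + V 0%N t 0 ^+ 2 + Y 0%N t 0 ^+ 2).
    by apply: (le_trans tz1); rewrite ler_wpM2r ?addr_ge0 ?sqr_ge0// /C2 ler_wpM2r// ler_nat.
  have HS : J * S0 <= I3 * (V 0%N t 0 ^+ 2 + Y 0%N t 0 ^+ 2).
    rewrite /S0 nk /I3 -mulrA; apply: ler_pM => //; exact: sqr_ge0.
  have s3 (a b d : R) : [/\ 0 <= a ^+ 2, 0 <= b ^+ 2 & 0 <= d ^+ 2] by split; exact: sqr_ge0.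
  exact: (boundary_bound (ltW b00) nu0 C2_0 KS0 J0 HM (And3 Q21 Q11 Q01) HM1b
    (And4 HQ2 HQ1 HQ0 HM0) (s3 _ _ _) (s3 _ _ _) (s3 _ _ _) tz0 tz1 tz2 HS
    (bA _ _ (fV0 t tT)) (bA _ _ (fV1 t tT)) (bA _ _ (fV2 t tT))
    (bZ _ _ (fZ0 t tT)) (bZ _ _ (fZ1 t tT)) (bZ _ _ (fZ2 t tT))
    (bA _ _ (fY0 t tT)) (bA _ _ (fY1 t tT)) (bA _ _ (fY2 t tT))
    (bA _ _ (fP0 t tT)) (bA _ _ (fP1 t tT)) (bA _ _ (fP2 t tT))).
have sqm (a b M : R) : 1 <= M -> 0 <= b -> a <= M * b -> Num.sqrt a <= M * Num.sqrt b.
  move=> M1_ b_0 ab; have M_0 := pos _ M1_.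
  apply: (@le_trans _ _ (Num.sqrt (M ^+ 2 * b))); last by rewrite sqrtrM ?sqr_ge0// sqrtr_sqr ger0_norm.
  by rewrite ler_wsqrtr// (le_trans ab)// ler_wpM2r// expr2 ler_peMl.
have mass0 r : 0 <= mass eps c N q r.
  apply: sint_ge0 => x _; apply: mulr_ge0 => //; apply: mulr_ge0; first exact: ltW (wz0 x).
  by rewrite /q /qlevel !addr_ge0// sqr_ge0.
(* L = sqrt L * sqrt L, and sqrt L <= m * sqrt E since m >= 1 *)
have HE2 t : 0 < t < T -> E' t <= - (2 * (th / 2)) * E t + 2 * (Kf * m / 2) * (Num.sqrt (E t) * Num.sqrt (L t)).
  move=> tT; apply: (le_trans (HE t tT)).
  rewrite (_ : 2 * (th / 2) = th); last by field.
  rewrite (_ : 2 * (Kf * m / 2) = Kf * m); last by field.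
  rewrite lerD2l -mulrA ler_wpM2l// -{1}(sqr_sqrtr (L0 t)) expr2 mulrA ler_wpM2r ?sqrtr_ge0//.
  exact: sqm (LE t).
have gr := gronwall_sqrt (divr_ge0 (ltW th0) (ler0n _ 2)) (divr_ge0 (mulr_ge0 Kf0 (ltW m0)) (ler0n _ 2))
   cE cL E0 (fun t tT => (HE' t tT).1) HE2 t0T.
apply: (le_trans (sqm _ _ _ m1 (E0 t0) (mE t0))).
have KD : 0 <= Kf * m by rewrite mulr_ge0// ltW.
apply: (le_trans (ler_wpM2l (ltW m0) gr)); rewrite mulrDr; apply: lerD.
  apply: (@le_trans _ _ (m * (expR (- (th / 2) * t0) * (Mx * Num.sqrt (mass eps c N q 0))))).
    rewrite ler_wpM2l ?(ltW m0)// ler_wpM2l ?expR_ge0//; exact: sqm (Em 0).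
  rewrite (_ : m * _ = m * Mx * expR (- (th / 2) * t0) * Num.sqrt (mass eps c N q 0)); last by ring.
  by rewrite ler_wpM2r ?sqrtr_ge0// ler_wpM2r ?expR_ge0// lerDl mulr_ge0// ltW.
have cI : continuous (fun r => expR (- (th / 2) * (t0 - r)) * Num.sqrt (L r)).
  apply: contM; last exact: contsqrt.
  rewrite (_ : (fun r => _) = (fun r => expR (- (th / 2) * t0) * expR ((th / 2) * r))); last first.
    by apply/funext => r; rewrite -expRD; congr expR; ring.
  by apply: contM; [exact: contC|exact: contEX].
have sE D : sint 0 t0 (fun r => D * expR (- (th / 2) * (t0 - r)) * Num.sqrt (L r)) =
   D * sint 0 t0 (fun r => expR (- (th / 2) * (t0 - r)) * Num.sqrt (L r)).
  by rewrite -sintZ//; apply: sint_eq => r _; rewrite mulrA.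
rewrite -/L !sE mulrA ler_wpM2r//.
  by apply: sint_ge0 => r _; rewrite mulr_ge0 ?sqrtr_ge0 ?expR_ge0.
by move: (mulr_ge0 (ltW m0) (ltW Mx0)) (mulr_ge0 KD (ltW m0)); clear; lra.
Qed.

End frame.

(** * The wave profile *)

Section smooth_functions.
Context {R : realType}.
Implicit Types (f P : R -> R) (x a : R).

Lemma smooth_d f n x : smooth f -> is_derive x 1 (derive1n n f) (derive1n n.+1 f x).
Proof. by move=> sf; rewrite derive1nS; apply: deriveE; exact: sf. Qed.

Lemma smooth_c f n : smooth f -> continuous (derive1n n f).
Proof. by move=> sf x; exact: (is_derive_cont (smooth_d n x sf)). Qed.

Lemma cont_bounded f (r : R) : continuous f -> exists2 M, 0 <= M & forall x, `|x| <= r -> `|f x| <= M.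
Proof.
move=> cf; have [M M0 H] := cont2_bounded 0 0 (- r) r (cont2_of_x cf).
by exists M => // x xr; apply: (H 0) => //; rewrite ?lexx// -ler_norml.
Qed.

Lemma smooth_bounded f (r : R) : smooth f ->
  exists2 M, 0 <= M & forall n x, (n <= 4)%N -> `|x| <= r -> `|derive1n n f x| <= M.
Proof.
move=> sf; have H n := cont_bounded r (smooth_c (n := n) sf).
have [M0 M00 H0] := H 0%N. have [M1 M10 H1] := H 1%N. have [M2 M20 H2] := H 2%N.
have [M3 M30 H3] := H 3%N. have [M4 M40 H4] := H 4%N.
exists (M0 + M1 + M2 + M3 + M4); first by rewrite !addr_ge0.
move=> [|[|[|[|[|//]]]]] x _ xr; [move: (H0 x xr)|move: (H1 x xr)|move: (H2 x xr)|move: (H3 x xr)|move: (H4 x xr)]; lra.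
Qed.

Lemma eq0_left_closure P a : continuous P -> (forall x, x < a -> P x = 0) -> forall x, x <= a -> P x = 0.
Proof.
move=> cP P0 x; rewrite le_eqVlt => /predU1P[->|]; last exact: P0.
have c1 : P x @[x --> a^'-] --> P a by apply: cvg_at_left_filter; exact: (cP a).
have c2 : P x @[x --> a^'-] --> (0 : R).
  by apply: cvg_near_cst; near=> y; rewrite P0//; near: y; exact: nbhs_left_lt.
exact: (cvg_unique _ c1 c2).
Unshelve. all: by end_near. Qed.

(** To the left of a the function P is locally constant; at a itself P' is continuous. *)
Lemma deriv_eq0_left P P' a : (forall x, is_derive x 1 P (P' x)) -> continuous P' ->
  (forall x, x < a -> P x = 0) -> forall x, x <= a -> P' x = 0.
Proof.
move=> dP cP' P0; apply: eq0_left_closure => // x xa.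
have H : is_derive x 1 P 0.
  apply: (deriv_near _ (derivC (0 : R) x)).
  by near=> y; rewrite P0//; near: y; exact: lt_nbhsl.
by rewrite -(derive1_is (dP x)) (derive1_is H).
Unshelve. all: by end_near. Qed.

End smooth_functions.

Section wave_profile.
Context {R : realType}.
Variables (f U : R -> R) (kq kap sg g u0 : R).
Hypotheses (sf : smooth f) (sU : smooth U) (U0 : U 0 = u0) (kap0 : 0 < kap) (g0 : 0 < g).
Hypothesis gap : forall x, x <= 0 -> sg + g <= derive1 f (U x).
Hypothesis ode : forall x, x <= 0 -> derive1 U x = kq * expR (kap * x) / (derive1 f (U x) - sg).

Implicit Types (n : nat) (x y : R).
Let Df n : R -> R := derive1n n f.
Let DU n : R -> R := derive1n n U.
Let e x : R := expR (kap * x).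

Lemma profile_eq1 x : x <= 0 -> (Df 1 (U x) - sg) * DU 1 x - kq * e x = 0.
Proof.
move=> x0; rewrite /DU derive1n1 ode// /Df derive1n1 mulrC divfK ?subrr// gt_eqF// subr_gt0.
by apply: lt_le_trans (gap x0); rewrite ltrDl.
Qed.

Lemma dDfU n x : is_derive x 1 (fun x => Df n (U x)) (Df n.+1 (U x) * DU 1 x).
Proof. exact: (@deriv_comp _ (Df n) U _ _ _ (smooth_d n (U x) sf) (smooth_d 0 x sU)). Qed.

Lemma cDfU n : continuous (fun x => Df n (U x)).
Proof. by move=> x; exact: (is_derive_cont (dDfU n x)). Qed.

Lemma cDU n : continuous (DU n). Proof. exact: smooth_c. Qed.

(** The differential equation of the wave holds only for x <= 0, so that its derivatives at 0 are
    obtained as limits from the left. *)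
Lemma profile_eq2 x : x <= 0 ->
  (Df 1 (U x) - sg) * DU 2 x + Df 2 (U x) * DU 1 x ^+ 2 - kq * (kap * e x) = 0.
Proof.
pose P' x := (Df 2 (U x) * DU 1 x - 0) * DU 1 x + (Df 1 (U x) - sg) * DU 2 x - kq * (kap * e x).
move=> x0; rewrite -[RHS](_ : P' x = 0).
  by rewrite /P'; move: (Df 1 (U x)) (Df 2 (U x)) (DU 1 x) (DU 2 x) (e x) => *; ring.
apply: (@deriv_eq0_left _ (fun x => (Df 1 (U x) - sg) * DU 1 x - kq * e x) P' 0) => //.
- move=> y; exact: (derivB (derivM (derivB (dDfU 1 y) (derivC sg y)) (smooth_d 1 y sU))
    (derivZ kq (derivEX kap y))).
- rewrite /P'; apply: contD.
    apply: contD; apply: contM; try exact: cDU.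
      by apply: contD; [apply: contM; [exact: cDfU|exact: cDU]|exact: contC].
    by apply: contD; [exact: cDfU|exact: contC].
  by move=> y; apply: cvgN; apply: (contM (@contC _ kq) (contM (@contC _ kap) (@contEX _ kap))).
- by move=> y y0; apply: profile_eq1; exact: ltW.
Qed.

Lemma profile_eq3 x : x <= 0 ->
  (Df 1 (U x) - sg) * DU 3 x + 3 * Df 2 (U x) * DU 1 x * DU 2 x + Df 3 (U x) * DU 1 x ^+ 3
   - kq * (kap * (kap * e x)) = 0.
Proof.
pose P' x := (Df 2 (U x) * DU 1 x - 0) * DU 2 x + (Df 1 (U x) - sg) * DU 3 x
   + (Df 3 (U x) * DU 1 x * DU 1 x ^+ 2 + Df 2 (U x) * (2 * DU 1 x * DU 2 x))
   - kq * (kap * (kap * e x)).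
move=> x0; rewrite -[RHS](_ : P' x = 0).
  rewrite /P'; move: (Df 1 (U x)) (Df 2 (U x)) (Df 3 (U x)) (DU 1 x) (DU 2 x) (DU 3 x) (e x) => *; ring.
apply: (@deriv_eq0_left _ (fun x => (Df 1 (U x) - sg) * DU 2 x + Df 2 (U x) * DU 1 x ^+ 2 - kq * (kap * e x)) P' 0) => //.
- move=> y; exact: (derivB (derivD (derivM (derivB (dDfU 1 y) (derivC sg y)) (smooth_d 2 y sU))
    (derivM (dDfU 2 y) (deriv2 (smooth_d 1 y sU))))
    (derivZ kq (derivZ kap (derivEX kap y)))).
- have c2 : continuous (fun x => DU 1 x ^+ 2).
    by move=> y; exact: (is_derive_cont (deriv2 (smooth_d 1 y sU))).
  have cS : continuous (fun x => Df 1 (U x) - sg) by apply: contD; [exact: cDfU|exact: contC].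
  have c3 := contM (contM (@cDfU 3) (@cDU 1)) c2.
  have c4 := contM (@cDfU 2) (contM (contM (@contC _ 2) (@cDU 1)) (@cDU 2)).
  have c5 := contM (@contC _ kq) (contM (@contC _ kap) (contM (@contC _ kap) (@contEX _ kap))).
  have c6 : continuous (fun x => Df 2 (U x) * DU 1 x - 0).
    by apply: contD; [apply: contM; [exact: cDfU|exact: cDU]|exact: contC].
  have c7 := contD (contD (contM c6 (@cDU 2)) (contM cS (@cDU 3))) (contD c3 c4).
  by move=> y; exact: (cvgB (c7 y) (c5 y)).
- by move=> y y0; apply: profile_eq2; exact: ltW.
Qed.

Let e_gt0 x : 0 < e x. Proof. exact: expR_gt0. Qed.
Let e_le1 x : x <= 0 -> e x <= 1.
Proof. by move=> x0; rewrite /e -expR0 ler_expR mulr_ge0_le0// ltW. Qed.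

Lemma gap_div x y c : x <= 0 -> 0 <= c -> `|(Df 1 (U x) - sg) * y| <= c * e x -> `|y| <= c / g * e x.
Proof.
move=> x0 c0 H; rewrite mulrAC ler_pdivlMr//; apply: le_trans H.
rewrite normrM mulrC ler_wpM2r// (le_trans _ (ler_norm _))// /Df derive1n1.
by have := gap x0; lra.
Qed.

(** The wave equation gives `|U'| <= A1 * expR (kap * x), whence U is bounded by integration up to 0;
    then the derivatives of f are bounded along U, and the differentiated equations give the higher
    derivatives one after the other. *)
Lemma profile_bound : exists2 Cw, 0 <= Cw & forall x, x <= 0 ->
  [/\ `|U x| <= Cw, `|DU 1 x| <= Cw * e x, `|DU 2 x| <= Cw * e x & `|DU 3 x| <= Cw * e x].
Proof.
pose A1 := `|kq| / g.
have A10 : 0 <= A1 by rewrite divr_ge0// ltW.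
have b1 x : x <= 0 -> `|DU 1 x| <= A1 * e x.
  move=> x0; apply: gap_div => //; have /eqP := profile_eq1 x0; rewrite subr_eq0 => /eqP ->.
  by rewrite normrM (ger0_norm (ltW (e_gt0 x))).
pose r0 := `|u0| + A1 / kap.
have bU x : x <= 0 -> `|U x| <= r0.
  move=> x0.
  have dU y : is_derive y 1 U (DU 1 y) := smooth_d 0 y sU.
  have dE y : is_derive y 1 (fun y => A1 / kap * e y) (A1 / kap * (kap * e y)) :=
    derivZ (A1 / kap) (derivEX kap y).
  have h1 : U 0 - A1 / kap * e 0 <= U x - A1 / kap * e x.
    apply: (@decreasing_on _ (fun y => U y - A1 / kap * e y) _ x 0 _ (fun y _ => derivB (dU y) (dE y)) _ x0).
      by apply: continuous_subspaceT => y; exact: (is_derive_cont (derivB (dU y) (dE y))).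
    move=> y /andP[_ y0]; rewrite mulrA divfK ?gt_eqF// subr_le0.
    by apply: le_trans (b1 y (ltW y0)); exact: ler_norm.
  have h2 : - U 0 - A1 / kap * e 0 <= - U x - A1 / kap * e x.
    apply: (@decreasing_on _ (fun y => - U y - A1 / kap * e y) _ x 0 _
      (fun y _ => derivB (derivN (dU y)) (dE y)) _ x0).
      by apply: continuous_subspaceT => y; exact: (is_derive_cont (derivB (derivN (dU y)) (dE y))).
    move=> y /andP[_ y0]; rewrite mulrA divfK ?gt_eqF// subr_le0.
    by apply: le_trans (b1 y (ltW y0)); rewrite -normrN; exact: ler_norm.
  have : 0 <= A1 / kap * e x by rewrite mulr_ge0 ?(ltW (e_gt0 x))// divr_ge0// ltW.
  move: h1 h2; rewrite U0 /e mulr0 expR0 /r0 !mulr1 => h1 h2 h3.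
  have := ler_norm u0; have := ler_norm (- u0); rewrite normrN ler_norml; lra.
have [M M0 HM] := smooth_bounded r0 sf.
have HMU n x : (n <= 4)%N -> x <= 0 -> `|Df n (U x)| <= M by move=> n4 x0; apply: HM => //; exact: bU.
pose c2 := `|kq| * kap + M * A1 ^+ 2.
have c20 : 0 <= c2 by rewrite addr_ge0// mulr_ge0 ?sqr_ge0// ltW.
pose A2 := c2 / g.
have A20 : 0 <= A2 by rewrite divr_ge0// ltW.
have es x : x <= 0 -> e x * e x <= e x by move=> x0; rewrite ler_piMl ?e_le1// ltW.
have b1' x : x <= 0 -> `|DU 1 x| <= A1.
  by move=> x0; apply: (le_trans (b1 x x0)); rewrite ler_piMr ?e_le1.
have b2 x : x <= 0 -> `|DU 2 x| <= A2 * e x.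
  move=> x0; apply: gap_div => //.
  have -> : (Df 1 (U x) - sg) * DU 2 x = kq * (kap * e x) - Df 2 (U x) * DU 1 x ^+ 2.
    by move: (profile_eq2 x0); move: (Df 1 (U x)) (Df 2 (U x)) (DU 1 x) (DU 2 x) (e x) => *; lra.
  rewrite (le_trans (ler_normB _ _))// [leRHS]mulrDl lerD//.
    by rewrite !normrM (gtr0_norm kap0) (gtr0_norm (e_gt0 x)) mulrA.
  rewrite normrM normrX -mulrA ler_pM// ?sqr_ge0// ?HMU//.
  by rewrite !expr2 -mulrA; apply: ler_pM => //; [exact: b1'|exact: b1].
pose c3 := `|kq| * kap ^+ 2 + 3 * M * A1 * A2 + M * A1 ^+ 3.
have c30 : 0 <= c3.
  by rewrite /c3; nonneg.
pose A3 := c3 / g.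
have A30 : 0 <= A3 by rewrite divr_ge0// ltW.
have b3 x : x <= 0 -> `|DU 3 x| <= A3 * e x.
  move=> x0; apply: gap_div => //.
  have -> : (Df 1 (U x) - sg) * DU 3 x = kq * (kap * (kap * e x)) - 3 * Df 2 (U x) * DU 1 x * DU 2 x
      - Df 3 (U x) * DU 1 x ^+ 3.
    by move: (profile_eq3 x0); move: (Df 1 (U x)) (Df 2 (U x)) (Df 3 (U x)) (DU 1 x) (DU 2 x) (DU 3 x) (e x) => *; lra.
  rewrite (le_trans (ler_normB _ _))// [leRHS]mulrDl lerD//.
    rewrite (le_trans (ler_normB _ _))// [leRHS]mulrDl lerD//.
      by rewrite !normrM (gtr0_norm kap0) (gtr0_norm (e_gt0 x)) !mulrA.
    rewrite !normrM (ger0_norm (ler0n _ 3)) -[leRHS]mulrA; apply: ler_pM; [by nonneg|by nonneg| |exact: b2].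
    apply: ler_pM; [by nonneg|by nonneg| |exact: b1'].
    by apply: ler_wpM2l => //; exact: HMU.
  rewrite normrM normrX -mulrA; apply: ler_pM; [by nonneg|by nonneg|exact: HMU|].
  rewrite exprSr [A1 ^+ 3]exprSr -[leRHS]mulrA; apply: ler_pM; [by nonneg|by nonneg| |exact: b1].
  by apply: lerXn2r; rewrite ?nnegrE// b1'.
exists (r0 + A1 + A2 + A3).
  by rewrite !addr_ge0// divr_ge0// ltW.
have r00 : 0 <= r0 by rewrite addr_ge0// divr_ge0// ltW.
move=> x x0; split.
- by apply: (le_trans (bU x x0)); lra.
- by apply: (le_trans (b1 x x0)); rewrite ler_wpM2r ?(ltW (e_gt0 x))//; lra.
- by apply: (le_trans (b2 x x0)); rewrite ler_wpM2r ?(ltW (e_gt0 x))//; lra.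
- by apply: (le_trans (b3 x x0)); rewrite ler_wpM2r ?(ltW (e_gt0 x))//; lra.
Qed.

End wave_profile.

(** * Smooth functions of the plane and the differentiated equations *)

Section clamp.
Context {R : realType}.

(** The front is only known on [0, T], while balances need functions that are continuous on the whole
    plane; times are therefore clamped, which changes nothing inside [0, T]. *)
Definition clamp (T t : R) : R := Num.max 0 (Num.min t T).

Lemma clamp_in T t : 0 <= T -> 0 <= clamp T t <= T.
Proof. by move=> T0; rewrite /clamp le_max lexx /= ge_max T0 ge_min lexx orbT. Qed.

Lemma clamp_id T t : 0 <= t <= T -> clamp T t = t.
Proof. by move=> /andP[t0 tT]; rewrite /clamp min_l// max_r. Qed.

Lemma clamp_cont T : continuous (clamp T).
Proof.
move=> t; apply: (@continuous_max R R (fun=> 0) (fun t => Num.min t T) t); first exact: cvg_cst.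
by apply: (@continuous_min R R id (fun=> T) t); [exact: cvg_id|exact: cvg_cst].
Qed.

Lemma clamp_comp_cont (psi : R -> R) T : 0 <= T -> {within `[0, T], continuous psi} ->
  continuous (fun t => psi (clamp T t)).
Proof.
move=> T0 /subspace_continuousP cpsi t.
have A0 : `[0, T]%classic (clamp T t) by rewrite /= in_itv /= clamp_in.
have := cpsi _ A0; move=> /cvgrPdist_lt H; apply/cvgrPdist_lt => e e0.
have := H e e0; rewrite near_withinE => K.
have HH := @clamp_cont T t _ K; near=> y.
have : `[0, T]%classic (clamp T y) -> `|psi (clamp T t) - psi (clamp T y)| < e.
  by near: y; exact: HH.
by apply; rewrite /= in_itv /= clamp_in.
Unshelve. all: by end_near. Qed.

Lemma clamp_near (T t : R) : 0 < t < T -> \forall s \near t, clamp T s = s.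
Proof.
move=> /andP[t0 tT]; near=> s; rewrite clamp_id//; apply/andP; split; apply: ltW; near: s.
  exact: lt_nbhsr.
exact: lt_nbhsl.
Unshelve. all: by end_near. Qed.

End clamp.

Section smooth2_theory.
Context {R : realType}.
Implicit Types (g G Z : R -> R -> R) (t x y : R).

Lemma smooth2_cont g : smooth2 g -> cont2 g.
Proof. by move=> /(_ 0%N)[]. Qed.

Lemma smooth2_dt g : smooth2 g -> smooth2 (dt g).
Proof. by move=> sg n; have [_ [_ []]] := sg n.+1. Qed.

Lemma smooth2_dx g : smooth2 g -> smooth2 (dx g).
Proof. by move=> sg n; have [_ [_ []]] := sg n.+1. Qed.

Lemma smooth2_is_dt g t x : smooth2 g -> is_derive t 1 (g ^~ x) (dt g t x).
Proof. by move=> sg; have [_ [/(_ t x)[d _] _]] := sg 1%N; exact: deriveE. Qed.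

Lemma smooth2_is_dx g t x : smooth2 g -> is_derive x 1 (g t) (dx g t x).
Proof. by move=> sg; have [_ [/(_ t x)[_ d] _]] := sg 1%N; exact: deriveE. Qed.

Lemma smooth2_swap g t x : smooth2 g -> dx (dt g) t x = dt (dx g) t x.
Proof.
move=> sg; have s1 := smooth2_dt sg; have s2 := smooth2_dx sg.
apply: (@Clairaut _ g (dt g) (dx g)).
- exact: smooth2_cont (smooth2_dx s1).
- exact: smooth2_cont (smooth2_dt s2).
- by move=> *; exact: smooth2_is_dt.
- by move=> *; exact: smooth2_is_dx.
- by move=> *; exact: smooth2_is_dx.
- by move=> *; exact: smooth2_is_dt.
Qed.

Definition dxn (n : nat) g : R -> R -> R := iter n dx g.

Lemma smooth2_dxn n g : smooth2 g -> smooth2 (dxn n g).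
Proof. by move=> sg; elim: n => //= n; exact: smooth2_dx. Qed.

(** Equations hold on an open side O of the front; the energy estimate uses them, and their space
    derivatives, up to the front.  This is what passing from O to its closure C has to provide, and it
    serves for both sides. *)
Definition transfers (O C : R -> Prop) := [/\ (forall x, O x -> C x),
  (forall P, continuous P -> (forall x, O x -> P x = 0) -> forall x, C x -> P x = 0 :> R) &
  (forall P P' : R -> R, (forall x, is_derive x 1 P (P' x)) -> continuous P' ->
    (forall x, O x -> P x = 0) -> forall x, C x -> P' x = 0)].

Lemma transfers_left (a : R) : transfers (fun x => x < a) (fun x => x <= a).
Proof.
split; first by move=> x; exact: ltW.
- by move=> P cP P0 x xa; exact: (eq0_left_closure cP P0 xa).
- by move=> P P' dP cP P0 x xa; exact: (deriv_eq0_left dP cP P0 xa).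
Qed.

Lemma transfers_right (a : R) : transfers (fun x => a < x) (fun x => a <= x).
Proof.
have opp_cont (P : R -> R) : continuous P -> continuous (fun x => P (- x)).
  by move=> cP x; apply: (@continuous_comp _ _ _ -%R P); [exact: opp_continuous|exact: cP].
split; first by move=> x; exact: ltW.
- move=> P cP P0 x xa; rewrite -(opprK x).
  apply: (@eq0_left_closure _ (fun x => P (- x)) (- a)); last by rewrite lerN2.
    exact: opp_cont.
  by move=> y ya; apply: P0; rewrite ltrNr.
- move=> P P' dP cP P0 x xa; apply: oppr_inj; rewrite oppr0 -(opprK x).
  apply: (@deriv_eq0_left _ (fun x => P (- x)) (fun x => - P' (- x)) (- a)); last by rewrite lerN2.
  + move=> y; have := deriv_comp (dP (- y)) (derivN (derivid y)).
    by rewrite mulrN1.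
  + by move=> y; apply: cvgN; exact: (opp_cont _ cP).
  + by move=> y ya; apply: P0; rewrite ltrNr.
Qed.

Variables (f : R -> R).
Hypothesis sf : smooth f.
Let Df n : R -> R := derive1n n f.

(** Differentiate in x on the open side, and extend each derivative to the closed one. *)
Lemma reaction_hierarchy (O C : R -> Prop) G Z kq t : transfers O C -> smooth2 G -> smooth2 Z ->
  (forall y, O y -> dt G t y + Df 1 (G t y) * dx G t y - kq * Z t y = 0) ->
  forall y, C y ->
  [/\ dt G t y + Df 1 (G t y) * dx G t y - kq * Z t y = 0,
      dt (dxn 1 G) t y + Df 2 (G t y) * dxn 1 G t y ^+ 2 + Df 1 (G t y) * dxn 2 G t y
        - kq * dxn 1 Z t y = 0 &
      dt (dxn 2 G) t y + Df 3 (G t y) * dxn 1 G t y ^+ 3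
        + 3 * Df 2 (G t y) * dxn 1 G t y * dxn 2 G t y + Df 1 (G t y) * dxn 3 G t y
        - kq * dxn 2 Z t y = 0].
Proof.
move=> [OC clos der] sG sZ E0.
have sd g y : smooth2 g -> is_derive y 1 (g t) (dx g t y) by move=> ?; exact: smooth2_is_dx.
have cx g : smooth2 g -> continuous (g t) by move=> ?; exact: (cont2_x (smooth2_cont _)).
have s1 := smooth2_dxn 1 sG; have s2 := smooth2_dxn 2 sG; have s3 := smooth2_dxn 3 sG.
have st := smooth2_dt sG; have s1z := smooth2_dxn 1 sZ; have s2z := smooth2_dxn 2 sZ.
have dDf n y : is_derive y 1 (fun y => Df n (G t y)) (Df n.+1 (G t y) * dxn 1 G t y).
  exact: (@deriv_comp _ (Df n) (G t) _ _ _ (smooth_d n (G t y) sf) (sd G y sG)).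
have cDf n : continuous (fun y => Df n (G t y)).
  by move=> y; exact: (is_derive_cont (dDf n y)).
pose P0 y := dt G t y + Df 1 (G t y) * dx G t y - kq * Z t y.
pose P1 y := dx (dt G) t y + (Df 2 (G t y) * dxn 1 G t y * dxn 1 G t y + Df 1 (G t y) * dxn 2 G t y)
  - kq * dxn 1 Z t y.
have d0 y : is_derive y 1 P0 (P1 y).
  exact: (derivB (derivD (sd _ y st) (derivM (dDf 1%N y) (sd _ y s1))) (derivZ kq (sd _ y sZ))).
have c1 : continuous P1.
  have k1 := cx _ (smooth2_dx st). have k2 := contM (contM (@cDf 2) (cx _ s1)) (cx _ s1).
  have k3 := contM (@cDf 1) (cx _ s2). have k4 := contM (@contC _ kq) (cx _ s1z).
  exact: (contB (contD k1 (contD k2 k3)) k4).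
have e1 := der P0 P1 d0 c1 E0.
pose P2 y := dx (dx (dt G)) t y
  + ((Df 3 (G t y) * dxn 1 G t y * dxn 1 G t y + Df 2 (G t y) * dxn 2 G t y) * dxn 1 G t y
     + Df 2 (G t y) * dxn 1 G t y * dxn 2 G t y
     + (Df 2 (G t y) * dxn 1 G t y * dxn 2 G t y + Df 1 (G t y) * dxn 3 G t y))
  - kq * dxn 2 Z t y.
have d1 y : is_derive y 1 P1 (P2 y).
  exact: (derivB (derivD (sd _ y (smooth2_dx st))
    (derivD (derivM (derivM (dDf 2%N y) (sd _ y s1)) (sd _ y s1)) (derivM (dDf 1%N y) (sd _ y s2))))
    (derivZ kq (sd _ y s1z))).
have c2 : continuous P2.
  have k1 := cx _ (smooth2_dx (smooth2_dx st)).
  have k2 := contM (contM (@cDf 3) (cx _ s1)) (cx _ s1).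
  have k3 := contM (@cDf 2) (cx _ s2). have k4 := contM (contM (@cDf 2) (cx _ s1)) (cx _ s2).
  have k5 := contM (@cDf 1) (cx _ s3). have k6 := contM (@contC _ kq) (cx _ s2z).
  exact: (contB (contD k1 (contD (contD (contM (contD k2 k3) (cx _ s1)) k4) (contD k4 k5))) k6).
have e2 := der P1 P2 d1 c2 (fun y Oy => e1 y (OC y Oy)).
have c0 : continuous P0 by move=> y; exact: (is_derive_cont (d0 y)).
have w1 y : dx (dt G) t y = dt (dxn 1 G) t y by exact: smooth2_swap.
have w2 y : dx (dx (dt G)) t y = dt (dxn 2 G) t y.
  have E : dx (dt G) t = dt (dxn 1 G) t by apply/funext => y'; exact: smooth2_swap.
  rewrite {1}/dx E; exact: (smooth2_swap t y s1).
move=> y Cy; split; first exact: (clos P0 c0 E0).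
  rewrite -[RHS](e1 y Cy) /P1 w1.
  by move: (Df 2 (G t y)) (Df 1 (G t y)) (dxn 1 G t y) (dxn 2 G t y) => *; ring.
rewrite -[RHS](e2 y Cy) /P2 w2.
by move: (Df 3 (G t y)) (Df 2 (G t y)) (Df 1 (G t y)) (dxn 1 G t y) (dxn 2 G t y) (dxn 3 G t y) => *; ring.
Qed.

Lemma decay_hierarchy (O C : R -> Prop) Z k t : transfers O C -> smooth2 Z ->
  (forall y, O y -> dt Z t y + k * Z t y = 0) ->
  forall n y, C y -> dt (dxn n Z) t y + k * dxn n Z t y = 0.
Proof.
move=> [OC clos der] sZ E0.
have sd g y : smooth2 g -> is_derive y 1 (g t) (dx g t y) by move=> ?; exact: smooth2_is_dx.
have cx g : smooth2 g -> continuous (g t) by move=> ?; exact: (cont2_x (smooth2_cont _)).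
elim=> [|n IH] y Cy.
  apply: (clos (fun y => dt Z t y + k * Z t y)) => //.
  by apply: contD; [exact: cx (smooth2_dt sZ)|apply: contM; [exact: contC|exact: cx]].
have sn := smooth2_dxn n sZ; have sn1 := smooth2_dxn n.+1 sZ.
rewrite -(smooth2_swap t y sn).
apply: (der (fun y => dt (dxn n Z) t y + k * dxn n Z t y)
  (fun y => dx (dt (dxn n Z)) t y + k * dxn n.+1 Z t y)) => //.
- by move=> y'; exact: (derivD (sd _ y' (smooth2_dt sn)) (derivZ k (sd _ y' sn))).
- apply: contD; first exact: cx (smooth2_dx (smooth2_dt sn)).
  by apply: contM; [exact: contC|exact: cx].
- by move=> y' /OC; exact: IH.
Qed.

End smooth2_theory.

(** * The forcing terms *)

Section forcing_bounds.
Context {R : realType}.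

Lemma normM_le (x y X Y : R) : `|x| <= X -> `|y| <= Y -> `|x * y| <= X * Y.
Proof. by move=> xX yY; rewrite normrM; apply: ler_pM. Qed.

Lemma normD_le (x y X Y : R) : `|x| <= X -> `|y| <= Y -> `|x + y| <= X + Y.
Proof. by move=> xX yY; apply: (le_trans (ler_normD _ _)); exact: lerD. Qed.

Lemma normB_le (x y X Y : R) : `|x| <= X -> `|y| <= Y -> `|x - y| <= X + Y.
Proof. by move=> xX yY; apply: (le_trans (ler_normB _ _)); exact: lerD. Qed.

(** Subtracting the equation of the wave from that of the solution, in the frame of the front: u1, U1
    and so on are derivatives of the solution and of the wave, f1u and f1U those of the flux at them, d
    is the time derivative in the fixed frame and z, zb the reactants. *)
Section forcing_identities.
Variables (kq s sg : R).

Lemma forcing0_id (d f1u f1U u1 U1 z zb : R) :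
  d + f1u * u1 - kq * z = 0 -> (f1U - sg) * U1 - kq * zb = 0 ->
  d + s * u1 + (f1u - s) * (u1 - U1) = kq * (z - zb) - (f1u - f1U - (s - sg)) * U1.
Proof. lra. Qed.

Lemma forcing1_id (d f1u f1U f2u f2U u1 U1 u2 U2 z zb : R) :
  d + f2u * u1 ^+ 2 + f1u * u2 - kq * z = 0 ->
  (f1U - sg) * U2 + f2U * U1 ^+ 2 - kq * zb = 0 ->
  d + s * u2 + (f1u - s) * (u2 - U2) =
  kq * (z - zb) - (f2u * (U1 + (u1 - U1)) ^+ 2 - f2U * U1 ^+ 2) - (f1u - f1U - (s - sg)) * U2.
Proof. rewrite addrCA subrr addr0; lra. Qed.

Lemma forcing2_id (d f1u f1U f2u f2U f3u f3U u1 U1 u2 U2 u3 U3 z zb : R) :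
  d + f3u * u1 ^+ 3 + 3 * f2u * u1 * u2 + f1u * u3 - kq * z = 0 ->
  (f1U - sg) * U3 + 3 * f2U * U1 * U2 + f3U * U1 ^+ 3 - kq * zb = 0 ->
  d + s * u3 + (f1u - s) * (u3 - U3) =
  kq * (z - zb) - (f3u * (U1 + (u1 - U1)) ^+ 3 + 3 * f2u * (U1 + (u1 - U1)) * (U2 + (u2 - U2))
    - (f3U * U1 ^+ 3 + 3 * f2U * U1 * U2)) - (f1u - f1U - (s - sg)) * U3.
Proof. rewrite [U1 + _]addrCA subrr addr0 [U2 + _]addrCA subrr addr0; lra. Qed.

(** Ahead of the front the wave is constant and the space variable reflected, hence the factor -1. *)
Lemma right_forcing1_id (d a1 a2 u1 u2 z : R) : d + a2 * u1 ^+ 2 + a1 * u2 - 0 * z = 0 ->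
  d + s * u2 + (s - a1) * (-1 * u2) = - (a2 * u1 ^+ 2).
Proof. lra. Qed.

Lemma right_forcing2_id (d a1 a2 a3 u1 u2 u3 z : R) :
  d + a3 * u1 ^+ 3 + 3 * a2 * u1 * u2 + a1 * u3 - 0 * z = 0 ->
  d + s * u3 + (s - a1) * (-1 * u3) = - (a3 * u1 ^+ 3 + 3 * a2 * u1 * u2).
Proof. lra. Qed.

End forcing_identities.

(** Here V and U are derivatives of the perturbation and of the wave, and the letters a and b the
    derivatives of the flux at the solution and at the wave.  The terms containing the highest derivative of the
    perturbation must have the small factor e + eta, where e bounds the wave and eta the perturbation;
    a constant is enough for all others. *)
Section left.
Variables (kq M Cw e eta : R) (V0 V1 V2 U1 U2 U3 z ds a1 a2 a3 b1 b2 b3 : R).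
Hypotheses (M0 : 0 <= M) (Cw0 : 0 <= Cw) (e0 : 0 <= e) (e1 : e <= 1) (eta0 : 0 <= eta) (eta1 : eta <= 1).
Hypotheses (ab1 : `|a1 - b1| <= M * `|V0|) (ab2 : `|a2 - b2| <= M * `|V0|)
  (ab3 : `|a3 - b3| <= M * `|V0|) (Ha2 : `|a2| <= M) (Ha3 : `|a3| <= M).
Hypotheses (HU1 : `|U1| <= Cw * e) (HU2 : `|U2| <= Cw * e) (HU3 : `|U3| <= Cw * e) (HV1 : `|V1| <= eta).

Let D := Cw + 1.
Definition linear_rate (M Cw : R) := 3 * M * (Cw + 1).
Definition lower_rate (kq M Cw : R) := `|kq| + Cw + 10 * M * (Cw + 1) ^+ 3.
Let A1 := linear_rate M Cw.
Let C0 := lower_rate kq M Cw.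

Let CwD : Cw <= D. Proof. by rewrite lerDl. Qed.
Let D1 : 1 <= D. Proof. by rewrite lerDr. Qed.
Let CeC : Cw * e <= Cw. Proof. by rewrite ler_piMr. Qed.
Let U1C : `|U1| <= Cw. Proof. exact: le_trans CeC. Qed.
Let U2C : `|U2| <= Cw. Proof. exact: le_trans CeC. Qed.
Let U3C : `|U3| <= Cw. Proof. exact: le_trans CeC. Qed.
Let D12 : D <= D ^+ 2. Proof. by rewrite expr2 ler_peMr// (le_trans ler01). Qed.
Let D23 : D ^+ 2 <= D ^+ 3. Proof. by rewrite [leRHS]exprS ler_peMl// sqr_ge0. Qed.
Let u1e : `|U1 + V1| <= D * (e + eta).
Proof.
apply: (le_trans (normD_le HU1 HV1)).
have : Cw * e <= D * e by rewrite ler_wpM2r.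
have : 1 * eta <= D * eta by rewrite ler_wpM2r.
lra.
Qed.
Let u1D : `|U1 + V1| <= D.
Proof. by apply: (le_trans (normD_le U1C HV1)); rewrite lerD2l. Qed.
Let u1D' : `|2 * U1 + V1| <= 2 * D * (e + eta).
Proof.
rewrite (_ : 2 * U1 + V1 = U1 + (U1 + V1)); last by ring.
apply: (le_trans (normD_le HU1 u1e)).
have : Cw * e <= D * e by rewrite ler_wpM2r.
have : 0 <= D * eta by rewrite mulr_ge0// (le_trans ler01).
lra.
Qed.
Let MCC (x y : R) : 0 <= x -> x <= D ^+ 3 -> 0 <= y -> M * y * x <= M * D ^+ 3 * y.
Proof. by move=> x0 xD y0; rewrite mulrAC ler_wpM2r// ler_wpM2l. Qed.

Lemma forcing0_bound : `|kq * z - (a1 - b1 - ds) * U1| <=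
  A1 * (e + eta) * `|V0| + C0 * (0 + `|z| + `|ds| * e).
Proof.
rewrite (_ : _ - _ = kq * z - (a1 - b1) * U1 + ds * U1); last by ring.
apply: (le_trans (normD_le (normB_le (lexx _) (normM_le ab1 HU1)) (normM_le (lexx `|ds|) HU1))).
rewrite normrM /A1 /C0 /linear_rate /lower_rate.
have z0 := normr_ge0 z; have v0 := normr_ge0 V0; have d0 := mulr_ge0 (normr_ge0 ds) e0.
have k0 := normr_ge0 kq.
have t1 : M * `|V0| * (Cw * e) <= 3 * M * (Cw + 1) * (e + eta) * `|V0|.
  have : 0 <= M * `|V0| * Cw * e by nonneg. have : 0 <= M * `|V0| * Cw * eta by nonneg.
  have : 0 <= M * `|V0| * eta by nonneg. have : 0 <= M * `|V0| * e by nonneg.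
  lra.
have t2 : 0 <= 10 * M * (Cw + 1) ^+ 3 * (`|z| + `|ds| * e) by nonneg.
have t3 : 0 <= Cw * `|z| by nonneg.
have t4 : 0 <= `|kq| * (`|ds| * e) by nonneg.
rewrite add0r; lra.
Qed.

Lemma forcing1_bound : `|kq * z - (a2 * (U1 + V1) ^+ 2 - b2 * U1 ^+ 2) - (a1 - b1 - ds) * U2| <=
  A1 * (e + eta) * `|V1| + C0 * (`|V0| + `|z| + `|ds| * e).
Proof.
rewrite (_ : _ - _ = kq * z - a2 * V1 * (2 * U1 + V1) - (a2 - b2) * (U1 * U1) - (a1 - b1) * U2 + ds * U2);
  last by ring.
apply: (le_trans (normD_le (normB_le (normB_le (normB_le (lexx _) (normM_le (normM_le Ha2 (lexx `|V1|)) u1D'))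
  (normM_le ab2 (normM_le U1C U1C))) (normM_le ab1 U2C)) (normM_le (lexx `|ds|) HU2))).
rewrite normrM /A1 /C0 /linear_rate /lower_rate -/D.
have z0 := normr_ge0 z; have v0 := normr_ge0 V0; have v1 := normr_ge0 V1; have d0 := mulr_ge0 (normr_ge0 ds) e0.
have D0 : 0 <= D by exact: le_trans D1.
have t1 : 0 <= M * D * (e + eta) * `|V1| by nonneg.
have t2 : M * `|V0| * (Cw * Cw) <= M * D ^+ 3 * `|V0|.
  by apply: MCC; rewrite ?mulr_ge0//; apply: le_trans D23; rewrite expr2 ler_pM.
have t3 : M * `|V0| * Cw <= M * D ^+ 3 * `|V0|.
  by apply: MCC => //; apply: (le_trans CwD); apply: (le_trans D12).
have t4 : 0 <= M * D ^+ 3 * (`|z| + `|ds| * e) by nonneg.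
have t4' : 0 <= M * D ^+ 3 * `|V0| by nonneg.
have t5 : 0 <= Cw * (`|z| + `|V0|) by nonneg.
have t6 : 0 <= `|kq| * (`|ds| * e + `|V0|) by nonneg.
lra.
Qed.

Lemma forcing2_bound : `|kq * z - (a3 * (U1 + V1) ^+ 3 + 3 * a2 * (U1 + V1) * (U2 + V2)
    - (b3 * U1 ^+ 3 + 3 * b2 * U1 * U2)) - (a1 - b1 - ds) * U3| <=
  A1 * (e + eta) * `|V2| + C0 * (`|V0| + `|V1| + `|z| + `|ds| * e).
Proof.
pose u := U1 + V1.
rewrite (_ : _ - _ = kq * z - a3 * V1 * (u * u + u * U1 + U1 * U1) - (a3 - b3) * (U1 * U1 * U1)
  - 3 * (a2 * V2 * u) - 3 * (a2 * V1 * U2) - 3 * ((a2 - b2) * (U1 * U2)) - (a1 - b1) * U3 + ds * U3);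
  last by rewrite /u; ring.
have n3 : `|3 : R| <= 3 by rewrite ger0_norm.
have D0 : 0 <= D by exact: le_trans D1.
have U1D := le_trans U1C CwD.
apply: (le_trans (normD_le (normB_le (normB_le (normB_le (normB_le (normB_le (normB_le (lexx _)
   (normM_le (normM_le Ha3 (lexx `|V1|)) (normD_le (normD_le (normM_le u1D u1D) (normM_le u1D U1D)) (normM_le U1D U1D))))
   (normM_le ab3 (normM_le (normM_le U1D U1D) U1D)))
   (normM_le n3 (normM_le (normM_le Ha2 (lexx `|V2|)) u1e)))
   (normM_le n3 (normM_le (normM_le Ha2 (lexx `|V1|)) U2C)))
   (normM_le n3 (normM_le ab2 (normM_le U1D (le_trans U2C CwD)))))
   (normM_le ab1 U3C)) (normM_le (lexx `|ds|) HU3))).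
rewrite normrM /A1 /C0 /linear_rate /lower_rate -/D.
have z0 := normr_ge0 z; have v0 := normr_ge0 V0; have v1 := normr_ge0 V1; have v2 := normr_ge0 V2.
have d0 := mulr_ge0 (normr_ge0 ds) e0.
have t1 : M * `|V1| * D ^+ 2 <= M * D ^+ 3 * `|V1| by apply: MCC; rewrite ?sqr_ge0.
have t2 : M * `|V0| * D ^+ 2 <= M * D ^+ 3 * `|V0| by apply: MCC; rewrite ?sqr_ge0.
have t3 : M * `|V1| * Cw <= M * D ^+ 3 * `|V1|.
  by apply: MCC => //; apply: (le_trans CwD); apply: (le_trans D12).
have t3' : M * `|V0| * Cw <= M * D ^+ 3 * `|V0|.
  by apply: MCC => //; apply: (le_trans CwD); apply: (le_trans D12).
have t4 : 0 <= M * D ^+ 3 * (`|z| + `|ds| * e + `|V0| + `|V1|) by nonneg.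
have t4' : 0 <= M * D ^+ 3 * `|V0| by nonneg. have t4'' : 0 <= M * D ^+ 3 * `|V1| by nonneg.
have t4z : 0 <= M * D ^+ 3 * (`|z| + `|ds| * e) by nonneg.
have t5 : 0 <= Cw * (`|z| + `|V0| + `|V1|) by nonneg.
have t6 : 0 <= `|kq| * (`|ds| * e + `|V0| + `|V1|) by nonneg.
lra.
Qed.

End left.

Section right.
Variables (M eta A1 e C0 : R) (Y1 Y2 a2 a3 : R).
Hypotheses (M0 : 0 <= M) (eta0 : 0 <= eta) (eta1 : eta <= 1) (e0 : 0 <= e).
Hypotheses (Ha2 : `|a2| <= M) (Ha3 : `|a3| <= M) (HY1 : `|Y1| <= eta) (HA : 3 * M <= A1) (HC : M <= C0).

Lemma right_forcing1_bound : `|- (a2 * Y1 ^+ 2)| <= A1 * (e + eta) * `|Y1|.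
Proof.
rewrite normrN expr2; apply: (le_trans (normM_le Ha2 (normM_le HY1 (lexx _)))).
have y0 := normr_ge0 Y1.
have A10 : 0 <= A1 by apply: le_trans HA; nonneg.
have t1 : 0 <= A1 * e * `|Y1| by nonneg.
have t2 : 3 * M * (eta * `|Y1|) <= A1 * (eta * `|Y1|) by rewrite ler_wpM2r// mulr_ge0.
have t3 : 0 <= M * (eta * `|Y1|) by nonneg.
lra.
Qed.

Lemma right_forcing2_bound : `|- (a3 * Y1 ^+ 3 + 3 * a2 * Y1 * Y2)| <= A1 * (e + eta) * `|Y2| + C0 * `|Y1|.
Proof.
have n3 : `|3 : R| <= 3 by rewrite ger0_norm.
rewrite normrN (_ : a3 * _ + _ = a3 * (Y1 * Y1 * Y1) + 3 * (a2 * (Y1 * Y2))); last by ring.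
apply: (le_trans (normD_le (normM_le Ha3 (normM_le (normM_le HY1 HY1) (lexx _)))
  (normM_le n3 (normM_le Ha2 (normM_le HY1 (lexx `|Y2|)))))).
have y0 := normr_ge0 Y1; have y2 := normr_ge0 Y2.
have A10 : 0 <= A1 by apply: le_trans HA; nonneg.
have t1 : 0 <= A1 * e * `|Y2| by nonneg.
have t2 : 3 * M * (eta * `|Y2|) <= A1 * (eta * `|Y2|) by rewrite ler_wpM2r// mulr_ge0.
have t3 : M * (eta * eta * `|Y1|) <= C0 * `|Y1|.
  rewrite mulrA ler_wpM2r//; apply: le_trans HC; rewrite ler_piMr// -[leRHS]mulr1 ler_pM//.
lra.
Qed.

End right.

End forcing_bounds.

(** * Traces, wave and moving frame *)

Section traces.
Context {R : realType}.
Implicit Types (g G : R -> R) (a x : R).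

Lemma ltraceE g G a : continuous G -> (forall x, x < a -> g x = G x) -> ltrace g a = G a.
Proof.
move=> cG gG; apply: cvg_lim => //.
have c1 : G x @[x --> a^'-] --> G a by apply: cvg_at_left_filter; exact: cG.
apply: cvg_trans c1; apply: near_eq_cvg.
by near=> x; rewrite gG//; near: x; exact: nbhs_left_lt.
Unshelve. all: by end_near. Qed.

Lemma rtraceE g G a : continuous G -> (forall x, a < x -> g x = G x) -> rtrace g a = G a.
Proof.
move=> cG gG; apply: cvg_lim => //.
have c1 : G x @[x --> a^'+] --> G a by apply: cvg_at_right_filter; exact: cG.
apply: cvg_trans c1; apply: near_eq_cvg.
by near=> x; rewrite gG//; near: x; exact: nbhs_right_gt.
Unshelve. all: by end_near. Qed.

Lemma le_left_closure (P : R -> R) (b a : R) : continuous P -> (forall x, x < a -> P x <= b) ->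
  forall x, x <= a -> P x <= b.
Proof.
move=> cP Pb x xa.
have H : Num.max 0 (P x - b) = 0.
  apply: (@eq0_left_closure _ (fun x => Num.max 0 (P x - b)) a) => //.
    move=> y; apply: (@continuous_max R R (fun=> 0) (fun y => P y - b) y); first exact: cvg_cst.
    exact: (contB cP (@contC _ b)).
  by move=> y /Pb Py; rewrite max_l// subr_le0.
have : P x - b <= Num.max 0 (P x - b) by rewrite le_max lexx orbT.
by rewrite H subr_le0.
Qed.

End traces.

Section wave_facts.
Context {R : realType}.

Lemma ereal_inf_gap (S : set R) (h : R -> R) (a : R) :
  (a%:E < ereal_inf [set (h x)%:E | x in S])%E -> exists2 m, a < m & forall x, S x -> m <= h x.
Proof.
case E : (ereal_inf _) => [r| |] //.
- rewrite lte_fin => ar; exists r => // x Sx; rewrite -lee_fin -E.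
  by apply: ereal_inf_lbound; exists x.
- move=> _; exists (a + 1); first by rewrite ltrDl.
  move=> x Sx; rewrite -lee_fin.
  have : (ereal_inf [set (h x)%:E | x in S] <= (h x)%:E)%E by apply: ereal_inf_lbound; exists x.
  by rewrite E.
Qed.

Lemma wave_facts (f : R -> R) k q u_i u0 sigma ubar zbar : smooth f ->
  detonation_wave f k q u_i u0 sigma ubar zbar ->
  exists U g m, [/\ smooth U, U 0 = u0, (forall x, x < 0 -> ubar x = U x),
    (forall x, x <= 0 -> derive1 U x = k * q * expR (k / sigma * x) / (derive1 f (U x) - sigma)) &
    [/\ 0 < g, u_i < m, (forall x, x <= 0 -> m <= U x),
      (forall x, x <= 0 -> sigma + g <= derive1 f (U x)) & derive1 f 0 <= sigma - g]].
Proof.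
move=> sf [_ _ [U [sU U0 ubarE ode]] /ereal_inf_gap[m um Hm] /ereal_inf_gap[b sb Hb] lax].
have cU : continuous U by exact: (@smooth_c _ U 0 sU).
have cfU : continuous (fun x => derive1 f (U x)).
  have cf : continuous (derive1 f) by have := @smooth_c _ f 1 sf; rewrite derive1n1.
  by move=> x; apply: continuous_comp; [exact: cU|exact: cf].
pose g := Num.min (b - sigma) (sigma - derive1 f 0).
have g0 : 0 < g by rewrite lt_min !subr_gt0 sb.
have gb : g <= b - sigma by rewrite ge_min lexx.
have gl : g <= sigma - derive1 f 0 by rewrite ge_min lexx orbT.
exists U, g, m; split=> //.
  by move=> x x0; rewrite ode// (mulrAC k x).
split=> //.
- move=> x x0; rewrite -lerN2.
  apply: (@le_left_closure _ (fun x => - U x) (- m) 0) => //.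
    by move=> y; apply: cvgN; exact: cU.
  by move=> y y0; rewrite lerN2 -ubarE//; exact: Hm.
- move=> x x0; rewrite -lerN2.
  apply: (@le_left_closure _ (fun x => - derive1 f (U x)) (- (sigma + g)) 0) => //.
    by move=> y; apply: cvgN; exact: cfU.
  by move=> y y0; rewrite lerN2 -ubarE//; have := Hb y y0; lra.
- lra.
Qed.

End wave_facts.

Section pde_transfer.
Context {R : realType}.

Lemma transfer_dt (D : R -> R -> Prop) (u G : R -> R -> R) (T t x : R) : 0 < t < T ->
  (\forall s \near t, D s x) -> (forall t x, 0 <= t <= T /\ D t x -> u t x = G t x) ->
  smooth2 G -> dt u t x = dt G t x.
Proof.
move=> /andP[t0 tT] nD uG sG; apply: derive1_is.
apply: deriv_near (smooth2_is_dt t x sG).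
near=> s; rewrite uG//; split; last by near: s.
apply/andP; split; apply: ltW; near: s; [exact: lt_nbhsr|exact: lt_nbhsl].
Unshelve. all: by end_near. Qed.

Lemma transfer_dx (D : R -> R -> Prop) (u G : R -> R -> R) (f : R -> R) (T t x : R) : 0 <= t <= T ->
  (\forall y \near x, D t y) -> (forall t x, 0 <= t <= T /\ D t x -> u t x = G t x) ->
  smooth2 G -> smooth f ->
  dx (fun s y => f (u s y)) t x = derive1n 1 f (G t x) * dx G t x.
Proof.
move=> tT nD uG sG sf; apply: derive1_is.
apply: deriv_near (@deriv_comp _ f (G t) x _ _ (smooth_d 0 (G t x) sf) (smooth2_is_dx t x sG)).
by near=> y; rewrite uG//; split => //; near: y.
Unshelve. all: by end_near. Qed.

Lemma near_lt_curve (psi : R -> R) (t x : R) : {for t, continuous psi} -> x < psi t ->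
  \forall s \near t, x < psi s.
Proof. by move=> c xp; exact: (cvgr_gt _ c _ xp). Qed.

Lemma near_gt_curve (psi : R -> R) (t x : R) : {for t, continuous psi} -> psi t < x ->
  \forall s \near t, psi s < x.
Proof. by move=> c xp; exact: (cvgr_lt _ c _ xp). Qed.

End pde_transfer.

Section moving.
Context {R : realType}.
Variables (T : R) (psi : R -> R).
Hypotheses (T0 : 0 <= T) (cpsi : {within `[0, T], continuous psi}).
Implicit Types (G : R -> R -> R) (t x : R).

(** The function G in the frame of the front; the orientation b is 1 behind it and -1 ahead of it, where
    the half line is reflected. *)
Definition moving (b : R) G t x : R := G (clamp T t) (b * x + psi (clamp T t)).

Lemma moving_cont b G : cont2 G -> cont2 (moving b G).
Proof.
move=> cG; have c1 : cont2 (fun t x : R => clamp T t) by apply: cont2_of_t; exact: clamp_cont.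
have c2 : cont2 (fun t x : R => b * x + psi (clamp T t)).
  apply: cont2D; last by apply: cont2_of_t; exact: clamp_comp_cont.
  by apply: cont2M; [exact: cont2C|apply: (@cont2_of_x _ id) => ?; exact: cvg_id].
exact: (cont2_subst cG c1 c2).
Qed.

Lemma movingE b G t x : 0 <= t <= T -> moving b G t x = G t (b * x + psi t).
Proof. by move=> tT; rewrite /moving clamp_id. Qed.

Lemma moving_dx b G t x : smooth2 G -> is_derive x 1 (moving b G t) (b * moving b (dx G) t x).
Proof.
move=> sG.
have H : is_derive x 1 (fun x => b * x + psi (clamp T t)) (b * 1 + 0).
  exact: (derivD (derivZ b (derivid x)) (derivC (psi (clamp T t)) x)).
have := @deriv_comp _ (G (clamp T t)) (fun x => b * x + psi (clamp T t)) x _ _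
  (smooth2_is_dx _ _ sG) H.
by rewrite mulr1 addr0 mulrC.
Qed.

Lemma moving_dt b G t x s : smooth2 G -> 0 < t < T -> is_derive t 1 psi s ->
  is_derive t 1 (moving b G ^~ x) (moving b (dt G) t x + s * moving b (dx G) t x).
Proof.
move=> sG tT dpsi; have tT' : 0 <= t <= T by case/andP: tT => *; rewrite !ltW.
rewrite !movingE//.
have H : is_derive t 1 (fun t => b * x + psi t) (0 + s) by exact: (derivD (derivC (b * x) t) dpsi).
rewrite add0r in H.
have H2 : forall t x, is_derive t 1 (G ^~ x) (dt G t x) by move=> *; exact: smooth2_is_dt.
have H3 := @chain_rule _ G (dt G) (fun t => b * x + psi t) t _ _
  (smooth2_cont (smooth2_dt sG)) H2 (smooth2_is_dx t (b * x + psi t) sG) H.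
rewrite (mulrC s); apply: (deriv_near _ H3).
near=> r; rewrite /moving.
have -> // : clamp T r = r by near: r; exact: clamp_near.
Unshelve. all: by end_near. Qed.

End moving.

(** * The trace of the reactant at the front *)

Section trace_identities.
Context {R : realType}.

(** Derivative in time, along the front, of the continuity of z: the solution behind obeys z_t = - k z,
    and ahead of the front z_t = 0. *)
Lemma trace1_id (a b s z1 p1 k z0 : R) : a + s * z1 - (b + s * p1) = 0 -> a + k * z0 = 0 -> b = 0 ->
  s * (z1 - p1) = k * z0.
Proof. lra. Qed.

(** The derivative along the front of the conclusion of trace1_id. *)
Lemma trace2_id (a b c s s' z0 z1 z2 p1 p2 k : R) :
  s' * (z1 - p1) + s * (c + s * z2 - (b + s * p2)) - k * (a + s * z1) = 0 ->
  a + k * z0 = 0 -> c + k * z1 = 0 -> b = 0 ->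
  s' * (z1 - p1) + s * (- k * z1 + s * z2 - s * p2) - k * (- k * z0 + s * z1) = 0.
Proof.
move=> h ha hc hb; rewrite -h hb.
have -> : c = - k * z1 by lra.
have -> : a = - k * z0 by lra.
by ring.
Qed.

End trace_identities.

Section trace_bounds.
Context {R : realType}.
Variables (k sg kap s nu Cs : R).
Hypotheses (k0 : 0 < k) (sg0 : 0 < sg) (kap0 : 0 < kap) (kE : k = sg * kap) (s_ge : sg / 2 <= s)
  (s_le : s <= nu) (Cs0 : 0 <= Cs).

Definition trace1_const (k sg kap Cs : R) := 1 + 2 / sg * (k + kap * Cs).

Let s0 : 0 < s. Proof. by apply: lt_le_trans s_ge; rewrite divr_gt0. Qed.

(** Subtract the relation satisfied by the wave, sigma * kap = k; the difference of the speeds enters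
    through q. *)
Lemma trace1_bound (Z1 P1 P0 q : R) : 0 <= q -> `|s - sg| <= Cs * q ->
  s * (Z1 + kap - P1) = k * (P0 + 1) ->
  `|Z1| <= trace1_const k sg kap Cs * (`|P1| + `|P0| + q).
Proof.
move=> q0 ds E.
have E1 : s * (Z1 - P1) = k * P0 - kap * (s - sg) by move: E; rewrite kE; lra.
have h1 : s * `|Z1 - P1| <= k * `|P0| + kap * (Cs * q).
  rewrite -{1}(gtr0_norm s0) -normrM E1.
  apply: normB_le; first by rewrite normrM (gtr0_norm k0).
  by rewrite normrM (gtr0_norm kap0) ler_wpM2l// ltW.
have h2 : sg / 2 * `|Z1 - P1| <= s * `|Z1 - P1| by rewrite ler_wpM2r.
have h3 : `|Z1 - P1| <= 2 / sg * (k * `|P0| + kap * (Cs * q)).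
  rewrite -(ler_pM2l (x := sg / 2)) ?divr_gt0//.
  rewrite (_ : sg / 2 * (2 / sg * (k * `|P0| + kap * (Cs * q))) = k * `|P0| + kap * (Cs * q)).
    exact: le_trans h1.
  by field; rewrite gt_eqF.
have h4 : `|Z1| <= `|P1| + `|Z1 - P1|.
  by rewrite -{1}[Z1](subrK P1) addrC; exact: ler_normD.
rewrite /trace1_const.
have c0 : 0 <= 2 / sg by rewrite divr_ge0// ltW.
have t1 : 0 <= 2 / sg * k * (`|P1| + q) by nonneg.
have t2 : 0 <= 2 / sg * kap * Cs * (`|P1| + `|P0|) by nonneg.
have := normr_ge0 P0.
move: (2 / sg) t1 t2 h3 => c; lra.
Qed.

Definition trace2_const (k sg kap nu Cs Cp : R) :=
  1 + 4 / sg ^+ 2 * (2 * k * nu * trace1_const k sg kap Cs + k ^+ 2 + kap ^+ 2 * (sg / 2) * Cs + 4 * k / sg * Cp).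

(** As in trace1_bound, with the relation sigma ^ 2 * kap ^ 2 = k ^ 2 of the wave.  The jump w
    of the first derivatives is not small, but its factor s', the derivative of the
    speed, is. *)
Lemma trace2_bound (Z2 P2 Z1 P1 P0 s' w q q1 Cp : R) : 0 <= q -> 0 <= q1 -> 0 <= Cp -> `|P0| <= 1 ->
  `|s - sg| <= Cs * q -> `|s - sg| <= sg / 2 ->
  `|Z1| <= trace1_const k sg kap Cs * (`|P1| + `|P0| + q) ->
  `|s'| <= Cp * (`|P0| + q + q1) ->
  s * w = k * (P0 + 1) ->
  s' * w + s * (- k * (Z1 + kap) + s * (Z2 + kap ^+ 2) - s * P2) - k * (- k * (P0 + 1) + s * (Z1 + kap)) = 0 ->
  `|Z2| <= trace2_const k sg kap nu Cs Cp * (`|P2| + `|P1| + `|P0| + q + q1).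
Proof.
move=> q0 q10 Cp0 P01 ds ds' HZ1 Hs' Hw E.
have nu0 : 0 <= nu by apply: le_trans s_le; exact: ltW.
pose Q := `|P1| + `|P0| + q + q1.
have Q0 : 0 <= Q by rewrite /Q; nonneg.
pose C1 := trace1_const k sg kap Cs.
have c0 : 0 <= 2 / sg by rewrite divr_ge0// ltW.
have C10 : 0 <= C1 by rewrite /C1 /trace1_const; have := ler01 (R := R); move=> ?; nonneg.
have HZ1' : `|Z1| <= C1 * Q.
  by apply: (le_trans HZ1); rewrite ler_wpM2l// /Q; lra.
have hw : `|w| <= 4 * k / sg.
  have : s * `|w| <= k * 2.
    rewrite -{1}(gtr0_norm s0) -normrM Hw normrM (gtr0_norm k0) ler_wpM2l ?(ltW k0)//.
    by apply: (le_trans (ler_normD _ _)); rewrite normr1; lra.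
  have : sg / 2 * `|w| <= s * `|w| by rewrite ler_wpM2r.
  rewrite ler_pdivlMr//; lra.
have E1 : s ^+ 2 * (Z2 - P2) = 2 * k * s * Z1 - k ^+ 2 * P0 - kap ^+ 2 * ((s - sg) * (s - sg)) - s' * w.
  by move: E; rewrite kE; lra.
have h1 : s ^+ 2 * `|Z2 - P2| <= (2 * k * nu * C1 + k ^+ 2 + kap ^+ 2 * (sg / 2) * Cs + 4 * k / sg * Cp) * Q.
  rewrite -{1}(ger0_norm (sqr_ge0 s)) -normrM E1.
  have p1 : `|2 * k * s * Z1| <= 2 * k * nu * (C1 * Q).
    apply: normM_le => //; rewrite ger0_norm ?ler_wpM2l//; have := ltW k0; have := ltW s0 => *; nonneg.
  have p2 : `|k ^+ 2 * P0| <= k ^+ 2 * Q.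
    by apply: normM_le; [rewrite ger0_norm// sqr_ge0|rewrite /Q; have := normr_ge0 P1; lra].
  have p3 : `|kap ^+ 2 * ((s - sg) * (s - sg))| <= kap ^+ 2 * (sg / 2 * (Cs * Q)).
    apply: normM_le; first by rewrite ger0_norm// sqr_ge0.
    apply: normM_le => //; apply: (le_trans ds); rewrite ler_wpM2l// /Q.
    have := normr_ge0 P1; have := normr_ge0 P0; lra.
  have p4 : `|s' * w| <= Cp * Q * (4 * k / sg).
    apply: normM_le => //; apply: (le_trans Hs'); rewrite ler_wpM2l// /Q.
    have := normr_ge0 P1; lra.
  apply: (le_trans (normB_le (normB_le (normB_le p1 p2) p3) p4)).
  rewrite le_eqVlt; apply/orP; left; apply/eqP; ring.
have h2 : (sg / 2) ^+ 2 * `|Z2 - P2| <= s ^+ 2 * `|Z2 - P2|.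
  rewrite ler_wpM2r// lerXn2r// ?nnegrE ?divr_ge0 ?(ltW sg0)// ltW//.
set K := 2 * k * nu * C1 + k ^+ 2 + kap ^+ 2 * (sg / 2) * Cs + 4 * k / sg * Cp in h1.
have K0 : 0 <= K by rewrite /K; have := ltW k0; have := ltW sg0; have := ler0n R 2; have := ler0n R 4 => *; nonneg.
have h3 : `|Z2 - P2| <= 4 / sg ^+ 2 * K * Q.
  rewrite -(ler_pM2l (x := (sg / 2) ^+ 2)) ?exprn_gt0 ?divr_gt0//.
  rewrite (_ : (sg / 2) ^+ 2 * (4 / sg ^+ 2 * K * Q) = K * Q); last by field; rewrite gt_eqF.
  exact: le_trans h1.
have h4 : `|Z2| <= `|P2| + `|Z2 - P2|.
  by rewrite -{1}[Z2](subrK P2) addrC; exact: ler_normD.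
rewrite /trace2_const -/C1 -/K.
have D0 : 0 <= 4 / sg ^+ 2 * K by rewrite mulr_ge0// divr_ge0// sqr_ge0.
move: (4 / sg ^+ 2 * K) D0 h3 => D D0 h3.
have t1 : 0 <= D * `|P2| by nonneg.
by move: h3 h4 t1 Q0; rewrite /Q; lra.
Qed.

End trace_bounds.

(** * The perturbation in the frame of the front *)

(** Gl, Zl and Gr, Zr extend u and z smoothly from behind and from ahead of the front to the whole
    plane. *)
Section perturbation.
Context {R : realType}.
Variables (k kq sg nu u0 g Cw M eta T : R) (f U psi : R -> R) (Gl Gr Zl Zr : R -> R -> R).
Implicit Types (t x : R) (n j : nat).
Let Df n : R -> R := derive1n n f.
Let DU n : R -> R := derive1n n U.
Let kap := k / sg.
Let e x := expR (kap * x).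

Hypotheses (sf : smooth f) (sU : smooth U) (k0 : 0 < k) (sg0 : 0 < sg) (sgnu : sg < nu) (u00 : 0 < u0)
  (U0 : U 0 = u0) (g0 : 0 < g) (Cw0 : 0 <= Cw) (M0 : 0 <= M) (T0 : 0 < T).
Hypothesis sgE : f u0 - f 0 = sg * u0.
Hypothesis gap : forall x, x <= 0 -> sg + g <= Df 1 (U x).
Hypothesis lax : Df 1 0 <= sg - g.
Hypothesis HU : forall x, x <= 0 ->
  [/\ `|U x| <= Cw, `|DU 1 x| <= Cw * e x, `|DU 2 x| <= Cw * e x & `|DU 3 x| <= Cw * e x].
Hypothesis HM : forall n x, (n <= 4)%N -> `|x| <= Cw + 1 -> `|Df n x| <= M.
Hypothesis profile : forall x, x <= 0 ->
  [/\ (Df 1 (U x) - sg) * DU 1 x - kq * e x = 0,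
    (Df 1 (U x) - sg) * DU 2 x + Df 2 (U x) * DU 1 x ^+ 2 - kq * (kap * e x) = 0 &
    (Df 1 (U x) - sg) * DU 3 x + 3 * Df 2 (U x) * DU 1 x * DU 2 x + Df 3 (U x) * DU 1 x ^+ 3
      - kq * (kap * (kap * e x)) = 0].

(* Cs is a Lipschitz constant of the speed given by the Rankine-Hugoniot relation. *)
Let Cs := 2 * (M + sg) / u0.
Hypotheses (eta0 : 0 <= eta) (eta1 : eta <= 1) (eta_u : 4 * eta <= u0)
  (eta_g : M * eta + 2 * Cs * eta <= g / 2) (eta_sg : 2 * Cs * eta <= sg / 2)
  (eta_nu : 2 * Cs * eta <= nu - sg).

Hypotheses (sGl : smooth2 Gl) (sGr : smooth2 Gr) (sZl : smooth2 Zl) (sZr : smooth2 Zr).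
Hypothesis cpsi : {within `[0, T], continuous psi}.

Let ml G := moving T psi 1 G.
Let mr G := moving T psi (-1) G.
Let uL t := ml Gl t 0.
Let uR t := mr Gr t 0.
Definition shock_speed t : R :=
  (f (moving T psi 1 Gl t 0) - f (moving T psi (-1) Gr t 0)) /
  (moving T psi 1 Gl t 0 - moving T psi (-1) Gr t 0).
Let s := shock_speed.
Hypothesis dpsi : forall t, 0 < t < T -> is_derive t 1 psi (s t).

Hypothesis eq_ul : forall t y, 0 < t < T -> y < psi t ->
  dt Gl t y + Df 1 (Gl t y) * dx Gl t y - kq * Zl t y = 0.
Hypothesis eq_zl : forall t y, 0 < t < T -> y < psi t -> dt Zl t y + k * Zl t y = 0.
Hypothesis eq_ur : forall t y, 0 < t < T -> psi t < y ->
  dt Gr t y + Df 1 (Gr t y) * dx Gr t y - 0 * Zr t y = 0.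
Hypothesis eq_zr : forall t y, 0 < t < T -> psi t < y -> dt Zr t y + 0 * Zr t y = 0.
Hypothesis zcont : forall t, 0 < t < T -> ml Zl t 0 = mr Zr t 0.

Definition pertV j t x : R := moving T psi 1 (dxn j Gl) t x - derive1n j U x.
Definition pertZ j t x : R := moving T psi 1 (dxn j Zl) t x - (k / sg) ^+ j * expR (k / sg * x).
Definition pertY j t x : R := moving T psi (-1) (dxn j Gr) t x.
Definition pertP j t x : R := moving T psi (-1) (dxn j Zr) t x - (j == 0%N)%:R.

Let V := pertV. Let Z := pertZ. Let Y := pertY. Let P := pertP.

Hypotheses (bV0 : forall t x, x <= 0 -> `|V 0 t x| <= eta) (bV1 : forall t x, x <= 0 -> `|V 1 t x| <= eta)
 (bY0 : forall t x, x <= 0 -> `|Y 0 t x| <= eta) (bY1 : forall t x, x <= 0 -> `|Y 1 t x| <= eta)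
 (bP0 : forall t x, x <= 0 -> `|P 0 t x| <= eta).

Let T0' : 0 <= T. Proof. exact: ltW. Qed.
Let kap0 : 0 < kap. Proof. by rewrite divr_gt0. Qed.
Let kE : k = sg * kap. Proof. by rewrite /kap mulrC divfK// gt_eqF. Qed.
Let e0 x : 0 < e x. Proof. exact: expR_gt0. Qed.
Let e1 x : x <= 0 -> e x <= 1.
Proof. by move=> x0; rewrite /e -expR0 ler_expR mulr_ge0_le0// ltW. Qed.

Let cm b G : smooth2 G -> cont2 (moving T psi b G).
Proof. by move=> sG; apply: moving_cont => //; exact: smooth2_cont. Qed.

Let Cs0 : 0 <= Cs. Proof. by rewrite /Cs; have := sg0; have := u00; move=> ? ?; nonneg. Qed.

Let uLE t : uL t = u0 + V 0 t 0.
Proof. by rewrite /V /pertV /= U0 addrC subrK. Qed.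
Let uRE t : uR t = Y 0 t 0. Proof. by []. Qed.

Let jump t : u0 / 2 <= uL t - uR t.
Proof.
have := bV0 t (lexx 0); have := bY0 t (lexx 0); rewrite uLE uRE !ler_norml.
by have := eta_u; lra.
Qed.

Let jump0 t : uL t - uR t != 0.
Proof. by rewrite gt_eqF//; apply: lt_le_trans (jump t); rewrite divr_gt0. Qed.

Let lip n (a b : R) : (n <= 3)%N -> `|a| <= Cw + 1 -> `|b| <= Cw + 1 ->
  `|Df n a - Df n b| <= M * `|a - b|.
Proof.
move=> n3 aC bC; have [c cb ->] := MVT_between b a (fun y => smooth_d n y sf).
rewrite normrM ler_wpM2r//; apply: (HM (n := n.+1)) => //.
by move: aC bC; rewrite !ler_norml; case/orP: cb => /andP[]; lra.
Qed.

Let uCw t x : x <= 0 -> `|U x + V 0 t x| <= Cw + 1.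
Proof.
move=> x0; have [h _ _ _] := HU x0.
by apply: (le_trans (normD_le h (bV0 t x0))); rewrite lerD2l.
Qed.

Let UCw x : x <= 0 -> `|U x| <= Cw + 1.
Proof. by move=> x0; have [h _ _ _] := HU x0; apply: (le_trans h); rewrite lerDl. Qed.

Let small_Cw (y : R) : `|y| <= eta -> `|y| <= Cw + 1.
Proof. by move=> h; apply: (le_trans h); apply: (le_trans eta1); rewrite lerDr. Qed.

(** The speed is a difference quotient of f between the traces, and that of the wave is the same quotient
    between u0 and 0; the jump stays above u0 / 2. *)
Lemma speed_bound t : `|s t - sg| <= Cs * (`|V 0 t 0| + `|Y 0 t 0|).
Proof.
have J := jump t; have J0 : 0 < uL t - uR t by apply: lt_le_trans J; rewrite divr_gt0.
have -> : s t - sg = ((f (uL t) - f u0) - (f (uR t) - f 0) - sg * (V 0 t 0 - Y 0 t 0)) / (uL t - uR t).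
  rewrite /s /shock_speed -/(ml Gl t 0) -/(mr Gr t 0) -/(uL t) -/(uR t).
  apply: (mulIf (jump0 t)); rewrite mulrBl !divfK ?jump0//.
  have := sgE; rewrite uLE uRE; lra.
rewrite normrM normfV (gtr0_norm J0) ler_pdivrMr//.
have h1 : `|f (uL t) - f u0| <= M * `|V 0 t 0|.
  have := @lip 0 (uL t) u0 isT; rewrite uLE [u0 + _ - u0]addrC addKr; apply.
    by have := uCw t (lexx 0); rewrite U0.
  by have := UCw (lexx 0); rewrite U0.
have h2 : `|f (uR t) - f 0| <= M * `|Y 0 t 0|.
  have := @lip 0 (uR t) 0 isT; rewrite subr0 uRE; apply; first by apply: small_Cw; exact: bY0.
  by rewrite normr0 addr_ge0.
have h3 : `|sg * (V 0 t 0 - Y 0 t 0)| <= sg * (`|V 0 t 0| + `|Y 0 t 0|).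
  by rewrite normrM (gtr0_norm sg0) ler_wpM2l ?(ltW sg0)// ler_normB.
apply: (le_trans (normB_le (normB_le h1 h2) h3)).
have h4 : Cs * (`|V 0 t 0| + `|Y 0 t 0|) * (u0 / 2) <= Cs * (`|V 0 t 0| + `|Y 0 t 0|) * (uL t - uR t).
  by rewrite ler_wpM2l// mulr_ge0// addr_ge0.
apply: le_trans h4; rewrite /Cs le_eqVlt; apply/orP; left; apply/eqP; field.
by rewrite gt_eqF.
Qed.

Lemma speed_small t : `|s t - sg| <= 2 * Cs * eta.
Proof.
apply: (le_trans (speed_bound t)); rewrite (_ : 2 * Cs * eta = Cs * (eta + eta)); last by ring.
by apply: ler_wpM2l => //; apply: lerD; [exact: bV0|exact: bY0].
Qed.

Lemma speed_range t : sg / 2 <= s t <= nu.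
Proof.
have := speed_small t; rewrite ler_norml; have := eta_sg; have := eta_nu; lra.
Qed.

Let s_gt0 t : 0 < s t.
Proof. by have /andP[h _] := speed_range t; apply: lt_le_trans h; rewrite divr_gt0. Qed.

Let a_l t x := Df 1 (ml Gl t x) - s t.
Let a_r t x := s t - Df 1 (mr Gr t x).

Let mlE t x : ml Gl t x = U x + V 0 t x.
Proof. by rewrite /V /pertV /= addrC subrK. Qed.

Let lipV n t x : (n <= 3)%N -> x <= 0 -> `|Df n (ml Gl t x) - Df n (U x)| <= M * `|V 0 t x|.
Proof.
move=> n3 x0; have := lip n3 (uCw t x0) (UCw x0).
by rewrite -mlE [in X in M * X]mlE [U x + _ - _]addrC addKr.
Qed.

Let HMl n t x : (n <= 4)%N -> x <= 0 -> `|Df n (ml Gl t x)| <= M.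
Proof. by move=> n4 x0; apply: HM => //; rewrite mlE; exact: uCw. Qed.

Let HMr n t x : (n <= 4)%N -> x <= 0 -> `|Df n (mr Gr t x)| <= M.
Proof. by move=> n4 x0; apply: HM => //; apply: small_Cw; exact: bY0. Qed.

Definition min_speed (g sg : R) := Num.min (g / 2) (sg / 2).
Definition max_speed (M nu : R) := M + nu.
Let c1 := min_speed g sg.
Let cmax := max_speed M nu.

Let c1g : c1 <= g / 2. Proof. by rewrite ge_min lexx. Qed.
Let c1s : c1 <= sg / 2. Proof. by rewrite ge_min lexx orbT. Qed.

Let a_l_range t x : x <= 0 -> c1 <= a_l t x <= cmax.
Proof.
move=> x0; have h := gap x0; have := @lipV 1 t x isT x0.
have Mb : M * `|V 0 t x| <= M * eta by rewrite ler_wpM2l// bV0.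
have := @HMl 1 t x isT x0; have := speed_small t; have := s_gt0 t.
move: c1g eta_g sgnu sg0; rewrite !ler_norml /a_l /cmax /max_speed.
move: (Df 1 (ml Gl t x)) (Df 1 (U x)) Mb h => *; lra.
Qed.

Let a_r_range t x : x <= 0 -> c1 <= a_r t x <= cmax.
Proof.
move=> x0; have := @lip 1 (mr Gr t x) 0 isT (small_Cw (bY0 t x0)).
rewrite normr0 subr0 => /(_ (addr_ge0 Cw0 ler01)) h.
have Mb : M * `|Y 0 t x| <= M * eta by rewrite ler_wpM2l// bY0.
have {}h := le_trans h Mb.
have := @HMr 1 t x isT x0; have := speed_small t; have := speed_range t; move: h.
move: c1g eta_g lax; rewrite !ler_norml /a_r /cmax /max_speed.
move: (Df 1 (mr Gr t x)) (Df 1 0) => *; lra.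
Qed.

Let s_cmax t : c1 <= s t <= cmax.
Proof.
have := speed_range t; move: c1s M0; rewrite /cmax /max_speed; lra.
Qed.

Let oT t : 0 < t < T -> 0 <= t <= T.
Proof. by move=> /andP[t_0 tT]; rewrite !ltW. Qed.

Let HL t x : 0 < t < T -> x <= 0 ->
  [/\ ml (dt Gl) t x + Df 1 (ml Gl t x) * ml (dxn 1 Gl) t x - kq * ml Zl t x = 0,
      ml (dt (dxn 1 Gl)) t x + Df 2 (ml Gl t x) * ml (dxn 1 Gl) t x ^+ 2
        + Df 1 (ml Gl t x) * ml (dxn 2 Gl) t x - kq * ml (dxn 1 Zl) t x = 0 &
      ml (dt (dxn 2 Gl)) t x + Df 3 (ml Gl t x) * ml (dxn 1 Gl) t x ^+ 3
        + 3 * Df 2 (ml Gl t x) * ml (dxn 1 Gl) t x * ml (dxn 2 Gl) t x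
        + Df 1 (ml Gl t x) * ml (dxn 3 Gl) t x - kq * ml (dxn 2 Zl) t x = 0].
Proof.
move=> tT x0; have y0 : 1 * x + psi t <= psi t by rewrite mul1r gerDr.
have := reaction_hierarchy sf (transfers_left (psi t)) sGl sZl (fun y => @eq_ul t y tT) y0.
by rewrite /ml /moving clamp_id ?oT.
Qed.

Let HR t x : 0 < t < T -> x <= 0 ->
  [/\ mr (dt Gr) t x + Df 1 (mr Gr t x) * mr (dxn 1 Gr) t x - 0 * mr Zr t x = 0,
      mr (dt (dxn 1 Gr)) t x + Df 2 (mr Gr t x) * mr (dxn 1 Gr) t x ^+ 2
        + Df 1 (mr Gr t x) * mr (dxn 2 Gr) t x - 0 * mr (dxn 1 Zr) t x = 0 &
      mr (dt (dxn 2 Gr)) t x + Df 3 (mr Gr t x) * mr (dxn 1 Gr) t x ^+ 3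
        + 3 * Df 2 (mr Gr t x) * mr (dxn 1 Gr) t x * mr (dxn 2 Gr) t x
        + Df 1 (mr Gr t x) * mr (dxn 3 Gr) t x - 0 * mr (dxn 2 Zr) t x = 0].
Proof.
move=> tT x0; have y0 : psi t <= -1 * x + psi t by rewrite mulN1r lerDr oppr_ge0.
have := reaction_hierarchy sf (transfers_right (psi t)) sGr sZr (fun y => @eq_ur t y tT) y0.
by rewrite /mr /moving clamp_id ?oT.
Qed.

Let HZl n t x : 0 < t < T -> x <= 0 -> ml (dt (dxn n Zl)) t x + k * ml (dxn n Zl) t x = 0.
Proof.
move=> tT x0; have y0 : 1 * x + psi t <= psi t by rewrite mul1r gerDr.
have := decay_hierarchy (transfers_left (psi t)) sZl (fun y => @eq_zl t y tT) n y0.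
by rewrite /ml /moving clamp_id ?oT.
Qed.

Let HZr n t x : 0 < t < T -> x <= 0 -> mr (dt (dxn n Zr)) t x = 0.
Proof.
move=> tT x0; have y0 : psi t <= -1 * x + psi t by rewrite mulN1r lerDr oppr_ge0.
have := decay_hierarchy (transfers_right (psi t)) sZr (fun y => @eq_zr t y tT) n y0.
by rewrite mul0r addr0 /mr /moving clamp_id ?oT.
Qed.

Let FV j t x := ml (dt (dxn j Gl)) t x + s t * ml (dxn j.+1 Gl) t x + a_l t x * V j.+1 t x.

Let FV_bound0 t x : 0 < t < T -> x <= 0 ->
  `|FV 0 t x| <= linear_rate M Cw * (e x + eta) * `|V 0 t x|
     + lower_rate kq M Cw * (0 + `|Z 0 t x| + `|s t - sg| * e x).
Proof.
move=> tT x0; have [E0 _ _] := HL tT x0; have [P0 _ _] := profile x0.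
have [_ u1 u2 u3] := HU x0.
rewrite /FV -[V 1 t x]/(ml (dxn 1 Gl) t x - DU 1 x) (forcing0_id (s t) E0 P0).
rewrite [Z 0 t x](_ : _ = ml Zl t x - e x); last by rewrite /Z /pertZ expr0 mul1r.
apply: (@forcing0_bound _ kq M Cw (e x) eta (V 0 t x)) => //.
- exact: ltW.
- exact: lipV.
Qed.

Let Vsplit n t x : ml (dxn n Gl) t x = DU n x + (ml (dxn n Gl) t x - DU n x).
Proof. by rewrite addrC subrK. Qed.

Let FV_bound1 t x : 0 < t < T -> x <= 0 ->
  `|FV 1 t x| <= linear_rate M Cw * (e x + eta) * `|V 1 t x|
     + lower_rate kq M Cw * (`|V 0 t x| + `|Z 1 t x| + `|s t - sg| * e x).
Proof.
move=> tT x0; have [_ E1 _] := HL tT x0; have [_ P1 _] := profile x0.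
have [_ u1 u2 u3] := HU x0.
rewrite /FV -[V 2 t x]/(ml (dxn 2 Gl) t x - DU 2 x) (forcing1_id (s t) E1 P1).
rewrite [Z 1 t x](_ : _ = ml (dxn 1 Zl) t x - kap * e x); last by rewrite /Z /pertZ expr1.
by apply: (@forcing1_bound _ kq M Cw (e x) eta (V 0 t x)) => //; rewrite ?(ltW (e0 x))//;
  [exact: e1|exact: lipV|exact: lipV|exact: HMl|exact: bV1].
Qed.

Let FV_bound2 t x : 0 < t < T -> x <= 0 ->
  `|FV 2 t x| <= linear_rate M Cw * (e x + eta) * `|V 2 t x|
     + lower_rate kq M Cw * (`|V 0 t x| + `|V 1 t x| + `|Z 2 t x| + `|s t - sg| * e x).
Proof.
move=> tT x0; have [_ _ E2] := HL tT x0; have [_ _ P2] := profile x0.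
have [_ u1 u2 u3] := HU x0.
rewrite /FV -[V 3 t x]/(ml (dxn 3 Gl) t x - DU 3 x) (forcing2_id (s t) E2 P2).
rewrite [Z 2 t x](_ : _ = ml (dxn 2 Zl) t x - kap * (kap * e x)); last by rewrite (mulrA kap kap) -expr2.
by apply: (@forcing2_bound _ kq M Cw (e x) eta (V 0 t x)) => //; rewrite ?(ltW (e0 x))//;
  [exact: e1|exact: lipV|exact: lipV|exact: lipV|exact: HMl|exact: HMl|exact: bV1].
Qed.

Let cont_s : continuous s.
Proof.
have cL : continuous uL by apply: cont2_t; exact: cm.
have cR : continuous uR by apply: cont2_t; exact: cm.
have cf : continuous f by exact: (@smooth_c _ f 0 sf).
have c1_ : continuous (fun t => f (uL t) - f (uR t)).
  by apply: contB => t; apply: continuous_comp; [exact: cL|exact: cf|exact: cR|exact: cf].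
have c2_ : continuous (fun t => (uL t - uR t)^-1).
  by move=> t; apply: cvgV; [exact: jump0|exact: (contB cL cR)].
exact: (contM c1_ c2_).
Qed.

Let cdt b G : smooth2 G -> cont2 (fun t x => moving T psi b (dt G) t x + s t * moving T psi b (dx G) t x).
Proof.
move=> sG; apply: cont2D; first by apply: cm; exact: smooth2_dt.
by apply: cont2M; [exact: (cont2_of_t cont_s)|apply: cm; exact: smooth2_dx].
Qed.

Let cDU2 n : cont2 (fun _ x : R => DU n x).
Proof. by apply: cont2_of_x; exact: smooth_c. Qed.

Let cDf2 b n G : smooth2 G -> cont2 (fun t x => Df n (moving T psi b G t x)).
Proof. by move=> sG; apply: cont2_comp; [exact: smooth_c|exact: cm]. Qed.

Let cs2 : cont2 (fun t _ : R => s t). Proof. exact: (cont2_of_t cont_s). Qed.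

Let deriv_flux b G t x : smooth2 G ->
  is_derive x 1 (fun x => Df 1 (moving T psi b G t x))
    (Df 2 (moving T psi b G t x) * (b * moving T psi b (dx G) t x)).
Proof.
move=> sG; exact: (@deriv_comp _ (Df 1) (moving T psi b G t) _ _ _
  (smooth_d 1 (moving T psi b G t x) sf) (moving_dx T psi b t x sG)).
Qed.

Let transport_V j : transport T (V j) a_l (fun t x => Df 2 (ml Gl t x) * (1 * ml (dx Gl) t x)) (FV j).
Proof.
have sj := smooth2_dxn j sGl; have sj1 := smooth2_dxn j.+1 sGl.
split.
- by apply: cont2B; [exact: cm|exact: cDU2].
- by apply: cont2B; [exact: cDf2|exact: cs2].
- by apply: cont2M; [exact: cDf2|apply: cont2M; [exact: cont2C|apply: cm; exact: smooth2_dx]].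
- move=> t x; rewrite -[X in is_derive _ _ _ X]subr0.
  exact: (derivB (deriv_flux 1 t x sGl) (derivC (s t) x)).
exists (fun t x => ml (dt (dxn j Gl)) t x + s t * ml (dx (dxn j Gl)) t x), (V j.+1); split.
- exact: cdt.
- by apply: cont2B; [exact: cm|exact: cDU2].
- move=> t x tT; rewrite -[X in is_derive _ _ _ X]subr0.
  exact: (derivB (moving_dt 1 x sj tT (dpsi tT)) (derivC (DU j x) t)).
- move=> t x; have := derivB (moving_dx T psi 1 t x sj) (smooth_d j x sU).
  by rewrite mul1r.
- by [].
Qed.

Let FY j t x := mr (dt (dxn j Gr)) t x + s t * mr (dxn j.+1 Gr) t x + a_r t x * (-1 * mr (dxn j.+1 Gr) t x).

Let transport_Y j : transport T (Y j) a_r (fun t x => - (Df 2 (mr Gr t x) * (-1 * mr (dx Gr) t x))) (FY j).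
Proof.
have sj := smooth2_dxn j sGr; have sj1 := smooth2_dxn j.+1 sGr.
split.
- exact: cm.
- by apply: cont2B; [exact: cs2|exact: cDf2].
- by apply: cont2N; apply: cont2M; [exact: cDf2|apply: cont2M; [exact: cont2C|apply: cm; exact: smooth2_dx]].
- move=> t x; rewrite -[X in is_derive _ _ _ X]add0r.
  exact: (derivB (derivC (s t) x) (deriv_flux (-1) t x sGr)).
exists (fun t x => mr (dt (dxn j Gr)) t x + s t * mr (dx (dxn j Gr)) t x),
  (fun t x => -1 * mr (dxn j.+1 Gr) t x); split.
- exact: cdt.
- by apply: cont2M; [exact: cont2C|exact: cm].
- move=> t x tT; exact: (moving_dt (-1) x sj tT (dpsi tT)).
- move=> t x; exact: (moving_dx T psi (-1) t x sj).
- by [].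
Qed.

Let FP j t x := mr (dt (dxn j Zr)) t x + s t * mr (dxn j.+1 Zr) t x + s t * (-1 * mr (dxn j.+1 Zr) t x).

Let transport_P j : transport T (P j) (fun t _ => s t) (fun _ _ => 0) (FP j).
Proof.
have sj := smooth2_dxn j sZr; have sj1 := smooth2_dxn j.+1 sZr.
split.
- by apply: cont2B; [exact: cm|exact: cont2C].
- exact: cs2.
- exact: cont2C.
- by move=> t x; exact: derivC.
exists (fun t x => mr (dt (dxn j Zr)) t x + s t * mr (dx (dxn j Zr)) t x),
  (fun t x => -1 * mr (dxn j.+1 Zr) t x); split.
- exact: cdt.
- by apply: cont2M; [exact: cont2C|exact: cm].
- move=> t x tT; rewrite -[X in is_derive _ _ _ X]subr0.
  exact: (derivB (moving_dt (-1) x sj tT (dpsi tT)) (derivC (j == 0%N)%:R t)).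
- move=> t x; rewrite -[X in is_derive _ _ _ X]subr0.
  exact: (derivB (moving_dx T psi (-1) t x sj) (derivC (j == 0%N)%:R x)).
- by [].
Qed.

Let FZ j t x := ml (dt (dxn j Zl)) t x + s t * ml (dxn j.+1 Zl) t x + - s t * Z j.+1 t x.

Let transport_Z j : transport T (Z j) (fun t _ => - s t) (fun _ _ => 0) (FZ j).
Proof.
have sj := smooth2_dxn j sZl; have sj1 := smooth2_dxn j.+1 sZl.
have cE n : cont2 (fun _ x : R => kap ^+ n * e x).
  by apply: cont2M; [exact: cont2C|apply: cont2_of_x; exact: contEX].
split.
- by apply: cont2B; [exact: cm|exact: cE].
- exact: (cont2N cs2).
- exact: cont2C.
- by move=> t x; exact: derivC.
exists (fun t x => ml (dt (dxn j Zl)) t x + s t * ml (dx (dxn j Zl)) t x), (Z j.+1); split.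
- exact: cdt.
- by apply: cont2B; [exact: cm|exact: cE].
- move=> t x tT; rewrite -[X in is_derive _ _ _ X]subr0.
  exact: (derivB (moving_dt 1 x sj tT (dpsi tT)) (derivC (kap ^+ j * e x) t)).
- move=> t x; have := derivB (moving_dx T psi 1 t x sj) (derivZ (kap ^+ j) (derivEX kap x)).
  by rewrite mul1r mulrA -exprSr.
- by [].
Qed.

Let deriv_eq0_open (h : R -> R) t d : (forall r, 0 < r < T -> h r = 0) -> 0 < t < T ->
  is_derive t 1 h d -> d = 0.
Proof.
move=> h0 /andP[t_0 tT] dh; rewrite -(derive1_is dh); apply: derive1_is.
apply: (deriv_near _ (derivC (0 : R) t)).
near=> r; rewrite h0//; apply/andP; split; near: r; [exact: lt_nbhsr|exact: lt_nbhsl].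
Unshelve. all: by end_near. Qed.

Let dL t := ml (dt Gl) t 0 + s t * ml (dx Gl) t 0.
Let dR t := mr (dt Gr) t 0 + s t * mr (dx Gr) t 0.
Let s' t := (a_l t 0 * dL t + a_r t 0 * dR t) / (uL t - uR t).

Let deriv_s t : 0 < t < T -> is_derive t 1 s (s' t).
Proof.
move=> tT.
have d1 : is_derive t 1 uL (dL t) := moving_dt 1 0 sGl tT (dpsi tT).
have d2 : is_derive t 1 uR (dR t) := moving_dt (-1) 0 sGr tT (dpsi tT).
have d3 := derivB (@deriv_comp _ f uL t _ _ (smooth_d 0 (uL t) sf) d1)
  (@deriv_comp _ f uR t _ _ (smooth_d 0 (uR t) sf) d2).
have d4 := @is_deriveV R (fun r => uL r - uR r) t _ _ (jump0 t) (derivB d1 d2).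
have := derivM d3 d4.
rewrite [X in is_derive _ _ _ X -> _](_ : _ = s' t)//.
rewrite /s' /a_l /a_r -[Df 1 (ml Gl t 0)]/(derive1n 1 f (uL t)) -[Df 1 (mr Gr t 0)]/(derive1n 1 f (uR t)).
rewrite /s /shock_speed -/(ml Gl t 0) -/(mr Gr t 0) -/(uL t) -/(uR t) /GRing.scale /=.
have := jump0 t.
move: (derive1n 1 f (uL t)) (derive1n 1 f (uR t)) (f (uL t)) (f (uR t)) (dL t) (dR t) => a b c d e' g' J.
move: (uL t) (uR t) J => x y J.
by field.
Qed.

Let Z0P t : 0 < t < T -> Z 0 t 0 = P 0 t 0.
Proof.
move=> tT; rewrite /Z /P /pertZ /pertP expr0 mul1r mulr0 expR0 /=.
by congr (_ - _); exact: zcont.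
Qed.

Let trace_eq1 t : 0 < t < T -> s t * (ml (dxn 1 Zl) t 0 - mr (dxn 1 Zr) t 0) = k * ml Zl t 0.
Proof.
move=> tT.
have d1 := moving_dt 1 0 sZl tT (dpsi tT).
have d2 := moving_dt (-1) 0 sZr tT (dpsi tT).
have h0 r : 0 < r < T -> moving T psi 1 Zl r 0 - moving T psi (-1) Zr r 0 = 0.
  by move=> rT; apply/eqP; rewrite subr_eq0; apply/eqP; exact: zcont.
exact: trace1_id (deriv_eq0_open h0 tT (derivB d1 d2)) (@HZl 0 t 0 tT (lexx 0)) (@HZr 0 t 0 tT (lexx 0)).
Qed.

Let trace_eq2 t : 0 < t < T ->
  s' t * (ml (dxn 1 Zl) t 0 - mr (dxn 1 Zr) t 0)
  + s t * (- k * ml (dxn 1 Zl) t 0 + s t * ml (dxn 2 Zl) t 0 - s t * mr (dxn 2 Zr) t 0)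
  - k * (- k * ml Zl t 0 + s t * ml (dxn 1 Zl) t 0) = 0.
Proof.
move=> tT.
have d0 := moving_dt 1 0 sZl tT (dpsi tT).
have d1 := moving_dt 1 0 (smooth2_dxn 1 sZl) tT (dpsi tT).
have d2 := moving_dt (-1) 0 (smooth2_dxn 1 sZr) tT (dpsi tT).
have h0 r : 0 < r < T -> s r * (moving T psi 1 (dxn 1 Zl) r 0 - moving T psi (-1) (dxn 1 Zr) r 0)
    - k * moving T psi 1 Zl r 0 = 0.
  by move=> rT; apply/eqP; rewrite subr_eq0; apply/eqP; exact: trace_eq1.
exact: trace2_id (deriv_eq0_open h0 tT (derivB (derivM (deriv_s tT) (derivB d1 d2)) (derivZ k d0)))
  (@HZl 0 t 0 tT (lexx 0)) (@HZl 1 t 0 tT (lexx 0)) (@HZr 1 t 0 tT (lexx 0)).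
Qed.

Let Z1E t : ml (dxn 1 Zl) t 0 = Z 1 t 0 + kap.
Proof. by rewrite /Z /pertZ expr1 mulr0 expR0 mulr1 subrK. Qed.
Let Z2E t : ml (dxn 2 Zl) t 0 = Z 2 t 0 + kap ^+ 2.
Proof. by rewrite /Z /pertZ mulr0 expR0 mulr1 subrK. Qed.
Let P1E t : mr (dxn 1 Zr) t 0 = P 1 t 0. Proof. by rewrite /P /pertP subr0. Qed.
Let P2E t : mr (dxn 2 Zr) t 0 = P 2 t 0. Proof. by rewrite /P /pertP subr0. Qed.
Let P0E t : 0 < t < T -> ml Zl t 0 = P 0 t 0 + 1.
Proof. by move=> tT; rewrite zcont// /P /pertP subrK. Qed.

Let CZ1 := trace1_const k sg kap Cs.

Let trace1 t : 0 < t < T ->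
  `|Z 1 t 0| <= CZ1 * (`|P 1 t 0| + `|P 0 t 0| + (`|V 0 t 0| + `|Y 0 t 0|)).
Proof.
move=> tT; have /andP[s1 s2] := speed_range t.
apply: (trace1_bound k0 sg0 kap0 kE s1 Cs0 (addr_ge0 (normr_ge0 _) (normr_ge0 _)) (speed_bound t)).
by rewrite -Z1E -P1E -P0E//; exact: trace_eq1.
Qed.

Let Cd := 2 * linear_rate M Cw + lower_rate kq M Cw + lower_rate kq M Cw * Cs + cmax.
Definition speed_rate_const := 2 * cmax * (Cd + cmax) / u0.

Let lin0 : 0 <= linear_rate M Cw. Proof. by rewrite /linear_rate; nonneg. Qed.
Let low0 : 0 <= lower_rate kq M Cw. Proof. by rewrite /lower_rate; nonneg. Qed.
Let cmax0 : 0 <= cmax.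
Proof. by rewrite /cmax /max_speed; have := M0; have := sgnu; have := sg0; lra. Qed.
Let Cd0 : 0 <= Cd. Proof. by rewrite /Cd; have := ler0n R 2 => *; nonneg. Qed.

Let FY0 t x : 0 < t < T -> x <= 0 -> FY 0 t x = 0.
Proof.
move=> tT x0; have [E0 _ _] := HR tT x0; move: E0.
rewrite /FY /a_r -[dxn 0 Gr]/(Gr); move: (mr (dt Gr) t x) => d; lra.
Qed.

(** By the equations at the front, the time derivatives of the traces of u are expressed by the first
    space derivatives of the perturbation and by lower order terms. *)
Let speed_rate t : 0 < t < T ->
  `|s' t| <= speed_rate_const * (`|P 0 t 0| + (`|V 0 t 0| + `|Y 0 t 0|) + (`|V 1 t 0| + `|Y 1 t 0|)).
Proof.
move=> tT; set Q := _ + _ + _.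
have q0 := normr_ge0 (P 0 t 0). have q1 := normr_ge0 (V 0 t 0). have q2 := normr_ge0 (Y 0 t 0).
have q3 := normr_ge0 (V 1 t 0). have q4 := normr_ge0 (Y 1 t 0).
have Q0 : 0 <= Q by rewrite /Q; nonneg.
have [/andP[al1 al2] /andP[ar1 ar2]] := (a_l_range t (lexx 0), a_r_range t (lexx 0)).
have c10 : 0 <= c1 by rewrite le_min !divr_ge0 ?(ltW g0) ?(ltW sg0).
have al : `|a_l t 0| <= cmax by rewrite ger0_norm// (le_trans c10).
have ar : `|a_r t 0| <= cmax by rewrite ger0_norm// (le_trans c10).
have HdL : `|dL t| <= Cd * Q.
  have -> : dL t = FV 0 t 0 - a_l t 0 * V 1 t 0 by rewrite /FV /dL -[dxn 0 Gl]/(Gl) -[dxn 1 Gl]/(dx Gl) addrK.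
  have := FV_bound0 tT (lexx 0); rewrite (Z0P tT) [e 0](_ : _ = 1); last by rewrite /e mulr0 expR0.
  move=> h; apply: (le_trans (normB_le h (normM_le al (lexx _)))).
  have := speed_bound t.
  move: (`|P 0 t 0|) (`|V 0 t 0|) (`|Y 0 t 0|) (`|V 1 t 0|) (`|Y 1 t 0|) (`|s t - sg|) q0 q1 q2 q3 q4 @Q Q0.
  move=> p v y v1 y1 ds p0 v0 y0 v10 y10 Q Q0 hds.
  have t1 : linear_rate M Cw * (1 + eta) * v <= 2 * linear_rate M Cw * Q.
    have -> : 2 * linear_rate M Cw * Q = linear_rate M Cw * (2 * Q) by ring.
    rewrite -mulrA; apply: ler_wpM2l => //.
    have : (1 + eta) * v <= 2 * v by rewrite ler_wpM2r// -[leRHS]/(1 + 1) lerD2l.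
    rewrite /Q; lra.
  have t2 : lower_rate kq M Cw * (0 + p + ds * 1) <= lower_rate kq M Cw * Q + lower_rate kq M Cw * (Cs * Q).
    rewrite -mulrDr ler_wpM2l// add0r mulr1 lerD//; first by rewrite /Q; lra.
    by apply: (le_trans hds); rewrite ler_wpM2l// /Q; lra.
  have t3 : cmax * v1 <= cmax * Q by rewrite ler_wpM2l// /Q; lra.
  rewrite /Cd; lra.
have HdR : `|dR t| <= cmax * Q.
  have -> : dR t = a_r t 0 * Y 1 t 0.
    have := FY0 tT (lexx 0); rewrite /FY /dR -[dxn 0 Gr]/(Gr) -[dxn 1 Gr]/(dx Gr).
    rewrite -[Y 1 t 0]/(mr (dx Gr) t 0); lra.
  by apply: normM_le => //; rewrite /Q; lra.
have J := jump t; have J0 : 0 < uL t - uR t by apply: lt_le_trans J; rewrite divr_gt0.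
rewrite /s' normrM normfV (gtr0_norm J0) ler_pdivrMr//.
apply: (le_trans (normD_le (normM_le al HdL) (normM_le ar HdR))).
have h4 : speed_rate_const * Q * (u0 / 2) <= speed_rate_const * Q * (uL t - uR t).
  have sr0 : 0 <= speed_rate_const.
    by rewrite /speed_rate_const; have := ltW u00; have := ler0n R 2 => *; nonneg.
  by rewrite ler_wpM2l// mulr_ge0.
apply: le_trans h4; rewrite /speed_rate_const le_eqVlt; apply/orP; left; apply/eqP; field.
by rewrite gt_eqF.
Qed.

Let CZ2 := trace2_const k sg kap nu Cs speed_rate_const.

Let trace2 t : 0 < t < T -> `|Z 2 t 0| <= CZ2 * (`|P 2 t 0| + `|P 1 t 0| + `|P 0 t 0|
     + (`|V 0 t 0| + `|Y 0 t 0|) + (`|V 1 t 0| + `|Y 1 t 0|)).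
Proof.
move=> tT; have /andP[s1 s2] := speed_range t.
have sr0 : 0 <= speed_rate_const.
  by rewrite /speed_rate_const; have := ltW u00; have := ler0n R 2 => *; nonneg.
apply: (trace2_bound k0 sg0 kap0 kE s1 s2 Cs0 (addr_ge0 (normr_ge0 _) (normr_ge0 _))
  (addr_ge0 (normr_ge0 _) (normr_ge0 _)) sr0 _ (speed_bound t) _ (trace1 tT) (speed_rate tT)
  (w := ml (dxn 1 Zl) t 0 - mr (dxn 1 Zr) t 0)).
- exact: le_trans (bP0 t (lexx 0)) eta1.
- exact: le_trans (speed_small t) eta_sg.
- by rewrite trace_eq1// P0E.
- by have := trace_eq2 tT; rewrite -Z1E -Z2E -P0E// -P2E.
Qed.

Definition frame_const := lower_rate kq M Cw + (kap + kap ^+ 2 + kap ^+ 3) + Cs + CZ1 + CZ2.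
Let Cf := frame_const.

Let CZ10 : 0 <= CZ1.
Proof. by rewrite /CZ1 /trace1_const; have := ltW sg0; have := ltW k0; have := ler0n R 2; have := ler0n R 1 => *; nonneg. Qed.
Let sr0 : 0 <= speed_rate_const.
Proof. by rewrite /speed_rate_const; have := ltW u00; have := ler0n R 2 => *; nonneg. Qed.
Let nu0 : 0 <= nu. Proof. exact: le_trans (ltW sg0) (ltW sgnu). Qed.
Let CZ20 : 0 <= CZ2.
Proof.
by rewrite /CZ2 /trace2_const -/CZ1; have := ltW sg0; have := ltW k0; have := ler0n R 2; have := ler0n R 1;
  have := ler0n R 4 => *; nonneg.
Qed.

Let Cf_low : lower_rate kq M Cw <= Cf.
Proof.
rewrite /Cf /frame_const; have := CZ10; have := CZ20; have := Cs0.
have kk := ltW kap0; have k2 := sqr_ge0 kap; have k3 := exprn_ge0 3 kk.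
move: (kap ^+ 2) (kap ^+ 3) k2 k3 => *; lra.
Qed.
Let Cf_kap j : (j < 3)%N -> kap ^+ j.+1 <= Cf.
Proof.
have kk := ltW kap0; have k2 := sqr_ge0 kap; have k3 := exprn_ge0 3 kk.
have h : kap + kap ^+ 2 + kap ^+ 3 <= Cf.
  rewrite /Cf /frame_const; have := low0; have := Cs0; have := CZ10; have := CZ20.
  move: (kap ^+ 2) (kap ^+ 3) => *; lra.
by move=> j3; apply: le_trans h; case: j j3 => [|[|[|//]]] _; move: (kap ^+ 2) (kap ^+ 3) k2 k3 => *; lra.
Qed.
Let Cf_Cs : Cs <= Cf.
Proof.
rewrite /Cf /frame_const; have := low0; have := CZ10; have := CZ20.
have kk := ltW kap0; have k2 := sqr_ge0 kap; have k3 := exprn_ge0 3 kk.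
move: (kap ^+ 2) (kap ^+ 3) k2 k3 => *; lra.
Qed.
Let Cf_Z1 : CZ1 <= Cf.
Proof.
rewrite /Cf /frame_const; have := low0; have := CZ20; have := Cs0.
have kk := ltW kap0; have k2 := sqr_ge0 kap; have k3 := exprn_ge0 3 kk.
move: (kap ^+ 2) (kap ^+ 3) k2 k3 => *; lra.
Qed.
Let Cf_Z2 : CZ2 <= Cf.
Proof.
rewrite /Cf /frame_const; have := low0; have := CZ10; have := Cs0.
have kk := ltW kap0; have k2 := sqr_ge0 kap; have k3 := exprn_ge0 3 kk.
move: (kap ^+ 2) (kap ^+ 3) k2 k3 => *; lra.
Qed.

Lemma frame_const_ge0 : 0 <= frame_const.
Proof. exact: le_trans low0 Cf_low. Qed.

Let rate0 x : 0 <= linear_rate M Cw * (e x + eta).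
Proof. by have := ltW (e0 x) => *; nonneg. Qed.

Let M_lin : 3 * M <= linear_rate M Cw.
Proof. by rewrite /linear_rate mulrDr mulr1 lerDr !mulr_ge0. Qed.

Let M_low : M <= lower_rate kq M Cw.
Proof.
rewrite /lower_rate; have h : M * 1 <= M * (Cw + 1) ^+ 3.
  by rewrite ler_wpM2l// exprn_ege1// lerDr.
have kq0 := normr_ge0 kq; move: ((Cw + 1) ^+ 3) h => D h.
have := M0; have := Cw0; lra.
Qed.

(** The equations of the wave are exact, so that subtracting them leaves no source term besides those
    of the record frame; frame_const dominates the constants of all the bounds above. *)
Theorem perturbation_frame : frame k sg nu c1 cmax (linear_rate M Cw) Cf kap eta T s V Z Y P.
Proof.
split.
- move=> j j3; exists a_l, (fun t x => Df 2 (ml Gl t x) * (1 * ml (dx Gl) t x)), (FV j).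
  split; first exact: transport_V.
  move=> t x tT x0; split; first exact: a_l_range.
    rewrite mul1r; apply: (le_trans (@normM_le _ _ _ _ (Cw * e x + eta) (@HMl 2 t x isT x0) _)).
      have [_ h1 _ _] := HU x0; have := normD_le h1 (bV1 t x0).
      by rewrite -[ml (dx Gl) t x]/(ml (dxn 1 Gl) t x) [in X in _ -> X]Vsplit.
    rewrite /linear_rate -/(e x).
    have a1 : M * (Cw * e x + eta) <= M * ((Cw + 1) * (e x + eta)).
      rewrite ler_wpM2l//; have := mulr_ge0 Cw0 eta0; have := ltW (e0 x); lra.
    have a2 : 0 <= M * ((Cw + 1) * (e x + eta)) by have := ltW (e0 x) => ?; nonneg.
    move: a1 a2; rewrite (mulrA M) => a1 a2; lra.
  have S0 : 0 <= \sum_(i < j) `|V i t x| + `|Z j t x| + `|s t - sg| * e x.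
    by have := ltW (e0 x) => *; nonneg.
  have mono := ler_wpM2r S0 Cf_low.
  case: j j3 S0 mono => [|[|[|//]]] _ S0 mono; apply: le_trans (lerD (lexx _) mono).
  + by rewrite big_ord0; exact: FV_bound0.
  + by rewrite (sum1 (fun i => `|V i t x|)); exact: FV_bound1.
  + by rewrite (sum2 (fun i => `|V i t x|)); exact: FV_bound2.
- move=> j j3; exists (FZ j); split; first exact: transport_Z.
  move=> t x tT x0.
  have E : FZ j t x = - k * Z j t x + kap ^+ j.+1 * (s t - sg) * e x.
    have := HZl j tT x0; rewrite /FZ /Z /pertZ -/kap -/(e x) -/(ml (dxn j Zl) t x) -/(ml (dxn j.+1 Zl) t x) exprS kE.
    move: (ml (dt (dxn j Zl)) t x) (ml (dxn j Zl) t x) (ml (dxn j.+1 Zl) t x) (kap ^+ j) => *; lra.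
  have h : `|kap ^+ j.+1 * (s t - sg) * e x| <= Cf * (`|s t - sg| * e x).
    rewrite -mulrA; apply: normM_le; first by rewrite ger0_norm ?Cf_kap// exprn_ge0// ltW.
    by rewrite normrM (gtr0_norm (e0 x)).
  move: h; rewrite E ler_norml => /andP[h1 h2].
  rewrite -/(e x); split; [by rewrite lerD2l|by rewrite lerD2l].
- move=> j j3; exists a_r, (fun t x => - (Df 2 (mr Gr t x) * (-1 * mr (dx Gr) t x))), (FY j).
  split; first exact: transport_Y.
  move=> t x tT x0; split; first exact: a_r_range.
    rewrite mulN1r mulrN opprK; apply: (le_trans (normM_le (@HMr 2 t x isT x0) (bY1 t x0))).
    have a1 : 3 * M * eta <= linear_rate M Cw * eta by rewrite ler_wpM2r.
    have a2 : 0 <= linear_rate M Cw * e x by have := ltW (e0 x) => ?; nonneg.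
    have a3 := mulr_ge0 M0 eta0; rewrite -/(e x); lra.
  have S0 : 0 <= \sum_(i < j) `|Y i t x| by nonneg.
  have mono := ler_wpM2r S0 Cf_low.
  have [R0 R1 R2] := HR tT x0.
  case: j j3 S0 mono => [|[|[|//]]] _ S0 mono; apply: le_trans (lerD (lexx _) mono).
  + by rewrite FY0// normr0 big_ord0 mulr0 addr0; apply: mulr_ge0; [exact: rate0|].
  + have -> : FY 1 t x = - (Df 2 (mr Gr t x) * Y 1 t x ^+ 2).
      exact: (right_forcing1_id (s t) R1).
    rewrite (sum1 (fun i => `|Y i t x|)); apply: (@le_trans _ _ (linear_rate M Cw * (e x + eta) * `|Y 1 t x|)).
      apply: (@right_forcing1_bound _ M) => //; [exact: ltW|exact: HMr|exact: bY1].
    by rewrite lerDl; nonneg.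
  + have -> : FY 2 t x = - (Df 3 (mr Gr t x) * Y 1 t x ^+ 3 + 3 * Df 2 (mr Gr t x) * Y 1 t x * Y 2 t x).
      exact: (right_forcing2_id (s t) R2).
    rewrite (sum2 (fun i => `|Y i t x|)).
    apply: (@le_trans _ _ (linear_rate M Cw * (e x + eta) * `|Y 2 t x| + lower_rate kq M Cw * `|Y 1 t x|)).
      apply: (@right_forcing2_bound _ M) => //; [exact: ltW|exact: HMr|exact: HMr|exact: bY1].
    by rewrite lerD2l ler_wpM2l// lerDr.
- move=> j j3; exists (fun t _ => s t), (fun _ _ => 0), (FP j); split; first exact: transport_P.
  move=> t x tT x0; split; [exact: s_cmax|by rewrite normr0; exact: rate0|].
  have -> : FP j t x = 0.
    by rewrite /FP HZr// add0r mulN1r mulrN subrr.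
  by rewrite normr0 addr0; apply: mulr_ge0; [exact: rate0|].
- by move=> t tT; have /andP[h1 h2] := speed_range t; rewrite h2 (ltW (s_gt0 t)).
- by move=> t tT; apply: (le_trans (speed_bound t)); rewrite ler_wpM2r.
- by move=> t tT; rewrite Z0P.
- move=> t tT; apply: (le_trans (trace1 tT)); rewrite addrA ler_wpM2r//; nonneg.
- move=> t tT; apply: (le_trans (trace2 tT)); rewrite !addrA ler_wpM2r//; nonneg.
Qed.

End perturbation.

(** * Norms on the punctured line *)

Section sup_norm.
Context {R : realType}.
Notation mu := (@lebesgue_measure R).

(** Where a continuous function exceeds eta it does so on a ball, which is not negligible. *)
Lemma Loo_pointwise (f : R -> R) (eta a : R) :
  ('N[mu]_+oo[EFin \o f] < eta%:E)%E -> {for a, continuous f} -> `|f a| <= eta.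
Proof.
rewrite unlock /Lnorm.
have -> : (0 < mu [set: R])%E.
  have : ((mu (ball (0%R : R) 1%R) <= mu [set: R])%E) by apply: le_measure; rewrite ?inE//; exact: measurable_ball.
  by apply: lt_le_trans; rewrite lebesgue_measure_ball// lte_fin.
move=> /ltW /ess_supP [N [mN N0 HN]] ca.
rewrite leNgt; apply/negP => fa.
have ca' : `|f x| @[x --> a] --> `|f a| by exact: (cvg_norm ca).
have /nbhs_ballP[d /= d0 Hd] : \forall x \near a, eta < `|f x|.
  exact: (cvgr_gt _ ca' _ fa).
have : (mu (ball a d) <= mu N)%E.
  apply: le_measure; rewrite ?inE//; first exact: measurable_ball.
  move=> x xd; apply: HN => /=; have := Hd x xd.
  by rewrite lee_fin leNgt => ->.
by rewrite N0 lebesgue_measure_ball ?(ltW d0)// lee_fin leNgt mulrn_wgt0.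
Qed.

End sup_norm.

Section punctured_line.
Context {R : realType}.
Notation mu := (@lebesgue_measure R).
Implicit Types (f g F hL hR : R -> R) (a b N : R).

(** The integral of a nonnegative function is the supremum of the integrals of the simple functions
    below it. *)
Lemma ge0_le_integral_sup (D : set R) (f g : R -> \bar R) :
  (forall x, D x -> (0 <= f x)%E) -> (forall x, D x -> (f x <= g x)%E) ->
  (\int[mu]_(x in D) f x <= \int[mu]_(x in D) g x)%E.
Proof.
move=> f0 fg; have g0 x : D x -> (0 <= g x)%E by move=> Dx; apply: le_trans (fg x Dx); exact: f0.
rewrite !ge0_integralE//; apply: le_ereal_sup => _ [h hf <-].
exists h => // x; apply: (le_trans (hf x)).
by rewrite /patch; case: ifPn => // /set_mem; exact: fg.
Qed.

Lemma sint_widen a b c f : c <= a -> continuous f -> (forall x, x <= b -> 0 <= f x) ->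
  sint a b f <= sint c b f.
Proof.
move=> ca cf f0; rewrite -lee_fin -!sintE//; apply: ge0_subset_integral => //.
- by apply/measurable_EFinP; apply: measurable_funTS; exact: continuous_measurable_fun.
- by move=> x; rewrite /= in_itv /= lee_fin => /andP[_ xb]; exact: f0.
- by apply: subset_itvr; rewrite bnd_simp.
Qed.

(** A nonnegative function on the punctured line is described by its two halves, the right one reflected,
    and is integrated over punctured segments exhausting the line. *)
Section halves.
Variables (F hL hR : R -> R).
Hypotheses (cL : continuous hL) (cR : continuous hR) (F0 : forall x, 0 <= F x)
  (FL : forall x, x < 0 -> F x = hL x) (FR : forall x, 0 < x -> F x = hR (- x)).

Definition punctured (n : nat) : set R := `[- n%:R, 0[%classic `|` `]0, n%:R]%classic.

Let mp n : measurable (punctured n). Proof. by apply: measurableU. Qed.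

Lemma bigcup_punctured : \bigcup_n punctured n = Rstar.
Proof.
apply/seteqP; split => [x [n _]|x /eqP /= x0].
  by rewrite /punctured /= !in_itv /= /Rstar /=; case=> /andP[a b]; apply/eqP; [rewrite lt_eqF|rewrite gt_eqF].
exists (Num.truncn `|x|).+1 => //.
have xn : `|x| <= (Num.truncn `|x|).+1%:R by apply: ltW; exact: truncnS_gt.
rewrite /punctured /= !in_itv /=; case: (ltgtP x 0) x0 => // xs _; [left|right].
  by move: xn; rewrite ler_norml => /andP[-> _].
by move: xn; rewrite ler_norml => /andP[_ ->].
Qed.

Let chR : continuous (fun x : R => hR (- x)).
Proof. by move=> x; apply: (@continuous_comp _ _ _ -%R hR); [exact: opp_continuous|exact: cR]. Qed.

Let mhR : measurable_fun setT (fun x : R => hR (- x)).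
Proof. exact: continuous_measurable_fun chR. Qed.

Let mF : measurable_fun Rstar (fun x => (F x)%:E).
Proof.
apply/measurable_EFinP.
have -> : Rstar = (`]-oo, 0%R[%classic `|` `]0%R, +oo[%classic : set R).
  apply/seteqP; split => x; rewrite /Rstar /= !in_itv /= ?andbT.
    by move=> /eqP; rewrite neq_lt => /orP.
  by move=> h; apply/eqP; rewrite neq_lt; apply/orP.
apply/measurable_funU => //; split.
- apply: (@eq_measurable_fun _ _ _ _ _ hL).
    by move=> x; rewrite inE /= in_itv /= => /FL ->.
  by apply: measurable_funTS; exact: continuous_measurable_fun.
- apply: (@eq_measurable_fun _ _ _ _ _ (fun x : R => hR (- x))).
    by move=> x; rewrite inE /= in_itv /= andbT => /FR ->.
  exact: measurable_funTS.
Qed.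

Let sub n : punctured n `<=` Rstar.
Proof. by rewrite -bigcup_punctured => x; exists n. Qed.

Let mRstar : measurable (@Rstar R).
Proof. by rewrite -bigcup_punctured; apply: bigcup_measurable. Qed.

Lemma integral_punctured n :
  (\int[mu]_(x in punctured n) (F x)%:E = (sint (- n%:R) 0 (fun x => hL x + hR x))%:E)%E.
Proof.
rewrite /punctured ge0_integral_setU//; last 3 first.
- exact: (measurable_funS mRstar (@sub n) mF).
- by move=> x _; rewrite lee_fin.
- apply/disj_setPS => x [/=]; rewrite !in_itv /= => /andP[_ a] /andP[b _].
  by move: (lt_trans a b); rewrite ltxx.
have -> : (\int[mu]_(x in `[(- n%:R)%R, 0%R[) (F x)%:E = (sint (- n%:R) 0 hL)%:E)%E.
  rewrite -sintE// -integral_itv_bndo_bndc.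
    by apply: eq_integral => x; rewrite inE /= in_itv /= => /andP[_ /FL ->].
  by apply/measurable_EFinP; apply: measurable_funTS; exact: continuous_measurable_fun.
have -> : (\int[mu]_(x in `]0%R, n%:R%R]) (F x)%:E = (sint (- n%:R) 0 hR)%:E)%E.
  have -> : sint (- n%:R) 0 hR = sint 0 n%:R (fun x => hR (- x)) by rewrite sint_opp// oppr0.
  rewrite -(sintE _ _ chR) -integral_itv_obnd_cbnd.
    by apply: eq_integral => x; rewrite inE /= in_itv /= => /andP[/FR -> _].
  by apply/measurable_EFinP; apply: measurable_funTS; exact: mhR.
by rewrite -EFinD sintD.
Qed.

Lemma integral_Rstar_ge n :
  ((sint (- n%:R) 0 (fun x => hL x + hR x))%:E <= \int[mu]_(x in Rstar) (F x)%:E)%E.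
Proof.
rewrite -integral_punctured; apply: ge0_subset_integral => //; first exact: mp.
by move=> x _; rewrite lee_fin.
Qed.

Lemma integral_Rstar_cvg :
  ((sint (- n%:R) 0 (fun x => hL x + hR x))%:E @[n --> \oo] -->
    \int[mu]_(x in Rstar) (F x)%:E)%E.
Proof.
under eq_cvg do rewrite -integral_punctured.
rewrite -bigcup_punctured; apply: ge0_nondecreasing_set_cvg_integral => //.
- move=> m n mn; apply/subsetPset => x; rewrite /punctured /= !in_itv /=.
  have h : (m%:R : R) <= n%:R by rewrite ler_nat.
  by case=> /andP[a b]; [left|right]; apply/andP; split => //; lra.
- by move=> n; exact: (measurable_funS mRstar (@sub n) mF).
- by move=> n x _; rewrite lee_fin.
Qed.

End halves.
End punctured_line.

Section weighted_norm.
Context {R : realType}.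
Notation mu := (@lebesgue_measure R).
Variables (m : nat) (eps : R) (v zeta : R -> R) (hL hR : nat -> R -> R).
Let F l x := (derive1n l v x ^+ 2 + derive1n l zeta x ^+ 2) * expR (eps * `|x|).
Hypotheses (cL : forall l, continuous (hL l)) (cR : forall l, continuous (hR l))
  (hL0 : forall l x, 0 <= hL l x) (hR0 : forall l x, 0 <= hR l x)
  (FL : forall l x, (l <= m)%N -> x < 0 -> F l x = hL l x)
  (FR : forall l x, (l <= m)%N -> 0 < x -> F l x = hR l (- x)).

Let S n : R := \sum_(l < m.+1) sint (- n%:R) 0 (fun x => hL l x + hR l x).

Let F0 l x : 0 <= F l x.
Proof. by rewrite mulr_ge0 ?expR_ge0// addr_ge0// sqr_ge0. Qed.

Let S0 n : 0 <= S n.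
Proof. by apply: sumr_ge0 => l _; apply: sint_ge0 => x _; rewrite addr_ge0. Qed.

Let I0 : (0 <= \sum_(l < m.+1) \int[mu]_(x in Rstar) (F l x)%:E)%E.
Proof. by apply: sume_ge0 => l _; apply: integral_ge0 => x _; rewrite lee_fin. Qed.

Lemma wHnorm_ge n : ((Num.sqrt (S n))%:E <= wHnorm m eps v zeta)%E.
Proof.
have -> : ((Num.sqrt (S n))%:E = (S n)%:E `^ 2^-1)%E by rewrite poweR_EFin powR12_sqrt.
rewrite /wHnorm gt0_ler_poweR// ?in_itv /= ?leey ?lee_fin ?andbT//.
rewrite -sumEFin; apply: lee_sum => l _.
have lm : (l <= m)%N by rewrite -ltnS.
exact: (integral_Rstar_ge (@cL l) (@cR l) (@F0 l) (fun x => @FL l x lm) (fun x => @FR l x lm)).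
Qed.

Lemma wHnorm_le c : (forall n, ((Num.sqrt (S n))%:E <= c)%E) -> (wHnorm m eps v zeta <= c)%E.
Proof.
case: c => [c Hc| |] ; last 2 first.
- by rewrite leey.
- by move=> /(_ 0%N).
have c0 : 0 <= c by have := Hc 0%N; rewrite lee_fin; apply: le_trans; exact: sqrtr_ge0.
have -> : (c%:E = (c ^+ 2)%:E `^ 2^-1)%E by rewrite poweR_EFin powR12_sqrt ?sqr_ge0// sqrtr_sqr ger0_norm.
rewrite /wHnorm gt0_ler_poweR// ?in_itv /= ?leey ?lee_fin ?andbT ?sqr_ge0//.
have SI : ((S n)%:E @[n --> \oo] --> \sum_(l < m.+1) \int[mu]_(x in Rstar) (F l x)%:E)%E.
  under eq_cvg do rewrite -sumEFin.
  apply: cvg_nnesum => [l _|l _].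
    by apply: nearW => n; rewrite lee_fin; apply: sint_ge0 => x _; rewrite addr_ge0.
  have lm : (l <= m)%N by rewrite -ltnS.
  exact: (integral_Rstar_cvg (@cL l) (@cR l) (@F0 l) (fun x => @FL l x lm) (fun x => @FR l x lm)).
apply: (cvge_to_le SI); apply: nearW => n; rewrite lee_fin.
by rewrite -(sqr_sqrtr (S0 n)) ler_pXn2r// ?nnegrE ?sqrtr_ge0// -lee_fin.
Qed.

End weighted_norm.

Section time_integral.
Context {R : realType}.
Notation mu := (@lebesgue_measure R).

Lemma sint_le_integral (a b : R) (h : R -> R) (G : R -> \bar R) : continuous h ->
  (forall x, a <= x <= b -> 0 <= h x) -> (forall x, a <= x <= b -> ((h x)%:E <= G x)%E) ->
  ((sint a b h)%:E <= \int[mu]_(x in `[a, b]) G x)%E.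
Proof.
move=> ch h0 hG; rewrite -sintE//; apply: ge0_le_integral_sup => x; rewrite /= in_itv /=; last exact: hG.
by rewrite lee_fin; exact: h0.
Qed.
End time_integral.

(** * From cut-off masses to weighted norms *)

Section norm_estimate.
Context {R : realType}.
Notation mu := (@lebesgue_measure R).
Variables (eps c theta D T : R) (V Z Y P : nat -> R -> R -> R) (v zeta : R -> R -> R).
Hypotheses (cV : forall j, cont2 (V j)) (cZ : forall j, cont2 (Z j)) (cY : forall j, cont2 (Y j))
  (cP : forall j, cont2 (P j)) (c0 : 0 <= c) (D0 : 0 <= D) (T0 : 0 <= T).
Hypotheses
  (vL : forall l t x, 0 <= t <= T -> x < 0 -> derive1n l (v t) x = V l t x)
  (vR : forall l t x, 0 <= t <= T -> 0 < x -> derive1n l (v t) x = Y l t (- x))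
  (zL : forall l t x, 0 <= t <= T -> x < 0 -> derive1n l (zeta t) x = Z l t x)
  (zR : forall l t x, 0 <= t <= T -> 0 < x -> derive1n l (zeta t) x = P l t (- x)).
Let ql j := qlevel V Z Y P j.
Let Q t x := ql 0 t x + ql 1 t x + ql 2 t x.
Hypothesis energy : forall N, 0 < N -> 2 * (c * T) <= N -> forall t, 0 <= t <= T ->
  Num.sqrt (mass eps c N Q t) <= D * expR (- theta * t) * Num.sqrt (mass eps c N Q 0)
   + sint 0 t (fun r => D * expR (- theta * (t - r)) * Num.sqrt (mass eps c N (ql 0) r)).

Let hL t l x := wexp eps x * (V l t x ^+ 2 + Z l t x ^+ 2).
Let hR t l x := wexp eps x * (Y l t x ^+ 2 + P l t x ^+ 2).

Let w0 x : 0 <= wexp eps x. Proof. exact: ltW (wexp_gt0 _ _). Qed.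
Let cw : continuous (wexp eps). Proof. exact: cont_wexp. Qed.
Let c2w : cont2 (fun _ x : R => wexp eps x). Proof. by apply: cont2_of_x. Qed.

Let c2h (A B : R -> R -> R) : cont2 A -> cont2 B -> cont2 (fun t x => A t x ^+ 2 + B t x ^+ 2).
Proof.
move=> cA cB; have h1 : cont2 (fun t x => A t x ^+ 2) by exact: cont2X.
have h2 : cont2 (fun t x => B t x ^+ 2) by exact: cont2X.
exact: (cont2D h1 h2).
Qed.

Let chL t l : continuous (hL t l).
Proof. by have h := cont2_x (cont2M c2w (c2h (@cV l) (@cZ l))) (t := t); exact: h. Qed.

Let chR t l : continuous (hR t l).
Proof. by have h := cont2_x (cont2M c2w (c2h (@cY l) (@cP l))) (t := t); exact: h. Qed.

Let hL0 t l x : 0 <= hL t l x. Proof. by rewrite mulr_ge0// addr_ge0// sqr_ge0. Qed.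
Let hR0 t l x : 0 <= hR t l x. Proof. by rewrite mulr_ge0// addr_ge0// sqr_ge0. Qed.

Let FL m t : 0 <= t <= T -> forall l x, (l <= m)%N -> x < 0 ->
  (derive1n l (v t) x ^+ 2 + derive1n l (zeta t) x ^+ 2) * expR (eps * `|x|) = hL t l x.
Proof. by move=> tT l x _ x0; rewrite vL// zL// ltr0_norm// mulrN -mulNr mulrC. Qed.

Let FR m t : 0 <= t <= T -> forall l x, (l <= m)%N -> 0 < x ->
  (derive1n l (v t) x ^+ 2 + derive1n l (zeta t) x ^+ 2) * expR (eps * `|x|) = hR t l (- x).
Proof. by move=> tT l x _ x0; rewrite vR// zR// gtr0_norm// mulrC /hR /wexp mulrNN. Qed.

Let hql t l x : hL t l x + hR t l x = wexp eps x * ql l t x.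
Proof. by rewrite /hL /hR /ql /qlevel -mulrDr !addrA. Qed.

Let cql l : cont2 (ql l).
Proof.
have h := cont2D (c2h (@cV l) (@cZ l)) (c2h (@cY l) (@cP l)).
rewrite (_ : ql l = fun t x => V l t x ^+ 2 + Z l t x ^+ 2 + (Y l t x ^+ 2 + P l t x ^+ 2)); first exact: h.
by apply/funext => t; apply/funext => x; rewrite /ql /qlevel !addrA.
Qed.

Let cQ : cont2 Q. Proof. exact: (cont2D (cont2D (@cql 0) (@cql 1)) (@cql 2)). Qed.

Let ql0 l t x : 0 <= ql l t x. Proof. by rewrite /ql /qlevel !addr_ge0// sqr_ge0. Qed.
Let Q0 t x : 0 <= Q t x. Proof. exact: (addr_ge0 (addr_ge0 (ql0 0 t x) (ql0 1 t x)) (ql0 2 t x)). Qed.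

Let cwq (q : R -> R -> R) t : cont2 q -> continuous (fun x => wexp eps x * q t x).
Proof. by move=> cq; exact: (cont2_x (cont2M c2w cq)). Qed.

Let cmass N (q : R -> R -> R) : cont2 q -> cont2 (fun t x => cutoff c N t x * (wexp eps x * q t x)).
Proof. by move=> cq; apply: cont2M; [exact: cont2_cutoff|exact: (cont2M c2w cq)]. Qed.

Let level0_sum n t : \sum_(l < 1) sint (- n%:R) 0 (fun x => hL t l x + hR t l x) =
  sint (- n%:R) 0 (fun x => wexp eps x * ql 0 t x).
Proof. rewrite (sum1 (fun l => sint (- n%:R) 0 (fun x => hL t l x + hR t l x))).
by apply: sint_eq => x _; exact: hql. Qed.

Let level2_sum n t : \sum_(l < 3) sint (- n%:R) 0 (fun x => hL t l x + hR t l x) =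
  sint (- n%:R) 0 (fun x => wexp eps x * Q t x).
Proof.
rewrite big_ord_recr /= (sum2 (fun l => sint (- n%:R) 0 (fun x => hL t l x + hR t l x))).
have E l : sint (- n%:R) 0 (fun x => hL t l x + hR t l x) = sint (- n%:R) 0 (fun x => wexp eps x * ql l t x).
  by apply: sint_eq => x _; exact: hql.
have c0' := @cwq (ql 0) t (@cql 0); have c1' := @cwq (ql 1) t (@cql 1); have c2' := @cwq (ql 2) t (@cql 2).
rewrite !E -(sintD _ _ c0' c1') -(sintD _ _ (contD c0' c1') c2').
by apply: sint_eq => x _; rewrite /Q !mulrDr.
Qed.

Let mass_le n (q : R -> R -> R) t : 0 < n%:R :> R -> 0 <= t -> cont2 q -> (forall t x, 0 <= q t x) ->
  mass eps c n%:R q t <= sint (- n%:R) 0 (fun x => wexp eps x * q t x).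
Proof.
move=> n0 t0 cq q0; apply: sint_le; [exact: (cont2_x (@cmass _ _ cq))|exact: cwq|].
move=> x /andP[_ x0]; apply: ler_piMl; first by rewrite mulr_ge0.
exact: cutoff_le1.
Qed.

Let mass_ge n N t : 0 <= t <= T -> 0 < N -> n%:R <= N -> 2 * (n%:R + c * T) <= N ->
  sint (- n%:R) 0 (fun x => wexp eps x * Q t x) <= 4 * mass eps c N Q t.
Proof.
move=> tT N0 nN nT; have cm := cont2_x (@cmass N Q cQ) (t := t).
have c4 : continuous (fun x => 4 * (cutoff c N t x * (wexp eps x * Q t x))).
  by apply: contM; [exact: contC|exact: cm].
have q0 x : 0 <= wexp eps x * Q t x by rewrite mulr_ge0.
rewrite /mass -sintZ; last exact: cm.
apply: (@le_trans _ _ (sint (- n%:R) 0 (fun x => 4 * (cutoff c N t x * (wexp eps x * Q t x))))).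
  apply: sint_le => //; first exact: cwq.
  move=> x /andP[xn x0]; rewrite mulrA; apply: ler_peMl => //.
  have := @cutoff_ge _ c N t x _ _ c0 tT xn N0 nT; rewrite -(ler_pM2l (ltr0n R 4)).
  by rewrite divff.
apply: sint_widen => //; first by rewrite lerN2.
by move=> x _; rewrite mulr_ge0// mulr_ge0// cutoff_ge0.
Qed.

(** Fix a segment [- n0, 0].  For N large the cutoff is at least 1 / 4 on it up to time T, so that the
    mass on it is at most 4 times the cut-off mass; the cut-off masses on the right-hand side are below the
    norms because the cutoff is at most 1.  Hence the factor 2 after taking square roots. *)
Theorem norm_estimate t : 0 <= t <= T ->
  (wHnorm 2 eps (v t) (zeta t) <= (2 * D * expR (- theta * t))%:E * wHnorm 2 eps (v 0) (zeta 0)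
    + \int[mu]_(s in `[0%R, t]) ((2 * D * expR (- theta * (t - s)))%:E * wHnorm 0 eps (v s) (zeta s)))%E.
Proof.
move=> tT; have /andP[t0 tT'] := tT.
have z0T : 0 <= (0 : R) <= T by rewrite lexx T0.
apply: (wHnorm_le (@chL t) (@chR t) (hL0 t) (hR0 t) (@FL 2 t tT) (@FR 2 t tT)) => n0.
rewrite level2_sum.
pose n := (Num.truncn (2 * (n0%:R + c * T) + n0%:R)).+1.
have cT : 0 <= c * T by rewrite mulr_ge0.
have n00 : 0 <= n0%:R :> R by exact: ler0n.
have nbig : 2 * (n0%:R + c * T) + n0%:R <= n%:R by apply: ltW; exact: truncnS_gt.
have nn : 0 < n%:R :> R by rewrite ltr0n.
have nn0 : n0%:R <= n%:R :> R by lra.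
have nT : 2 * (n0%:R + c * T) <= n%:R by lra.
have nT' : 2 * (c * T) <= n%:R by lra.
have b0 : ((Num.sqrt (mass eps c n%:R Q 0))%:E <= wHnorm 2 eps (v 0) (zeta 0))%E.
  have := wHnorm_ge (@chL 0) (@chR 0) (hL0 0) (hR0 0) (@FL 2 0 z0T) (@FR 2 0 z0T) n.
  apply: le_trans; rewrite lee_fin level2_sum; apply: ler_wsqrtr.
  exact: mass_le.
have bs s : 0 <= s <= t -> ((Num.sqrt (mass eps c n%:R (ql 0) s))%:E <= wHnorm 0 eps (v s) (zeta s))%E.
  move=> /andP[s0 st]; have sT : 0 <= s <= T by rewrite s0 (le_trans st).
  have := wHnorm_ge (@chL s) (@chR s) (hL0 s) (hR0 s) (@FL 0 s sT) (@FR 0 s sT) n.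
  apply: le_trans; rewrite lee_fin level0_sum; apply: ler_wsqrtr.
  exact: mass_le.
have cm : continuous (mass eps c n%:R (ql 0)) by apply: sint_cont; exact: cmass.
have ch : continuous (fun r => D * expR (- theta * (t - r)) * Num.sqrt (mass eps c n%:R (ql 0) r)).
  apply: contM; last exact: contsqrt.
  rewrite (_ : (fun r => _) = (fun r => D * (expR (- theta * t) * expR (theta * r)))); last first.
    by apply/funext => r; rewrite -expRD; congr (_ * expR _); ring.
  by apply: contM; [exact: contC|apply: contM; [exact: contC|exact: contEX]].
apply: (@le_trans _ _ (2 * Num.sqrt (mass eps c n%:R Q t))%:E).
  rewrite lee_fin (_ : 2 * _ = Num.sqrt (4 * mass eps c n%:R Q t)).
    by apply: ler_wsqrtr; exact: mass_ge.
  rewrite sqrtrM// (_ : 4 = 2 ^+ 2 :> R); last by ring.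
  by rewrite sqrtr_sqr ger0_norm.
apply: (@le_trans _ _ (2 * D * expR (- theta * t) * Num.sqrt (mass eps c n%:R Q 0)
   + sint 0 t (fun r => 2 * D * expR (- theta * (t - r)) * Num.sqrt (mass eps c n%:R (ql 0) r)))%:E).
  rewrite lee_fin (_ : sint _ _ _ = 2 * sint 0 t
      (fun r => D * expR (- theta * (t - r)) * Num.sqrt (mass eps c n%:R (ql 0) r))); last first.
    by rewrite -sintZ//; apply: sint_eq => r _; rewrite !mulrA.
  rewrite -!mulrA -mulrDr ler_wpM2l// mulrA; exact: energy.
rewrite EFinD; apply: leeD.
  by rewrite EFinM; apply: lee_wpmul2l => //; rewrite lee_fin !mulr_ge0// expR_ge0.
apply: sint_le_integral.
- rewrite (_ : (fun r => _) = (fun r => 2 * (D * expR (- theta * (t - r)) * Num.sqrt (mass eps c n%:R (ql 0) r)))).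
    by apply: contM; [exact: contC|exact: ch].
  by apply/funext => r; rewrite !mulrA.
- by move=> r _; rewrite !mulr_ge0 ?expR_ge0 ?sqrtr_ge0.
- move=> r rt; rewrite EFinM; apply: lee_wpmul2l; first by rewrite lee_fin !mulr_ge0// expR_ge0.
  exact: bs.
Qed.

End norm_estimate.

(** * From perturbative solutions to frames *)

(** On an open set where g agrees with h 0, each h j.+1 being the derivative of h j, all the iterated
    derivatives of g are known, and essential bounds on them are pointwise bounds. *)
Section derivative_chains.
Context {R : realType}.
Notation mu := (@lebesgue_measure R).
Variables (O : R -> Prop) (g : R -> R) (h : nat -> R -> R).
Hypotheses (nO : forall x, O x -> \forall y \near x, O y) (gh : forall x, O x -> g x = h 0%N x)
  (dh : forall j (x : R), is_derive x 1 (h j) (h j.+1 x)).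

Lemma derive1n_chain j x : O x -> derive1n j g x = h j x.
Proof.
elim: j x => [|j IH] x Ox; first exact: gh.
rewrite derive1nS; apply: derive1_is; apply: deriv_near (dh j x).
by near=> y; rewrite IH//; near: y; exact: nO.
Unshelve. all: by end_near. Qed.

Lemma Loo_chain j eta x : ('N[mu]_+oo[EFin \o derive1n j g] < eta%:E)%E -> O x -> `|h j x| <= eta.
Proof.
move=> Ng Ox; rewrite -derive1n_chain//; apply: (Loo_pointwise Ng).
have c : h j y @[y --> x] --> h j x by exact: (is_derive_cont (dh j x)).
suff : derive1n j g y @[y --> x] --> derive1n j g x by [].
rewrite derive1n_chain//; apply: cvg_trans c; apply: near_eq_cvg.
by near=> y; rewrite derive1n_chain//; near: y; exact: nO.
Unshelve. all: by end_near. Qed.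

End derivative_chains.

Section solution.
Context {R : realType}.
Variables (f U ubar zbar psi : R -> R) (k q u_i sg T : R) (u z Gl Gr Zl Zr : R -> R -> R).
Hypotheses (sU : smooth U) (T0 : 0 < T) (sGl : smooth2 Gl) (sGr : smooth2 Gr)
  (sZl : smooth2 Zl) (sZr : smooth2 Zr) (cpsi : {within `[0, T], continuous psi}).
Hypotheses
  (uL : forall t x, 0 <= t <= T /\ x < psi t -> u t x = Gl t x)
  (uR : forall t x, 0 <= t <= T /\ psi t < x -> u t x = Gr t x)
  (zL : forall t x, 0 <= t <= T /\ x < psi t -> z t x = Zl t x)
  (zR : forall t x, 0 <= t <= T /\ psi t < x -> z t x = Zr t x).
Hypotheses (ubarL : forall x, x < 0 -> ubar x = U x) (ubarR : forall x, 0 < x -> ubar x = 0)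
  (zbarL : forall x, x < 0 -> zbar x = expR (k * x / sg)) (zbarR : forall x, 0 < x -> zbar x = 1).

Let V := pertV T U psi Gl.
Let Z := pertZ k sg T psi Zl.
Let Y := pertY T psi Gr.
Let P := pertP T psi Zr.

Let m1 G (t x : R) j : smooth2 G -> is_derive x 1 (moving T psi 1 (dxn j G) t) (moving T psi 1 (dxn j.+1 G) t x).
Proof. by move=> sG; have := moving_dx T psi 1 t x (smooth2_dxn j sG); rewrite mul1r. Qed.

Let reflect G t x : moving T psi (-1) G t (- x) = moving T psi 1 G t x.
Proof. by rewrite /moving mulrNN. Qed.

Let dV (t : R) j (x : R) : is_derive x 1 (V j t) (V j.+1 t x).
Proof. exact: (derivB (m1 t x j sGl) (smooth_d j x sU)). Qed.

Let dZ (t : R) j (x : R) : is_derive x 1 (Z j t) (Z j.+1 t x).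
Proof.
have := derivB (m1 t x j sZl) (derivZ ((k / sg) ^+ j) (derivEX (k / sg) x)).
by rewrite mulrA -exprSr.
Qed.

Let dY (t : R) j (x : R) : is_derive x 1 (fun x => Y j t (- x)) (Y j.+1 t (- x)).
Proof.
rewrite /Y /pertY reflect; apply: deriv_near (m1 t x j sGr).
by near=> y; rewrite reflect.
Unshelve. all: by end_near. Qed.

Let dP (t : R) j (x : R) : is_derive x 1 (fun x => P j t (- x)) (P j.+1 t (- x)).
Proof.
rewrite /P /pertP reflect; apply: deriv_near (derivB (m1 t x j sZr) (derivC _ x)).
by near=> y; rewrite reflect.
Unshelve. all: by end_near. Qed.

Let nL (x : R) : x < 0 -> \forall y \near x, y < 0.
Proof. exact: lt_nbhsl. Qed.
Let nR (x : R) : 0 < x -> \forall y \near x, 0 < y.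
Proof. exact: lt_nbhsr. Qed.

Let VE t : 0 <= t <= T -> forall x, x < 0 -> pert psi ubar u t x = V 0 t x.
Proof.
move=> tT x x0; rewrite /pert /V /pertV movingE//= mul1r uL; last by rewrite gtrDr.
by rewrite ubarL.
Qed.

Let ZE t : 0 <= t <= T -> forall x, x < 0 -> pert psi zbar z t x = Z 0 t x.
Proof.
move=> tT x x0; rewrite /pert /Z /pertZ movingE//= mul1r zL; last by rewrite gtrDr.
by rewrite zbarL// mul1r (mulrAC k x).
Qed.

Let YE t : 0 <= t <= T -> forall x, 0 < x -> pert psi ubar u t x = Y 0 t (- x).
Proof.
move=> tT x x0; rewrite /pert /Y /pertY reflect movingE//= mul1r uR; last by rewrite ltrDr.
by rewrite ubarR// subr0.
Qed.

Let PE t : 0 <= t <= T -> forall x, 0 < x -> pert psi zbar z t x = P 0 t (- x).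
Proof.
move=> tT x x0; rewrite /pert /P /pertP reflect movingE//= mul1r zR; last by rewrite ltrDr.
by rewrite zbarR.
Qed.

Lemma pert_left_u l t x : 0 <= t <= T -> x < 0 -> derive1n l (pert psi ubar u t) x = V l t x.
Proof. by move=> tT; exact: (derive1n_chain nL (VE tT) (dV t)). Qed.

Lemma pert_left_z l t x : 0 <= t <= T -> x < 0 -> derive1n l (pert psi zbar z t) x = Z l t x.
Proof. by move=> tT; exact: (derive1n_chain nL (ZE tT) (dZ t)). Qed.

Lemma pert_right_u l t x : 0 <= t <= T -> 0 < x -> derive1n l (pert psi ubar u t) x = Y l t (- x).
Proof. by move=> tT; exact: (derive1n_chain nR (YE tT) (dY t)). Qed.

Lemma pert_right_z l t x : 0 <= t <= T -> 0 < x -> derive1n l (pert psi zbar z t) x = P l t (- x).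
Proof. by move=> tT; exact: (derive1n_chain nR (PE tT) (dP t)). Qed.

Variable eta : R.
Hypothesis small : forall t, 0 <= t <= T ->
  (W1oo_norm (pert psi ubar u t) (pert psi zbar z t) < eta%:E)%E.

Let small4 t : 0 <= t <= T -> forall j, (j <= 1)%N ->
  ('N[@lebesgue_measure R]_+oo[EFin \o derive1n j (pert psi ubar u t)] < eta%:E)%E /\
  ('N[@lebesgue_measure R]_+oo[EFin \o derive1n j (pert psi zbar z t)] < eta%:E)%E.
Proof.
move=> tT [|[|//]] _; have := small tT; rewrite /W1oo_norm !gt_max => /andP[/andP[h1 h2] /andP[h3 h4]].
  by split.
by rewrite !derive1n1.
Qed.

Let clampT t : 0 <= clamp T t <= T. Proof. by apply: clamp_in; exact: ltW. Qed.

Let to0 (h : R -> R) : continuous h -> (forall x, x < 0 -> `|h x| <= eta) -> forall x, x <= 0 -> `|h x| <= eta.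
Proof.
move=> ch Hh; apply: (le_left_closure _ Hh) => x.
by apply: cvg_norm; exact: ch.
Qed.

Let moving_clamp b G t : moving T psi b G (clamp T t) = moving T psi b G t.
Proof. by rewrite /moving clamp_id. Qed.

Let is_cont (h h' : R -> R) : (forall x : R, is_derive x 1 h (h' x)) -> continuous h.
Proof. by move=> dh x; exact: (is_derive_cont (dh x)). Qed.

Lemma pertV_small j t x : (j <= 1)%N -> x <= 0 -> `|V j t x| <= eta.
Proof.
move=> j1; apply: to0; first exact: (is_cont (dV t j)).
move=> y y0; have -> : V j t y = V j (clamp T t) y by rewrite /V /pertV moving_clamp.
exact: (Loo_chain nL (VE (clampT t)) (dV (clamp T t)) (small4 (clampT t) j1).1 y0).
Qed.

Lemma pertY_small j t x : (j <= 1)%N -> x <= 0 -> `|Y j t x| <= eta.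
Proof.
move=> j1; apply: to0.
  by apply: (@is_cont _ (fun x => - 1 * Y j.+1 t x)) => y; exact: (moving_dx T psi (-1) t y (smooth2_dxn j sGr)).
move=> y y0; have -> : Y j t y = Y j (clamp T t) (- - y) by rewrite /Y /pertY moving_clamp opprK.
have y0' : 0 < - y by rewrite oppr_gt0.
exact: (Loo_chain nR (YE (clampT t)) (dY (clamp T t)) (small4 (clampT t) j1).1 y0').
Qed.

Lemma pertP_small t x : x <= 0 -> `|P 0 t x| <= eta.
Proof.
apply: to0.
  apply: (@is_cont _ (fun x => - 1 * moving T psi (-1) (dxn 1 Zr) t x - 0)) => y.
  exact: (derivB (moving_dx T psi (-1) t y (smooth2_dxn 0 sZr)) (derivC _ y)).
move=> y y0; have -> : P 0 t y = P 0 (clamp T t) (- - y) by rewrite /P /pertP moving_clamp opprK.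
have y0' : 0 < - y by rewrite oppr_gt0.
exact: (Loo_chain nR (PE (clampT t)) (dP (clamp T t)) (small4 (clampT t) (leq0n 1)).2 y0').
Qed.

Hypotheses (sf : smooth f) (hot : forall x, x <= 0 -> u_i + eta < U x) (cold : eta <= u_i).
Hypothesis sol : perturbative_solution f k q u_i ubar zbar T psi u z.

Let oT t : 0 < t < T -> 0 <= t <= T.
Proof. by move=> /andP[t_0 tT]; rewrite !ltW. Qed.

Let cpsi_at t : 0 < t < T -> {for t, continuous psi}.
Proof. by move=> tT; exact: (is_derive_cont (pert_RH_u sol tT)). Qed.

(** Behind the front the wave exceeds the ignition threshold by more than eta, and ahead of it u is at
    most eta, so that the sign of u - u_i is the one of the wave. *)
Let ignition_left t y : 0 < t < T -> y < psi t -> ignition u_i (u t y) = 1.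
Proof.
move=> tT yp; have x0 : y - psi t < 0 by rewrite subr_lt0.
have := pertV_small t (leq0n 1) (ltW x0); rewrite -(VE (oT tT) x0) /pert subrK ubarL//.
rewrite ler_norml => /andP[h _]; have := hot (ltW x0) => h2.
by rewrite /ignition ifT//; move: h h2; move: (u t y) (U _) => a b; lra.
Qed.

Let ignition_right t y : 0 < t < T -> psi t < y -> ignition u_i (u t y) = 0.
Proof.
move=> tT yp; have x0 : 0 < y - psi t by rewrite subr_gt0.
have x0' : - (y - psi t) <= 0 by rewrite oppr_le0 ltW.
have := pertY_small t (leq0n 1) x0'; rewrite -(YE (oT tT) x0) /pert subrK ubarR// subr0.
rewrite ler_norml => /andP[_ h].
by rewrite /ignition ifF//; apply/negbTE; rewrite -leNgt; apply: le_trans cold.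
Qed.

Lemma left_eq_u t y : 0 < t < T -> y < psi t ->
  dt Gl t y + derive1n 1 f (Gl t y) * dx Gl t y - k * q * Zl t y = 0.
Proof.
move=> tT yp; have /eqP ne := lt_eqF yp.
have := pert_eq_u sol tT ne; rewrite ignition_left// mulr1 zL; last by split => //; exact: oT.
rewrite (transfer_dt tT (near_lt_curve (cpsi_at tT) yp) uL sGl).
rewrite (@transfer_dx _ (fun t x => x < psi t) u Gl f T t y (oT tT) (lt_nbhsl yp) uL sGl sf).
by move=> ->; rewrite subrr.
Qed.

Lemma left_eq_z t y : 0 < t < T -> y < psi t -> dt Zl t y + k * Zl t y = 0.
Proof.
move=> tT yp; have /eqP ne := lt_eqF yp.
have := pert_eq_z sol tT ne; rewrite ignition_left// mulr1 zL; last by split => //; exact: oT.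
rewrite (transfer_dt tT (near_lt_curve (cpsi_at tT) yp) zL sZl).
by move=> ->; rewrite mulNr addNr.
Qed.

Lemma right_eq_u t y : 0 < t < T -> psi t < y ->
  dt Gr t y + derive1n 1 f (Gr t y) * dx Gr t y - 0 * Zr t y = 0.
Proof.
move=> tT yp; have /eqP ne := gt_eqF yp.
have := pert_eq_u sol tT ne; rewrite ignition_right// mulr0 !mul0r.
rewrite (transfer_dt tT (near_gt_curve (cpsi_at tT) yp) uR sGr).
rewrite (@transfer_dx _ (fun t x => psi t < x) u Gr f T t y (oT tT) (lt_nbhsr yp) uR sGr sf).
by move=> ->; rewrite subrr.
Qed.

Lemma right_eq_z t y : 0 < t < T -> psi t < y -> dt Zr t y + 0 * Zr t y = 0.
Proof.
move=> tT yp; have /eqP ne := gt_eqF yp.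
have := pert_eq_z sol tT ne; rewrite ignition_right// mulr0 !mul0r.
rewrite (transfer_dt tT (near_gt_curve (cpsi_at tT) yp) zR sZr).
by move=> ->; rewrite addr0.
Qed.

Let cont_at (G : R -> R -> R) t : smooth2 G -> continuous (G t).
Proof. by move=> sG; have h := cont2_x (smooth2_cont sG) (t := t); exact: h. Qed.

Let m0 b G (t : R) : 0 < t < T -> moving T psi b G t 0 = G t (psi t).
Proof. by move=> tT; rewrite movingE ?oT// mulr0 add0r. Qed.

Let trace_l w G (t : R) : 0 < t < T -> smooth2 G -> (forall t x, 0 <= t <= T /\ x < psi t -> w t x = G t x) ->
  ltrace (w t) (psi t) = moving T psi 1 G t 0.
Proof.
move=> tT sG wG; rewrite m0//; apply: ltraceE; first exact: cont_at.
by move=> x xp; apply: wG; split => //; exact: oT.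
Qed.

Let trace_r w G (t : R) : 0 < t < T -> smooth2 G -> (forall t x, 0 <= t <= T /\ psi t < x -> w t x = G t x) ->
  rtrace (w t) (psi t) = moving T psi (-1) G t 0.
Proof.
move=> tT sG wG; rewrite m0//; apply: rtraceE; first exact: cont_at.
by move=> x xp; apply: wG; split => //; exact: oT.
Qed.

Lemma solution_speed t : 0 < t < T -> is_derive t 1 psi (shock_speed T f psi Gl Gr t).
Proof.
move=> tT; have := pert_RH_u sol tT.
by rewrite (trace_l tT sGl uL) (trace_r tT sGr uR).
Qed.

Lemma solution_zcont t : 0 < t < T -> moving T psi 1 Zl t 0 = moving T psi (-1) Zr t 0.
Proof.
by move=> tT; have := pert_RH_z sol tT; rewrite (trace_l tT sZl zL) (trace_r tT sZr zR).
Qed.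

End solution.

Section continuity.
Context {R : realType}.
Variables (k sg T : R) (U psi : R -> R).
Hypotheses (T0 : 0 < T) (sU : smooth U) (cpsi : {within `[0, T], continuous psi}).

Let cm (b : R) j G : smooth2 G -> cont2 (moving T psi b (dxn j G)).
Proof.
by move=> sG; apply: (moving_cont (ltW T0) cpsi); apply: smooth2_cont; exact: smooth2_dxn.
Qed.

Lemma cont2_pertV G j : smooth2 G -> cont2 (pertV T U psi G j).
Proof.
move=> sG; have h1 := @cm 1 j G sG.
have h2 : cont2 (fun _ x : R => derive1n j U x) by apply: cont2_of_x; exact: smooth_c.
exact: (cont2B h1 h2).
Qed.

Lemma cont2_pertZ G j : smooth2 G -> cont2 (pertZ k sg T psi G j).
Proof.
move=> sG; have h1 := @cm 1 j G sG.
have h2 : cont2 (fun _ x : R => (k / sg) ^+ j * expR (k / sg * x)).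
  apply: (@cont2_of_x _ (fun x => (k / sg) ^+ j * expR (k / sg * x))).
  by apply: contM; [exact: contC|exact: contEX].
exact: (cont2B h1 h2).
Qed.

Lemma cont2_pertY G j : smooth2 G -> cont2 (pertY T psi G j).
Proof. exact: cm. Qed.

Lemma cont2_pertP G j : smooth2 G -> cont2 (pertP T psi G j).
Proof. by move=> sG; have h1 := @cm (-1) j G sG; exact: (cont2B h1 (@cont2C _ _)). Qed.

End continuity.

(** * The decay estimate *)

Lemma exists_small (R : realFieldType) (s : seq (R * R)) :
  all (fun p => (0 <= p.1) && (0 < p.2)) s ->
  exists2 eta, 0 < eta & all (fun p => p.1 * eta <= p.2) s.
Proof.
elim: s => [|[a b] s IH] /=; first by exists 1.
move=> /andP[/andP[a0 b0] Hs]; have [eta eta0 Heta] := IH Hs.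
have a1 : 0 < a + 1 by rewrite ltr_wpDl.
exists (Num.min eta (b / (a + 1))); first by rewrite lt_min eta0 divr_gt0.
apply/andP; split.
  apply: (@le_trans _ _ (a * (b / (a + 1)))); first by rewrite ler_wpM2l// ge_min lexx orbT.
  by rewrite mulrA ler_pdivrMr// mulrC ler_wpM2l ?(ltW b0)// lerDl.
apply/allP => p ps; have /= /andP[p0 _] := allP Hs p ps.
by apply: le_trans (allP Heta p ps); rewrite ler_wpM2l ?ge_min ?lexx.
Qed.

Theorem proposition2p4 (R : realType) (k u_i u0 sigma nu : R) (f : R -> R)
    (k_gt0 : 0 < k) (f_smooth : smooth f)
    (u_i_gt0 : 0 < u_i) (u0_gt : u_i < u0)
    (sigmaE : sigma = (f u0 - f 0) / u0) (sigma_gt0 : 0 < sigma)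
    (nu_gt : sigma < nu)
    (q : R) (ubar zbar : R -> R)
    (wave : detonation_wave f k q u_i u0 sigma ubar zbar) :
  exists theta C eta : R,
    [/\ 0 < theta, 0 < C, 0 < eta &
     forall (T : R) (psi : R -> R) (u z : R -> R -> R),
       0 < T ->
       perturbative_solution f k q u_i ubar zbar T psi u z ->
       (forall t : R, 0 <= t <= T ->
          (W1oo_norm (pert psi ubar u t) (pert psi zbar z t) < eta%:E)%E) ->
       forall t : R, 0 <= t <= T ->
         (wHnorm 2 (k / nu) (pert psi ubar u t) (pert psi zbar z t)
          <= (C * expR (- theta * t))%:E
               * wHnorm 2 (k / nu) (pert psi ubar u 0) (pert psi zbar z 0)
             + \int[@lebesgue_measure R]_(s in `[0%R, t])
                 ((C * expR (- theta * (t - s)))%:E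
                    * wHnorm 0 (k / nu) (pert psi ubar u s)
                        (pert psi zbar z s)))%E].
Proof.
have [U [g [m [sU U0 ubarL ode [g0 um mU gap lax]]]]] := wave_facts f_smooth wave.
have u00 : 0 < u0 by exact: lt_trans u_i_gt0 u0_gt.
have nu0 : 0 < nu by exact: lt_trans sigma_gt0 nu_gt.
have kap0 : 0 < k / sigma by exact: divr_gt0.
have eps0 : 0 < k / nu by exact: divr_gt0.
have [Cw Cw0 HU] := profile_bound f_smooth sU U0 kap0 g0 gap ode.
have [M M0 HM] := smooth_bounded (Cw + 1) f_smooth.
pose c := max_speed M nu; pose c1 := min_speed g sigma.
pose A1 := linear_rate M Cw; pose CF := frame_const k (k * q) sigma nu u0 Cw M.
pose Cs := 2 * (M + sigma) / u0.
have c10 : 0 < c1 by rewrite lt_min !divr_gt0.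
have c0 : 0 <= c by rewrite addr_ge0// ltW.
have c1c : c1 <= c.
  apply: (@le_trans _ _ (sigma / 2)); first by rewrite ge_min lexx orbT.
  rewrite /c /max_speed; move: M0 nu_gt sigma_gt0; clear; lra.
have A10 : 0 <= A1 by rewrite /A1 /linear_rate !mulr_ge0// addr_ge0.
have CF0 : 0 <= CF by exact: frame_const_ge0.
have Cs0 : 0 <= Cs by rewrite /Cs divr_ge0 ?(ltW u00)// mulr_ge0// addr_ge0// ltW.
have epsnu : k / nu * nu <= k by rewrite divfK// gt_eqF.
have epskap : k / nu < 2 * (k / sigma).
  have h : k / nu < k / sigma by rewrite ltr_pM2l// ltf_pV2.
  by move: h kap0; move: (k / nu) (k / sigma) => a b; lra.
have [theta [D [theta0 D0 energy]]] :=
  frame_energy sigma k_gt0 (ltW nu0) c10 c1c A10 CF0 kap0 eps0 epsnu epskap.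
(* The conditions are, in order: derivatives of f are evaluated within the range of M; u stays below
   the ignition threshold ahead of the front and above it behind; the jump of u is at least u0 / 2; the
   characteristic speeds stay on their sides of psi'; psi' is at least sigma / 2 and at most nu; the
   small terms are absorbed by the decay. *)
have [eta eta0] : exists2 eta, 0 < eta & all (fun p => p.1 * eta <= p.2)
    [:: (1, 1); (1, u_i); (2, m - u_i); (4, u0); (M + 2 * Cs, g / 2);
      (2 * Cs, sigma / 2); (2 * Cs, nu - sigma); (3 * A1, k / nu * c1 / 2)].
  apply: exists_small.
  have Cs2 : 0 <= 2 * Cs by rewrite mulr_ge0.
  have A3 : 0 <= 3 * A1 by rewrite mulr_ge0.
  rewrite /= !subr_gt0 u_i_gt0 u00 um nu_gt (addr_ge0 M0 Cs2) Cs2 A3 !divr_gt0 ?(mulr_gt0 eps0 c10)//.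
  by rewrite !ler0n ltr01 !ler01.
move=> /= /and5P[eta1 eta_ui eta_m eta_u0 /and5P[eta_g eta_sg eta_nu eta_A _]].
exists theta, (2 * D), eta; split => //; first by rewrite mulr_gt0.
move=> T psi u z T0 sol sm t tT.
have cpsi := pert_psi_cont sol.
have [Gl [sGl uL]] := pert_smooth_l sol (or_introl erefl).
have [Zl [sZl zL]] := pert_smooth_l sol (or_intror erefl).
have [Gr [sGr uR]] := pert_smooth_r sol (or_introl erefl).
have [Zr [sZr zR]] := pert_smooth_r sol (or_intror erefl).
have ubarR x : 0 < x -> ubar x = 0 by move=> /(wave_ahead wave)[].
have zbarR x : 0 < x -> zbar x = 1 by move=> /(wave_ahead wave)[].
have zbarL := wave_zbar wave.
rewrite mul1r in eta1; rewrite mul1r in eta_ui.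
have hot x : x <= 0 -> u_i + eta < U x.
  by move=> /mU; move: eta_m um; clear; lra.
have sgE : f u0 - f 0 = sigma * u0 by rewrite sigmaE divfK// gt_eqF.
have eta_g' : M * eta + 2 * Cs * eta <= g / 2 by rewrite -mulrDl.
have gap1 x : x <= 0 -> sigma + g <= derive1n 1 f (U x) by move=> x0; rewrite derive1n1; exact: gap.
have lax1 : derive1n 1 f 0 <= sigma - g by rewrite derive1n1.
have profile x (x0 : x <= 0) := And3 (profile_eq1 g0 gap ode x0)
  (profile_eq2 f_smooth sU g0 gap ode x0) (profile_eq3 f_smooth sU g0 gap ode x0).
have fr := perturbation_frame f_smooth sU k_gt0 sigma_gt0 nu_gt u00 U0 g0 Cw0 M0 T0 sgE gap1 lax1 HU HM
  profile (ltW eta0) eta1 eta_u0 eta_g' eta_sg eta_nu sGl sGr sZl sZr cpsi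
  (solution_speed sGl sGr uL uR sol) (left_eq_u sU T0 sGl uL zL ubarL sm f_smooth hot sol)
  (left_eq_z sU T0 sGl sZl uL zL ubarL sm hot sol)
  (right_eq_u Zr T0 sGr uR ubarR sm f_smooth eta_ui sol)
  (right_eq_z T0 sGr sZr uR zR ubarR sm eta_ui sol) (solution_zcont sZl sZr zL zR sol)
  (fun t x => pertV_small sU T0 sGl uL ubarL sm t (leq0n 1))
  (fun t x => pertV_small sU T0 sGl uL ubarL sm t (leqnn 1))
  (fun t x => pertY_small T0 sGr uR ubarR sm t (leq0n 1))
  (fun t x => pertY_small T0 sGr uR ubarR sm t (leqnn 1))
  (pertP_small T0 sZr zR zbarR sm).
have cV j : cont2 (pertV T U psi Gl j) by exact: cont2_pertV.
have cZ j : cont2 (pertZ k sigma T psi Zl j) by exact: cont2_pertZ.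
have cY j : cont2 (pertY T psi Gr j) by exact: cont2_pertY.
have cP j : cont2 (pertP T psi Zr j) by exact: cont2_pertP.
apply: (@norm_estimate R (k / nu) c theta D T _ _ _ _ (pert psi ubar u) (pert psi zbar z)
  cV cZ cY cP c0 (ltW D0) (ltW T0) (fun l t x => @pert_left_u _ _ _ _ _ _ _ sU sGl uL ubarL l t x) _ _ _ _ t tT).
- exact: (pert_right_u sGr uR ubarR).
- exact: (pert_left_z sZl zL zbarL).
- exact: (pert_right_z sZr zR zbarR).
- exact: (energy _ _ _ _ _ _ _ (ltW eta0) eta_A fr).
Qed.
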